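(* Let $(M,F)$ be a Finsler manifold, let $m\ge 1$ be an integer and let $\kappa_1,\dots,\kappa_m$ be real constants. Let $D$ be the Shen-type connection on $\pi^*TM$ with constants $\kappa_1,\dots,\kappa_m$, i.e. the Finsler connection with compatible tensors $S=\kappa_1\dot A+\cdots+\kappa_m\overset{m}{A}$ and $T=0$. Then the hv-curvature of $D$ vanishes identically if and only if $F$ is Riemannian.
   Context: **Finsler structure.** $M$ is an $n$-dimensional $C^\infty$ manifold, $TM_0=TM\setminus\{0\}$, $\pi:TM_0\to M$ the projection. A Finsler structure is a function $F:TM\to[0,\infty)$ that is $C^\infty$ on $TM_0$, positively 1-homogeneous on the fibers, and such that $g_{ij}(x,y)=\frac12[F^2]_{y^iy^j}$ is positive definite on $TM_0$. $F$ is Riemannian if the $g_{ij}(x,y)$ are independent of $y\neq0$. $\pi^*TM$ is the pull-back of $TM$ over $TM_0$ (fiber over $v\in T_xM\setminus\{0\}$ is a copy of $T_xM$), with local frame $\partial_i|_v=(v,\partial/\partial x^i|_x)$ and canonical section $\ell_v=(v,v)/F(v)$. $g$ is the bundle metric on $\pi^*TM$ with $g(\partial_i,\partial_j)=g_{ij}$. The Cartan tensor $A$ is the symmetric trilinear form on $\pi^*TM$ with components $A_{ijk}=\frac14F\,[F^2]_{y^iy^jy^k}$. **Finsler connections.** $\rho:T(TM_0)\to\pi^*TM$ is the linear bundle map with $\rho(\partial/\partial x^i)=\partial_i$, $\rho(\partial/\partial y^i)=0$; the vertical space is $V_zTM=\ker\rho_z$. For a linear connection $D$ on the bundle $\pi^*TM$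 put $\mu(\hat X)=D_{\hat X}(F\ell)$. $D$ is a Finsler connection if $\mu_z$ restricted to $V_zTM$ is an isomorphism onto the fiber of $\pi^*TM$ for every $z\in TM_0$; then $T_zTM_0=H_zTM\oplus V_zTM$ with horizontal space $H_zTM=\ker\mu_z$, and $\hat X=H\hat X+V\hat X$ denotes the decomposition. **Derivatives of $A$.** Let $\bar\ell$ be the horizontal vector field with $\rho(\bar\ell)=\ell$. Put $\overset{0}{A}=A$ and $$\overset{j+1}{A}(X,Y,Z)=\bar\ell\,\overset{j}{A}(X,Y,Z)-\overset{j}{A}(D_{\bar\ell}X,Y,Z)-\overset{j}{A}(X,D_{\bar\ell}Y,Z)-\overset{j}{A}(X,Y,D_{\bar\ell}Z);$$ write $\dot A=\overset{1}{A}$, $\ddot A=\overset{2}{A}$. **Connection with compatible tensors $S,T$.** $S,T$ are symmetric trilinear forms on $\pi^*TM$; define $T(X,Y)\in\pi^*TM$ by $g(T(X,Y),Z)=T(X,Y,Z)$. $D$ is the Finsler connection with compatible tensors $S,T$ if for all $\hat X,\hat Y,\hat Z$ tangent to $TM_0$ and sections $X,Y$ of $\pi^*TM$: (i) $D_{\hat X}\rho(\hat Y)-D_{\hat Y}\rho(\hat X)-\rho[\hat X,\hat Y]=F^{-1}T(\mu(\hat X),\rho(\hat Y))-F^{-1}T(\mu(\hat Y),\rho(\hat X))$; (ii) $(D_{\hat Z}g)(X,Y)=2A(\rho(\hat Z),X,Y)+2F^{-1}A(\mu(\hat Z),X,Y)-2S(\rho(\hat Z),X,Y)-2F^{-1}T(\mu(\hat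 Z),X,Y)$. (Such a connection exists and is unique for the $S,T$ considered here.) When $S$ involves $\overset{j}{A}$, these are formed with $D$ itself. **hv-curvature.** With $\Omega(\hat X,\hat Y)Z=D_{\hat X}D_{\hat Y}Z-D_{\hat Y}D_{\hat X}Z-D_{[\hat X,\hat Y]}Z$, the hv-curvature of $D$ is $P=\Omega(H\hat X,V\hat Y)$; it vanishes if $\Omega(H\hat X,V\hat Y)Z=0$ for all $\hat X,\hat Y,Z$.
   Formalization: The dimension n = 1 is excluded: there the claim fails, e.g. on M = R with F = y for y > 0 and F = -2y for y < 0, where A = 0 and the hv-curvature vanishes but g_ij depends on the sign of y, so F is not Riemannian. *)

(* Defs.v *)
From HB Require Import structures.
From mathcomp Require Import all_boot all_order all_algebra.
From mathcomp Require Import all_classical all_reals all_analysis.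

Set Implicit Arguments.
Unset Strict Implicit.
Unset Printing Implicit Defensive.

Import Order.TTheory GRing.Theory Num.Theory.
Import numFieldNormedType.Exports.

Local Open Scope classical_set_scope.
Local Open Scope ring_scope.

(* C^oo on an open set [U] of a finite-dimensional space: every iterated
   directional derivative (the empty iteration being [f] itself) is Frechet
   differentiable at every point of [U]. *)
Definition smooth_on (R : realType) (E G : normedModType R)
    (U : set E) (f : E -> G) : Prop :=
  forall (vs : seq E) (p : E), U p ->
    differentiable (foldr (fun v (g : E -> G) => 'D_v g) f vs) p.

(* n-dimensional C^oo manifolds, given by an atlas.  [mpsi i] is the inverse of
   the chart [mphi i]; its values outside [mphi i @` mdom i] are irrelevant.
   [mat x] is a chart chosen around [x]; it is only used to name tangent
   vectors (see [tangent_bundle]). *)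
Record manifold (R : realType) (n : nat) := Manifold {
  mcarrier :> topologicalType ;
  mhausdorff : hausdorff_space mcarrier ;
  msecond_countable : @second_countable mcarrier ;
  midx : Type ;
  mdom : midx -> set mcarrier ;
  mphi : midx -> mcarrier -> 'rV[R]_n ;
  mpsi : midx -> 'rV[R]_n -> mcarrier ;
  mat : mcarrier -> midx ;
  mdom_open : forall i, open (mdom i) ;
  mimg_open : forall i, open (mphi i @` mdom i) ;
  mphiK : forall i x, mdom i x -> mpsi i (mphi i x) = x ;
  mphi_continuous : forall i x, mdom i x -> {for x, continuous (mphi i)} ;
  mpsi_continuous : forall i x, mdom i x ->
    {for mphi i x, continuous (mpsi i)} ;
  mat_dom : forall x, mdom (mat x) x ;
  mtrans_smooth : forall i j,
    smooth_on (mphi i @` (mdom i `&` mdom j)) (mphi j \o mpsi i)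
}.

Section TangentBundle.
Variables (R : realType) (n : nat) (M : manifold R n).

Local Notation V := 'rV[R]_n.

(* Tangent change of coordinates at [x] from the chart [i] to the chart [j]. *)
Definition tcoord (i j : midx M) (x : M) : V -> V :=
  'd (@mphi _ _ M j \o @mpsi _ _ M i) (mphi i x).

(* T_x M is identified with R^n through the chart [mat x]: the pair [(x, v)]
   is the tangent vector at [x] with components [v] in the chart [mat x].  Its
   components in another chart [i] at [x] are [tcoord (mat x) i x v]. *)
Definition tangent_bundle : Type := (mcarrier M * V)%type.

Local Notation TM := tangent_bundle.

(* Natural coordinates (x^1 .. x^n, y^1 .. y^n) of TM over the chart [i]. *)
Definition tphi (i : midx M) (z : TM) : V * V :=
  (mphi i z.1, tcoord (mat z.1) i z.1 z.2).

Definition tpsi (i : midx M) (p : V * V) : TM :=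
  let x := mpsi i p.1 in (x, tcoord i (mat x) x p.2).

Definition TM0 : set TM := [set z | z.2 != 0].

(* The part of the coordinate domain of the chart [i] that lies in [W]. *)
Definition tloc (i : midx M) (W : set TM) : set (V * V) :=
  [set p | (mphi i @` mdom i) p.1 /\ W (tpsi i p)].

Definition open_TM0 (W : set TM) : Prop :=
  W `<=` TM0 /\ forall i : midx M, open (tloc i W).

Definition fsmooth (W : set TM) (f : TM -> R) : Prop :=
  forall i : midx M, smooth_on (tloc i W) (f \o tpsi i).

(* Sections of pi^*TM: the fibre over z = (x, v) is a copy of T_x M, so it is
   identified with R^n through the chart [mat x] as well. *)
Definition section := TM -> V.

(* Components of a section in the frame \partial_1, .., \partial_n of the
   chart [i], as functions of the natural coordinates. *)
Definition srep (i : midx M) (Y : section) (p : V * V) : V :=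
  let z := tpsi i p in tcoord (mat z.1) i z.1 (Y z).

Definition ssmooth (W : set TM) (Y : section) : Prop :=
  forall i : midx M, smooth_on (tloc i W) (srep i Y).

(* The local frame section with constant components [v] in the chart [i]. *)
Definition frame (i : midx M) (v : V) : section :=
  fun z => tcoord i (mat z.1) z.1 v.

(* Vector fields on TM_0: the tangent vector (a, b) at z = (x, v) is
   a^k \partial/\partial x^k + b^k \partial/\partial y^k in the natural
   coordinates over the chart [mat x]. *)
Definition vfield := TM -> V * V.

Definition vrep (i : midx M) (X : vfield) (p : V * V) : V * V :=
  let z := tpsi i p in
  'd (tphi i \o tpsi (mat z.1)) (tphi (mat z.1) z) (X z).

Definition vsmooth (W : set TM) (X : vfield) : Prop :=
  forall i : midx M, smooth_on (tloc i W) (vrep i X).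

Definition vderiv (z : TM) (xi : V * V) (f : TM -> R) : R :=
  'D_xi (f \o tpsi (mat z.1)) (tphi (mat z.1) z).

Definition bracket (X Y : vfield) : vfield := fun z =>
  let i := mat z.1 in let p := tphi i z in
  'D_(vrep i X p) (vrep i Y) p - 'D_(vrep i Y p) (vrep i X) p.

Definition rho (X : vfield) : section := fun z => (X z).1.

(* A linear connection: [D z xi Y] is the covariant derivative of [Y] at [z]
   in the direction of the tangent vector [xi] of TM_0 at [z]. *)
Definition connection_data := TM -> V * V -> section -> V.

Definition cov (D : connection_data) (X : vfield) (Y : section) : section :=
  fun z => D z (X z) Y.

(* As usual a connection also acts on local sections and local vector fields;
   a local object over the open set [W] is a globally defined function that is
   only required to be smooth on [W].  Homogeneity over the constants is the
   Leibniz rule with [f] constant; locality follows from the Leibniz rule with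
   [f] the indicator function of an open set. *)
Definition is_connection (D : connection_data) : Prop :=
  forall W : set TM, open_TM0 W ->
  [/\ forall (X : vfield) (Y : section), vsmooth W X -> ssmooth W Y ->
        ssmooth W (cov D X Y),
      forall (Y : section) (z : TM) (a : R) (xi eta : V * V),
        ssmooth W Y -> W z ->
        D z (a *: xi + eta) Y = a *: D z xi Y + D z eta Y,
      forall (Y Y' : section) (z : TM) (xi : V * V),
        ssmooth W Y -> ssmooth W Y' -> W z ->
        D z xi (fun w => Y w + Y' w) = D z xi Y + D z xi Y' &
      forall (f : TM -> R) (Y : section) (z : TM) (xi : V * V),
        fsmooth W f -> ssmooth W Y -> W z ->
        D z xi (fun w => f w *: Y w) = vderiv z xi f *: Y z + f z *: D z xi Y].

(* The tautological section F \ell : v |-> (v, v). *)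
Definition taut : section := fun z => z.2.

Definition mu (D : connection_data) (X : vfield) : section := cov D X taut.

Definition mu_at (D : connection_data) (z : TM) (xi : V * V) : V :=
  D z xi taut.

Definition is_finsler_connection (D : connection_data) : Prop :=
  is_connection D /\
  forall z, TM0 z -> set_bij [set xi : V * V | xi.1 = 0] setT (mu_at D z).

(* For a Finsler connection the set below is a singleton when z \in TM_0: there
   is a unique horizontal vector over each element of the fibre. *)
Definition hlift (D : connection_data) (z : TM) (w : V) : V * V :=
  xget 0 [set xi : V * V | xi.1 = w /\ mu_at D z xi = 0].

Definition hpart (D : connection_data) (X : vfield) : vfield :=
  fun z => hlift D z (X z).1.

Definition vpart (D : connection_data) (X : vfield) : vfield :=
  fun z => X z - hpart D X z.

Definition curvature (D : connection_data) (X Y : vfield) (Z : section) :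
    section := fun z =>
  cov D X (cov D Y Z) z - cov D Y (cov D X Z) z - cov D (bracket X Y) Z z.

Definition hv_curvature (D : connection_data) (X Y : vfield) (Z : section) :
    section :=
  curvature D (hpart D X) (vpart D Y) Z.

Definition hv_curvature_vanishes (D : connection_data) : Prop :=
  forall (W : set TM) (X Y : vfield) (Z : section), open_TM0 W ->
    vsmooth W X -> vsmooth W Y -> ssmooth W Z ->
    forall z, W z -> hv_curvature D X Y Z z = 0.

Section Finsler.
Variable F : TM -> R.

Definition evec (k : 'I_n) : V := delta_mx 0 k.

Definition Fsq (i : midx M) (p : V * V) : R := F (tpsi i p) ^+ 2.

Definition dy (k : 'I_n) (f : V * V -> R) : V * V -> R :=
  'D_((0, evec k) : V * V) f.

Definition g_comp (i : midx M) (p : V * V) : 'M[R]_n :=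
  \matrix_(a, b) (2^-1 * dy b (dy a (Fsq i)) p).

Definition A_comp (i : midx M) (p : V * V) (a b c : 'I_n) : R :=
  4^-1 * F (tpsi i p) * dy c (dy b (dy a (Fsq i))) p.

Definition is_finsler : Prop :=
  [/\ forall z, 0 <= F z,
      fsmooth TM0 F,
      forall (x : M) (v : V) (t : R), 0 < t -> F (x, t *: v) = t * F (x, v) &
      forall (i : midx M) (p : V * V), tloc i TM0 p ->
        forall u : V, u != 0 -> 0 < (u *m g_comp i p *m u^T) 0 0].

(* The fibres of TM_0 are disconnected when n = 1: F(y) = |y| for y > 0 and
   F(y) = 2 |y| for y < 0 has a vanishing Cartan tensor but is not Riemannian in
   this sense. *)
Definition is_riemannian : Prop :=
  forall (i : midx M) (q y y' : V), (mphi i @` mdom i) q ->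
    y != 0 -> y' != 0 -> g_comp i (q, y) = g_comp i (q, y').

Definition metric (X Y : section) (z : TM) : R :=
  (X z *m g_comp (mat z.1) (tphi (mat z.1) z) *m (Y z)^T) 0 0.

(* Trilinear forms on pi^*TM, acting on sections. *)
Definition trilinear := section -> section -> section -> TM -> R.

Definition cartan : trilinear := fun X Y Z z =>
  \sum_(a < n) \sum_(b < n) \sum_(c < n)
    A_comp (mat z.1) (tphi (mat z.1) z) a b c * X z 0 a * Y z 0 b * Z z 0 c.

Definition ell : section := fun z => (F z)^-1 *: z.2.

Definition ellbar (D : connection_data) : vfield :=
  fun z => hlift D z (ell z).

Fixpoint cartan_deriv (D : connection_data) (j : nat) : trilinear :=
  if j is j'.+1 then
    let B := cartan_deriv D j' in
    let nabla := cov D (ellbar D) in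
    fun X Y Z z =>
      vderiv z (ellbar D z) (B X Y Z)
      - B (nabla X) Y Z z - B X (nabla Y) Z z - B X Y (nabla Z) z
  else cartan.

(* The section T(X, Y) with g(T(X, Y), Z) = T(X, Y, Z) for all Z. *)
Definition sharp (T : trilinear) (X Y : section) : section := fun z =>
  let i := mat z.1 in
  (\row_k T X Y (frame i (evec k)) z) *m invmx (g_comp i (tphi i z)).

Definition cov_metric (D : connection_data) (Z : vfield) (X Y : section)
    (z : TM) : R :=
  vderiv z (Z z) (metric X Y) - metric (cov D Z X) Y z - metric X (cov D Z Y) z.

Definition compatible (D : connection_data) (S T : trilinear) : Prop :=
  forall W : set TM, open_TM0 W ->
  (forall X Y : vfield, vsmooth W X -> vsmooth W Y -> forall z, W z ->
     cov D X (rho Y) z - cov D Y (rho X) z - rho (bracket X Y) z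
     = (F z)^-1 *: sharp T (mu D X) (rho Y) z
       - (F z)^-1 *: sharp T (mu D Y) (rho X) z) /\
  (forall (Z : vfield) (X Y : section),
     vsmooth W Z -> ssmooth W X -> ssmooth W Y -> forall z, W z ->
     cov_metric D Z X Y z
     = 2 * cartan (rho Z) X Y z + 2 * (F z)^-1 * cartan (mu D Z) X Y z
       - 2 * S (rho Z) X Y z - 2 * (F z)^-1 * T (mu D Z) X Y z).

Definition connection_with_compatible_tensors
    (D : connection_data) (S T : trilinear) : Prop :=
  is_finsler_connection D /\ compatible D S T.

(* [kappa] is indexed from 0: [kappa j] is the constant \kappa_(j+1). *)
Definition shen_tensor (m : nat) (kappa : 'I_m -> R) (D : connection_data) :
    trilinear := fun X Y Z z =>
  \sum_(j < m) kappa j * cartan_deriv D j.+1 X Y Z z.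

Definition is_shen_connection (m : nat) (kappa : 'I_m -> R)
    (D : connection_data) : Prop :=
  connection_with_compatible_tensors D (shen_tensor kappa D)
    (fun _ _ _ _ => 0).

End Finsler.

End TangentBundle.

(* Main.v *)
Require Import Defs.
From HB Require Import structures.
From mathcomp Require Import all_boot all_order all_algebra.
From mathcomp Require Import all_classical all_reals all_analysis.
From mathcomp Require Import ring lra.

(* In a chart, vanishing torsion makes D a symmetric family of coefficients
   Gamma(x, y) acting in horizontal directions only, and the hv-curvature is the
   fibre derivative of Gamma, up to sign.  Write C for the fibre derivative of g,
   so that A = F C / 2.  The metric condition reads g_{ij|k} = 2 A_{ijk} - 2 S_{ijk}
   =: Q_{kij}, and Q_{kij} y^k = 0.

   If Gamma does not depend on y, the fibre derivative of this equation is
   C_{ijl|k} = d_l Q_{kij}.  Contracting with y^k gives C_{ijl|k} y^k = - Q_{lij},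
   so Q, and then C_{ijl|k}, is totally symmetric; contracting with y^l gives
   C_{ijl|k} y^l = 0, hence C_{ijl|k} y^k = 0 and Q = 0.  So Adot = 0, all higher
   derivatives of A vanish, S = 0, and Q = 0 becomes A = 0.  Since n <> 1 the
   fibres of TM_0 are connected and g does not depend on y.

   Conversely, A = 0 gives S = 0, and Koszul's formula shows that Gamma is the
   Levi-Civita connection of g(x), so it does not depend on y. *)

Set Implicit Arguments.
Unset Strict Implicit.
Unset Printing Implicit Defensive.

Import Order.TTheory GRing.Theory Num.Theory.
Import numFieldNormedType.Exports.

Local Open Scope classical_set_scope.
Local Open Scope ring_scope.

(** * Smooth functions on normed spaces *)

Section Derivatives.
Variable R : realType.
Implicit Types E G H : normedModType R.

(** Neither the constants nor the order m of [S] enter a computation, although [S] is built from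
    derivatives of [A] taken with the unknown [D] itself. Before Q = 0 is known, all that is used of
    [S] is that it vanishes when an argument is the tautological section. [A] has this property
    because g is 0-homogeneous, and differentiation along [ellbar] preserves it because the
    tautological section is parallel in horizontal directions; this is why Q_{kij} y^k = 0. Passing
    from C_{ijl|k} y^k to Adot also needs F to be constant along the spray, which is the metric
    condition evaluated on the tautological section. The curvature reduces to a fibre derivative
    because vertical vectors annihilate chart frames: if h lifts a frame, v is vertical and Z is a
    frame, then [h, v] is vertical and only - D_v D_h Z survives in Omega(h, v) Z. Sections are
    arbitrary functions, smooth only on some open set, and [cartan_deriv] differentiates its
    arguments. The higher derivatives of [A] are therefore treated on sections over an open set, not
    on single vectors. *)

Lemma near_eq_differentiable E G (f g : E -> G) (x : E) :
  (\near x, f x = g x) -> differentiable f x -> differentiable g x.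
Proof.
move=> fg /diff_locallyP[dfc dfx].
have fgx : f x = g x by exact: nbhs_singleton fg.
have dgx : g \o shift x = cst (g x) + 'd f x +o_ 0 id.
  apply/eqaddoP => _/posnumP[e].
  have /eqaddoP/(_ e%:num)/(_ [gt0 of e%:num]) := dfx.
  have : \forall h \near (0 : E), f (h + x) = g (h + x).
    have := fg; rewrite (near_shift 0)/= => fg'.
    near=> h; rewrite -(subr0 x); near: h; exact: fg'.
  by apply: filterS2 => h /= fgh; rewrite -fgx !fctE /= fgh.
have dgE : 'd g x = 'd f x :> (E -> G) by apply: diff_unique.
by apply/diff_locallyP; rewrite dgE; split.
Unshelve. all: by end_near. Qed.

Lemma derive_linear E G (f : E -> G) (p u v : E) (a : R) :
  differentiable f p -> 'D_(a *: u + v) f p = a *: 'D_u f p + 'D_v f p.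
Proof. by move=> df; rewrite !deriveE// linearP. Qed.

Lemma derive_sumv E G (f : E -> G) (p : E) (I : Type) (r : seq I) (P : pred I)
    (u : I -> E) : differentiable f p ->
  'D_(\sum_(i <- r | P i) u i) f p = \sum_(i <- r | P i) 'D_(u i) f p.
Proof.
move=> df; rewrite deriveE// linear_sum.
by apply: eq_bigr => i _; rewrite deriveE.
Qed.

Lemma derive_scalev E G (f : E -> G) (p v : E) (a : R) :
  differentiable f p -> 'D_(a *: v) f p = a *: 'D_v f p.
Proof. by move=> df; rewrite !deriveE// linearZ. Qed.

Lemma derive_addv E G (f : E -> G) (p u v : E) :
  differentiable f p -> 'D_(u + v) f p = 'D_u f p + 'D_v f p.
Proof. by move=> df; rewrite !deriveE// linearD. Qed.

Lemma derive_oppv E G (f : E -> G) (p v : E) :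
  differentiable f p -> 'D_(- v) f p = - 'D_v f p.
Proof. by move=> df; rewrite !deriveE// linearN. Qed.

Lemma derive_comp E G H (f : E -> G) (g : G -> H) (p v : E) :
  differentiable f p -> differentiable g (f p) ->
  'D_v (g \o f) p = 'D_('D_v f p) g (f p).
Proof.
move=> df dg; rewrite !deriveE//; last exact: differentiable_comp.
by rewrite diff_comp.
Qed.

Lemma derive_linear_fun E G (L : {linear E -> G}) (p v : E) :
  continuous L -> 'D_v L p = L v.
Proof.
move=> Lc; rewrite deriveE; last exact: linear_differentiable.
by rewrite diff_lin.
Qed.

Lemma derive_lincomp E G H (L : {linear G -> H}) (f : E -> G) (p v : E) :
  continuous L -> differentiable f p -> 'D_v (L \o f) p = L ('D_v f p).
Proof.
move=> Lc df; rewrite derive_comp// ?derive_linear_fun//.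
exact: linear_differentiable.
Qed.

(** A named copy of scaling, to which a bilinear structure can be attached; the product rule is then
    the differential of a continuous bilinear map. *)
Definition scale_map G (a : R) (v : G) : G := a *: v.

Lemma scale_map_is_bilinear G : bilinear_for
  (GRing.Scale.Law.clone _ _ *:%R _) (GRing.Scale.Law.clone _ _ *:%R _)
  (@scale_map G).
Proof.
split=> [u'|u] a x y; rewrite /scale_map /=; first by rewrite scalerDl scalerA.
by rewrite scalerDr !scalerA mulrC.
Qed.

HB.instance Definition _ G := bilinear_isBilinear.Build R R G G _ _
  (@scale_map G) (@scale_map_is_bilinear G).

Lemma differentiable_scale E G (c : E -> R) (f : E -> G) (p : E) :
  differentiable c p -> differentiable f p ->
  differentiable (fun x => c x *: f x) p.
Proof.
move=> dc df.
have sc : continuous (fun q : R * G => scale_map q.1 q.2).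
  exact: scale_continuous.
have ds := @differentiable_bilin R R G G (@scale_map G) (c p, f p) sc.
exact: (differentiable_comp (differentiable_pair dc df) ds).
Qed.

Lemma derive_scale E G (c : E -> R) (f : E -> G) (p v : E) :
  differentiable c p -> differentiable f p ->
  'D_v (fun x => c x *: f x) p = 'D_v c p *: f p + c p *: 'D_v f p.
Proof.
move=> dc df.
have sc : continuous (fun q : R * G => scale_map q.1 q.2).
  exact: scale_continuous.
have dp := differentiable_pair dc df.
have ds := @differentiable_bilin R R G G (@scale_map G) (c p, f p) sc.
rewrite -[LHS]/('D_v ((fun q : R * G => scale_map q.1 q.2) \o
  (fun x => (c x, f x))) p) derive_comp// deriveE//.
rewrite (@diff_bilin R R G G (@scale_map G) (c p, f p) sc)/=.
by rewrite !deriveE// diff_pair//= addrC.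
Qed.

Lemma derive_pair E G H (f : E -> G) (g : E -> H) (p v : E) :
  differentiable f p -> differentiable g p ->
  'D_v (fun x => (f x, g x)) p = ('D_v f p, 'D_v g p).
Proof.
by move=> df dg; rewrite !deriveE ?diff_pair//; exact: differentiable_pair.
Qed.

Lemma near_open E (U : set E) (P : E -> Prop) (p : E) :
  open U -> U p -> (forall x, U x -> P x) -> \near p, P p.
Proof.
by move=> Uo Up UP; apply: filterS UP _; exact: open_nbhs_nbhs.
Qed.

Lemma open_eq_derive E G (U : set E) (f g : E -> G) (p v : E) :
  open U -> U p -> (forall x, U x -> f x = g x) -> 'D_v f p = 'D_v g p.
Proof. by move=> Uo Up fg; apply: near_eq_derive; exact: near_open fg. Qed.

Lemma open_eq_differentiable E G (U : set E) (f g : E -> G) (p : E) :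
  open U -> U p -> (forall x, U x -> f x = g x) ->
  differentiable f p -> differentiable g p.
Proof.
by move=> Uo Up fg; apply: near_eq_differentiable; exact: near_open fg.
Qed.

End Derivatives.

(** * C^oo functions: closure properties, Leibniz rules, symmetry of second derivatives *)

Section Smooth.
Variable R : realType.
Implicit Types E G H : normedModType R.

Lemma smooth_on_differentiable E G (U : set E) (f : E -> G) (p : E) :
  smooth_on U f -> U p -> differentiable f p.
Proof. by move=> fs; exact: (fs [::]). Qed.

Lemma smooth_on_derive E G (U : set E) (f : E -> G) (v : E) :
  smooth_on U f -> smooth_on U ('D_v f).
Proof. by move=> fs vs p Up; have := fs (rcons vs v) p Up; rewrite foldr_rcons. Qed.

Lemma smooth_on_sub E G (U W : set E) (f : E -> G) :
  W `<=` U -> smooth_on U f -> smooth_on W f.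
Proof. by move=> WU fs vs p /WU; exact: fs. Qed.

(** A coinduction principle: a class of differentiable functions that is closed under directional
    derivatives consists of C^oo functions. Closure is asked only up to equality on [U], because the
    rules that compute derivatives hold only there. *)
Lemma smooth_on_coind E G (U : set E) (P : (E -> G) -> Prop) : open U ->
  (forall f, P f -> forall p, U p -> differentiable f p) ->
  (forall f v, P f -> exists2 g, P g & forall p, U p -> 'D_v f p = g p) ->
  forall f, P f -> smooth_on U f.
Proof.
move=> Uo Pd PD f Pf vs.
have [h] : exists h, [/\ P h & forall p, U p -> f p = h p] by exists f.
(* In [foldr] the last vector of the list is the first direction of differentiation, so the list is
   peeled from its end and the function is generalised. *)
elim/last_ind: vs f h {Pf} => [|vs v IH] f h [Ph fh] p Up.
  apply: (open_eq_differentiable Uo Up _ (Pd _ Ph p Up)) => x Ux.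
  by rewrite /= fh.
rewrite foldr_rcons; have [g Pg hg] := PD h v Ph.
apply: (IH _ g) => //; split=> // x Ux.
by rewrite -hg//; exact: (open_eq_derive _ Uo Ux fh).
Qed.

Lemma smooth_on_ext E G (U : set E) (f g : E -> G) : open U ->
  (forall p, U p -> f p = g p) -> smooth_on U f -> smooth_on U g.
Proof.
move=> Uo fg fs.
pose P h := exists2 f : E -> G, smooth_on U f & forall p, U p -> f p = h p.
apply: (@smooth_on_coind E G U P Uo); last by exists f.
- move=> h [k ks kh] p Up.
  exact: (open_eq_differentiable Uo Up kh (smooth_on_differentiable ks Up)).
- move=> h v [k ks kh]; exists ('D_v k).
    by exists ('D_v k) => //; exact: smooth_on_derive.
  by move=> p Up; rewrite (open_eq_derive _ Uo Up kh).
Qed.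

Lemma smooth_on_cst E G (U : set E) (a : G) : open U ->
  smooth_on U (fun _ : E => a).
Proof.
move=> Uo; pose P (h : E -> G) := exists b : G, h = (fun _ => b).
apply: (@smooth_on_coind E G U P Uo); last by exists a.
- by move=> _ [b ->] p _; exact: differentiable_cst.
- move=> _ v [b ->]; exists (fun _ => 0); first by exists 0.
  by move=> p _; rewrite derive_cst.
Qed.

Lemma smooth_on_linear E G (U : set E) (L : {linear E -> G}) : open U ->
  continuous L -> smooth_on U L.
Proof.
move=> Uo Lc; pose P h := h = (L : E -> G) \/ exists b : G, h = (fun _ => b).
apply: (@smooth_on_coind E G U P Uo); last by left.
- move=> _ [|[b]] -> p _; last exact: differentiable_cst.
  exact: linear_differentiable.
- move=> _ v [|[b]] ->; last first.
    exists (fun _ => 0); first by right; exists 0.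
    by move=> p _; rewrite derive_cst.
  exists (fun _ => L v); first by right; exists (L v).
  by move=> p _; rewrite derive_linear_fun.
Qed.

Lemma smooth_on_lincomp E G H (U : set E) (L : {linear G -> H}) (f : E -> G) :
  open U -> continuous L -> smooth_on U f -> smooth_on U (L \o f).
Proof.
move=> Uo Lc fs.
pose P h := exists2 f : E -> G, smooth_on U f & h = L \o f.
apply: (@smooth_on_coind E H U P Uo); last by exists f.
- move=> _ [k ks ->] p Up.
  apply: differentiable_comp; first exact: smooth_on_differentiable ks Up.
  exact: linear_differentiable.
- move=> _ v [k ks ->]; exists (L \o 'D_v k).
    by exists ('D_v k) => //; exact: smooth_on_derive.
  move=> p Up; rewrite derive_lincomp//.
  exact: smooth_on_differentiable ks Up.
Qed.

Lemma smooth_on_pair E G H (U : set E) (f : E -> G) (g : E -> H) : open U ->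
  smooth_on U f -> smooth_on U g -> smooth_on U (fun x => (f x, g x)).
Proof.
move=> Uo fs gs.
pose P h := exists f : E -> G, exists g : E -> H,
  [/\ smooth_on U f, smooth_on U g & h = (fun x => (f x, g x))].
apply: (@smooth_on_coind E (G * H)%type U P Uo); last by exists f, g.
- move=> _ [f1 [g1 [fs1 gs1 ->]]] p Up.
  by apply: differentiable_pair; exact: (@smooth_on_differentiable _ _ U).
- move=> _ v [f1 [g1 [fs1 gs1 ->]]].
  exists (fun x => ('D_v f1 x, 'D_v g1 x)).
    by exists ('D_v f1), ('D_v g1); split=> //; exact: smooth_on_derive.
  by move=> p Up; apply: derive_pair; exact: (@smooth_on_differentiable _ _ U).
Qed.

(** Coordinates turn a direction that varies with the point, as in the chain rule, into fixed
    directions with scalar coefficients; iterated directional derivatives can only absorb the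
    latter. *)
Definition has_coordinates E := exists m (e : 'I_m -> E)
  (c : 'I_m -> {linear E -> R}),
  (forall k, continuous (c k)) /\ forall x, x = \sum_k c k x *: e k.

(* Designed to be stable under directional derivatives, by the chain rule. *)
Inductive smooth_closure E G H (U : set E) (W : set G) (f : E -> G) :
    (E -> H) -> Prop :=
| closure_smooth h : smooth_on U h -> smooth_closure U W f h
| closure_add h k : smooth_closure U W f h -> smooth_closure U W f k ->
    smooth_closure U W f (fun x => h x + k x)
| closure_scale (c : E -> R) h : smooth_on U c -> smooth_closure U W f h ->
    smooth_closure U W f (fun x => c x *: h x)
| closure_comp g : smooth_on W g -> smooth_closure U W f (g \o f).

Lemma smooth_closure_sum E G H (U : set E) (W : set G) (f : E -> G) m
    (h : 'I_m -> E -> H) : open U -> (forall k, smooth_closure U W f (h k)) ->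
  smooth_closure U W f (fun x => \sum_k h k x).
Proof.
move=> Uo; elim: m h => [|m IH] h hs.
  under eq_fun do rewrite big_ord0.
  by apply: closure_smooth; exact: smooth_on_cst.
under eq_fun do rewrite big_ord_recl.
by apply: closure_add => //; apply: IH.
Qed.

(** The case with content is the composite: its derivative is a sum of composites of ['D_(e k) g]
    with [f], whose coefficients are the coordinates of ['D_v f]. These coefficients are smooth on
    [U], so the sum stays in the class. *)
Lemma smooth_closureP E G H (U : set E) (W : set G) (f : E -> G) :
  has_coordinates G -> open U -> smooth_on U f -> (forall x, U x -> W (f x)) ->
  forall h : E -> H, smooth_closure U W f h -> smooth_on U h.
Proof.
move=> [m [e [c [cc ce]]]] Uo fs fW.
have cd : forall h : E -> H, smooth_closure U W f h ->
    forall p, U p -> differentiable h p.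
  move=> h; elim=> [{}h hs|{}h k _ hd _ kd|a {}h sa _ hd|g gs] p Up.
  - exact: smooth_on_differentiable hs Up.
  - by apply: differentiableD; [exact: hd|exact: kd].
  - apply: differentiable_scale; last exact: hd.
    exact: smooth_on_differentiable sa Up.
  - apply: differentiable_comp; first exact: smooth_on_differentiable fs Up.
    exact: smooth_on_differentiable gs (fW _ Up).
apply: smooth_on_coind => // h v.
elim=> [{}h hs|{}h k hc [h' h'c hE] kc [k' k'c kE]|a {}h sa hc [h' h'c hE]|g gs].
- exists ('D_v h) => //; apply: closure_smooth; exact: smooth_on_derive.
- exists (fun x => h' x + k' x); first exact: closure_add.
  by move=> p Up; rewrite -hE// -kE// deriveD//; apply/diff_derivable/cd.
- exists (fun x => 'D_v a x *: h x + a x *: h' x).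
    by apply: closure_add; apply: closure_scale => //; exact: smooth_on_derive.
  move=> p Up; rewrite derive_scale ?hE//; last exact: cd.
  exact: smooth_on_differentiable sa Up.
- exists (fun x => \sum_k c k ('D_v f x) *: ('D_(e k) g \o f) x).
    apply: smooth_closure_sum => // k; apply: closure_scale.
      apply: (@smooth_on_lincomp _ _ _ U (c k) ('D_v f)) => //.
      exact: smooth_on_derive.
    by apply: closure_comp; exact: smooth_on_derive.
  move=> p Up; have df := smooth_on_differentiable fs Up.
  have dg := smooth_on_differentiable gs (fW _ Up).
  rewrite derive_comp//.
  transitivity ('D_(\sum_k c k ('D_v f p) *: e k) g (f p)); first by rewrite -ce.
  rewrite derive_sumv//.
  by apply: eq_bigr => k _; rewrite derive_scalev.
Qed.

Lemma smooth_on_comp E G H (U : set E) (W : set G) (f : E -> G) (g : G -> H) :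
  has_coordinates G -> open U -> smooth_on U f -> (forall x, U x -> W (f x)) ->
  smooth_on W g -> smooth_on U (g \o f).
Proof.
move=> Gc Uo fs fW gs; apply: (smooth_closureP Gc Uo fs fW).
exact: closure_comp.
Qed.

Lemma has_coordinates_regular : has_coordinates R.
Proof.
exists 1%N, (fun=> 1), (fun=> idfun); split=> [_ x|x]; first exact: cvg_id.
by rewrite big_ord1 /= [_ *: _]mulr1.
Qed.

Lemma has_coordinates_rV n : has_coordinates 'rV[R]_n.
Proof.
have lc (k : 'I_n) : linear (fun v : 'rV[R]_n => v 0 k).
  by move=> a u v; rewrite !mxE.
pose c (k : 'I_n) : {linear 'rV[R]_n -> R} := HB.pack_for {linear 'rV[R]_n -> R}
  (fun v : 'rV[R]_n => v 0 k) (GRing.isLinear.Build _ _ _ _ _ (lc k)).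
exists n, (fun k => delta_mx 0 k), c.
split=> [k|x]; first exact: coord_continuous.
exact: row_sum_delta.
Qed.

Lemma fst_continuous E G : continuous (@fst E G).
Proof. by move=> x; exact: cvg_fst. Qed.

Lemma snd_continuous E G : continuous (@snd E G).
Proof. by move=> x; exact: cvg_snd. Qed.

Lemma has_coordinates_prod E G :
  has_coordinates E -> has_coordinates G -> has_coordinates (E * G)%type.
Proof.
move=> [m [e [c [cc ce]]]] [m' [e' [c' [cc' ce']]]].
exists (m + m')%N.
exists (fun k : 'I_(m + m') =>
  match fintype.split k with inl i => (e i, 0) | inr j => (0, e' j) end).
exists (fun k : 'I_(m + m') => match fintype.split k with
  | inl i => (c i \o fst : {linear (E * G)%type -> R})
  | inr j => (c' j \o snd : {linear (E * G)%type -> R}) end).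
split=> [k|[x y]].
  case: (fintype.split k) => j p.
    by apply: continuous_comp; [exact: fst_continuous|exact: cc].
  by apply: continuous_comp; [exact: snd_continuous|exact: cc'].
rewrite big_split_ord /=.
under eq_bigr do rewrite (unsplitK (inl _)) /=.
under [X in _ + X]eq_bigr do rewrite (unsplitK (inr _)) /=.
have pE (u : E) (v : G) : (u, v) = (u, 0) + (0, v).
  by congr pair; rewrite /= ?addr0 ?add0r.
rewrite [LHS]pE {1}(ce x) {1}(ce' y); congr (_ + _).
  by elim/big_rec2: _ => // k u v _ <-; congr pair; rewrite /= ?scaler0 ?addr0.
by elim/big_rec2: _ => // k u v _ <-; congr pair; rewrite /= ?scaler0 ?addr0.
Qed.

Lemma smooth_on_add E G (U : set E) (f g : E -> G) : open U ->
  smooth_on U f -> smooth_on U g -> smooth_on U (fun x => f x + g x).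
Proof.
(* Only the additive constructor is wanted, so any smooth inner map will do; the zero map is the
   simplest. *)
move=> Uo fs gs; pose k (_ : E) : R := 0.
apply: (@smooth_closureP E R G U setT k) => //.
- exact: has_coordinates_regular.
- exact: smooth_on_cst.
- by apply: closure_add; exact: closure_smooth.
Qed.

Lemma smooth_on_scale E G (U : set E) (c : E -> R) (f : E -> G) : open U ->
  smooth_on U c -> smooth_on U f -> smooth_on U (fun x => c x *: f x).
Proof.
move=> Uo cs fs; pose k (_ : E) : R := 0.
apply: (@smooth_closureP E R G U setT k) => //.
- exact: has_coordinates_regular.
- exact: smooth_on_cst.
- by apply: closure_scale => //; exact: closure_smooth.
Qed.

Lemma smooth_on_opp E G (U : set E) (f : E -> G) : open U ->
  smooth_on U f -> smooth_on U (fun x => - f x).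
Proof.
move=> Uo fs; under eq_fun do rewrite -scaleN1r.
by apply: smooth_on_scale => //; exact: smooth_on_cst.
Qed.

Lemma smooth_on_sum E G (U : set E) m (f : 'I_m -> E -> G) : open U ->
  (forall k, smooth_on U (f k)) -> smooth_on U (fun x => \sum_k f k x).
Proof.
move=> Uo; elim: m f => [|m IH] f fs.
  by under eq_fun do rewrite big_ord0; exact: smooth_on_cst.
under eq_fun do rewrite big_ord_recl.
by apply: smooth_on_add => //; exact: IH.
Qed.

(** The functions g f^-k form a class stable under differentiation, since (g f^-k)' = (g' f - k g
    f') f^-(k+1). *)
Lemma smooth_on_inv E (U : set E) (f : E -> R) : open U ->
  (forall x, U x -> f x != 0) -> smooth_on U f -> smooth_on U (fun x => (f x)^-1).
Proof.
move=> Uo f0 fs.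
have scaleRE (a b : R) : a *: b = a * b by [].
pose P (h : E -> R) := exists2 g : E -> R, smooth_on U g &
  exists k, h = (fun x => g x * (f x) ^- k).
have dfV x : U x -> differentiable (fun x => (f x)^-1) x.
  by move=> Ux; apply: differentiableV (f0 x Ux); exact: smooth_on_differentiable Ux.
have dfX k x : U x -> differentiable (fun x => f x ^- k) x.
  move=> Ux; under eq_fun do rewrite -exprVn.
  elim: k => [|k IH]; first exact: differentiable_cst.
  under eq_fun do rewrite exprS.
  exact: (@differentiable_scale R E R _ _ x (dfV x Ux) IH).
have Pf : P (fun x => (f x)^-1).
  exists (fun=> 1); first exact: smooth_on_cst.
  by exists 1%N; apply/funext => x; rewrite mul1r expr1.
apply: (@smooth_on_coind E R U P Uo _ _ _ Pf).
- move=> _ [g gs [k ->]] p Up.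
  exact: (differentiableM (smooth_on_differentiable gs Up) (dfX k p Up)).
- move=> _ v [g gs [k ->]].
  exists (fun x => ('D_v g x * f x - k%:R * g x * 'D_v f x) * f x ^- k.+1).
    exists (fun x => 'D_v g x * f x - k%:R * g x * 'D_v f x); last by exists k.+1.
    apply: smooth_on_add => //.
      by apply: (@smooth_on_scale E R) => //; exact: smooth_on_derive.
    apply: (@smooth_on_opp E R) => //.
    apply: (@smooth_on_scale E R) => //; last exact: smooth_on_derive.
    by apply: (@smooth_on_scale E R) => //; exact: smooth_on_cst.
  move=> p Up; have df := smooth_on_differentiable fs Up.
  have dg := smooth_on_differentiable gs Up.
  rewrite (@deriveM R E g (fun x => f x ^- k) p v); last 2 first.
  - exact: diff_derivable.
  - by apply: diff_derivable; exact: dfX.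
  have -> : 'D_v (fun x => f x ^- k) p = - k%:R * f p ^- k.+1 * 'D_v f p.
    under eq_fun do rewrite -exprVn.
    rewrite -(exprfctE (fun x => (f x)^-1)) (@deriveX R E (fun x => (f x)^-1) k p v); last first.
      by apply: diff_derivable; exact: dfV.
    rewrite (@deriveV R E f p v) ?f0//; last exact: diff_derivable.
    case: k => [|k]; first by rewrite !mul0r oppr0 !mul0r scale0r.
    have fp0 := f0 p Up.
    by rewrite !scaleRE /= exprVn !exprS; field; rewrite fp0 expf_neq0.
  have fp0 := f0 p Up.
  by rewrite !scaleRE exprS; field; rewrite fp0 expf_neq0.
Qed.

Lemma linear_combination G H (f : G -> H) m (a : 'I_m -> R) (e : 'I_m -> G) :
  linear f -> f (\sum_k a k *: e k) = \sum_k a k *: f (e k).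
Proof.
move=> lf; pose L : {linear G -> H} := HB.pack_for {linear G -> H} f
  (GRing.isLinear.Build _ _ _ _ _ lf).
rewrite -[f _]/(L _) linear_sum; apply: eq_bigr => k _.
by rewrite linearZ.
Qed.

Lemma linear_fun0 G H (f : G -> H) : linear f -> f 0 = 0.
Proof.
move=> lf; have := linear_combination (fun _ : 'I_0 => 0) (fun=> 0) lf.
by rewrite !big_ord0.
Qed.

Lemma linear_funN G H (f : G -> H) (a : G) : linear f -> f (- a) = - f a.
Proof.
move=> lf; have := lf (-1) a 0.
by rewrite (linear_fun0 lf) !addr0 !scaleN1r.
Qed.

Lemma linear_funZ G H (f : G -> H) (r : R) (a : G) : linear f -> f (r *: a) = r *: f a.
Proof. by move=> lf; rewrite -[r *: a]addr0 lf (linear_fun0 lf) addr0. Qed.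

Lemma linear_funD G H (f : G -> H) (a b : G) : linear f -> f (a + b) = f a + f b.
Proof. by move=> lf; rewrite -[a]scale1r lf !scale1r. Qed.

Lemma differentiable_app E G H (U : set E) (Phi : E -> G -> H) (X : E -> G)
    (p : E) : has_coordinates G -> open U -> U p ->
  (forall x, U x -> linear (Phi x)) ->
  (forall w, differentiable (Phi ^~ w) p) -> differentiable X p ->
  differentiable (fun x => Phi x (X x)) p.
Proof.
move=> [m [e [c [cc ce]]]] Uo Up Phil Phid dX.
apply: (@open_eq_differentiable _ _ _ U
  (\sum_k (fun x => c k (X x) *: Phi x (e k)))) => //.
  by move=> x Ux; rewrite fct_sumE [in RHS](ce (X x)) linear_combination//; exact: Phil.
apply: differentiable_sum => k; apply: differentiable_scale => //.
exact/(differentiable_comp dX)/linear_differentiable.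
Qed.

(** Expanding [X] in coordinates leaves [Phi] only at the fixed vectors [e k], so differentiability
    with a frozen argument suffices and no norm on linear maps is involved. This is the rule behind
    the derivative of expressions such as Gamma(x, y) y. *)
Lemma derive_app E G H (U : set E) (Phi : E -> G -> H) (X : E -> G)
    (p v : E) : has_coordinates G -> open U -> U p ->
  (forall x, U x -> linear (Phi x)) ->
  (forall w, differentiable (Phi ^~ w) p) -> differentiable X p ->
  'D_v (fun x => Phi x (X x)) p
  = 'D_v (Phi ^~ (X p)) p + Phi p ('D_v X p).
Proof.
move=> [m [e [c [cc ce]]]] Uo Up Phil Phid dX.
have dcX k : differentiable (c k \o X) p.
  exact/(differentiable_comp dX)/linear_differentiable.
transitivity ('D_v (\sum_k (fun x => c k (X x) *: Phi x (e k))) p).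
  apply: (open_eq_derive _ Uo Up) => x Ux.
  by rewrite fct_sumE [in LHS](ce (X x)) linear_combination//; exact: Phil.
rewrite derive_sum; last first.
  by move=> k; apply/diff_derivable/differentiable_scale => //; exact: dcX.
transitivity (\sum_k ('D_v (c k \o X) p *: Phi p (e k)
    + c k (X p) *: 'D_v (Phi ^~ (e k)) p)).
  by apply: eq_bigr => k _; rewrite (derive_scale v (dcX k)).
rewrite big_split /= addrC; congr (_ + _); last first.
  rewrite [in RHS](ce ('D_v X p)) linear_combination; last exact: Phil.
  by apply: eq_bigr => k _; rewrite -derive_lincomp.
transitivity ('D_v (\sum_k (fun x => c k (X p) *: Phi x (e k))) p).
  rewrite derive_sum; last first.
    by move=> k; apply/diff_derivable/differentiableZ.
  by apply: eq_bigr => k _; rewrite deriveZ//; exact: diff_derivable.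
apply: (open_eq_derive _ Uo Up) => x Ux.
by rewrite fct_sumE [in RHS](ce (X p)) linear_combination//; exact: Phil.
Qed.

Lemma smooth_on_app E G H (U : set E) (Phi : E -> G -> H) (X : E -> G) :
  has_coordinates G -> open U -> (forall x, U x -> linear (Phi x)) ->
  (forall w, smooth_on U (Phi ^~ w)) -> smooth_on U X ->
  smooth_on U (fun x => Phi x (X x)).
Proof.
move=> [m [e [c [cc ce]]]] Uo Phil Phis Xs.
apply: (@smooth_on_ext _ _ _ (fun x => \sum_k c k (X x) *: Phi x (e k))) => //.
  by move=> x Ux; rewrite [in RHS](ce (X x)) linear_combination//; exact: Phil.
apply: smooth_on_sum => // k; apply: smooth_on_scale => //.
exact: (@smooth_on_lincomp _ _ _ U (c k) X).
Qed.

Lemma is_derive_line E (f : E -> R) (q u : E) (t : R) :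
  differentiable f (q + t *: u) ->
  is_derive t (1 : R) (fun s : R => f (q + s *: u)) ('D_u f (q + t *: u)).
Proof.
move=> df.
have lu : linear (fun s : R => s *: u).
  by move=> a x y; rewrite scalerDl scalerA.
have cu : continuous (fun s : R => s *: u) by exact: scalel_continuous.
have dl : is_diff t (fun s : R => q + s *: u) (fun s : R => 0 + s *: u).
  by apply: is_diffD.
have dl' : differentiable (fun s : R => q + s *: u) t by [].
apply: DeriveDef.
  by apply: diff_derivable; exact: (differentiable_comp dl' df).
rewrite (@derive_comp _ _ _ _ (fun s : R => q + s *: u) f)//.
by congr ('D_ _ f _); rewrite deriveE// diff_val add0r scale1r.
Qed.

Lemma mean_value (f df : R -> R) (h : R) : 0 < h ->
  (forall s : R, 0 <= s <= h -> is_derive s 1 f (df s)) ->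
  exists2 s : R, 0 <= s <= h & f h - f 0 = df s * h.
Proof.
move=> h0 fd.
have fd' (x : R) : x \in `]0, h[%R -> is_derive x 1 f (df x).
  by rewrite in_itv/= => /andP[x0 xh]; apply: fd; rewrite !ltW.
have fc : {within `[0, h], continuous f}.
  apply: continuous_in_subspaceT => x; rewrite inE/= in_itv/= => /fd[dx _].
  by apply: differentiable_continuous; apply/derivable1_diffP.
have [s] := MVT_segment (ltW h0) fd' fc.
by rewrite in_itv/= subr0 => sh fE; exists s.
Qed.

(* Two applications of the mean value theorem to the second difference of [f]
   on the parallelogram spanned by [h u] and [h v]. *)
Lemma second_difference E (U : set E) (f : E -> R) (p u v : E) (h : R) :
  smooth_on U f -> 0 < h ->
  (forall s t : R, 0 <= s <= h -> 0 <= t <= h -> U (p + s *: u + t *: v)) ->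
  exists s t : R, [/\ 0 <= s <= h, 0 <= t <= h &
    f (p + h *: u + h *: v) - f (p + h *: u) - (f (p + h *: v) - f p)
    = h ^+ 2 * 'D_v ('D_u f) (p + s *: u + t *: v)].
Proof.
move=> fs h0 Uh.
have h00 : 0 <= h <= h by rewrite lexx ltW.
have h01 : 0 <= (0 : R) <= h by rewrite lexx ltW.
have fd (s t : R) : 0 <= s <= h -> 0 <= t <= h ->
    differentiable f (p + t *: v + s *: u).
  move=> sh th; rewrite addrAC; apply: (smooth_on_differentiable fs).
  exact: Uh.
pose phi (s : R) : R := f (p + h *: v + s *: u) - f (p + 0 *: v + s *: u).
pose dphi (s : R) : R :=
  'D_u f (p + h *: v + s *: u) - 'D_u f (p + 0 *: v + s *: u).
have [s sh phiE] : exists2 s : R, 0 <= s <= h & phi h - phi 0 = dphi s * h.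
  apply: (mean_value h0) => s sh.
  by apply: is_deriveB; apply: is_derive_line; exact: fd.
pose psi (t : R) : R := 'D_u f (p + s *: u + t *: v).
pose dpsi (t : R) : R := 'D_v ('D_u f) (p + s *: u + t *: v).
have [t th psiE] : exists2 t : R, 0 <= t <= h & psi h - psi 0 = dpsi t * h.
  apply: (mean_value h0) => t th; apply: is_derive_line.
  by apply: (smooth_on_differentiable (smooth_on_derive u fs)); exact: Uh.
exists s, t; split=> //; rewrite -/(dpsi t).
have -> : h ^+ 2 * dpsi t = (psi h - psi 0) * h by rewrite psiE; ring.
have -> : psi h - psi 0 = dphi s.
  by rewrite /psi /dphi ![p + s *: u + _]addrAC.
rewrite -phiE /phi !scale0r !addr0 [p + h *: u + _]addrAC; ring.
Qed.

(** The second difference over the parallelogram with sides h u and h v is symmetric in u and v, and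
    it equals h^2 times either mixed derivative at some point of the parallelogram. The two
    derivatives thus share a value, at points arbitrarily near [p], and continuity makes them agree
    at [p]. *)
Lemma derive_swap_real E (U : set E) (f : E -> R) (p u v : E) : open U -> U p ->
  smooth_on U f -> 'D_v ('D_u f) p = 'D_u ('D_v f) p.
Proof.
move=> Uo Up fs; apply: contrapT => /eqP; rewrite -subr_eq0 -normr_gt0.
pose a (x : E) : R := 'D_v ('D_u f) x; pose b (x : E) : R := 'D_u ('D_v f) x.
rewrite -/(a p) -/(b p) => ab0.
have ac : {for p, continuous a}.
  by apply/differentiable_continuous/(@smooth_on_differentiable _ _ U) => //;
    do 2 apply: smooth_on_derive.
have bc : {for p, continuous b}.
  by apply/differentiable_continuous/(@smooth_on_differentiable _ _ U) => //;
    do 2 apply: smooth_on_derive.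
have e0 : 0 < `|a p - b p| / 2 by rewrite divr_gt0.
have na : \forall x \near p, `|a p - a x| < `|a p - b p| / 2.
  by move/cvgrPdist_lt: ac => /(_ _ e0).
have nb : \forall x \near p, `|b p - b x| < `|a p - b p| / 2.
  by move/cvgrPdist_lt: bc => /(_ _ e0).
have nU : \forall x \near p, U x by apply: (near_open Uo Up).
have nall : nbhs p [set x | [/\ U x, `|a p - a x| < `|a p - b p| / 2 &
    `|b p - b x| < `|a p - b p| / 2]].
  by apply: filterS3 nU na nb => x; split.
have [r /= r0 rP] := (nbhs_ballP _ _).1 nall.
(* The summand 1 keeps the denominator positive when u = v = 0 and makes the bound h (|u| + |v|) < r
   strict. *)
pose h := r / (`|u| + `|v| + 1).
have uv0 : 0 < `|u| + `|v| + 1 by rewrite ltr_wpDl// addr_ge0.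
have h0 : 0 < h by rewrite divr_gt0.
have hr (s t : R) : 0 <= s <= h -> 0 <= t <= h ->
    ball p r (p + s *: u + t *: v).
  move=> /andP[s0 sh] /andP[t0 th]; rewrite -ball_normE /=.
  rewrite -addrA opprD addrA subrr sub0r normrN.
  rewrite (le_lt_trans (ler_normD _ _))// !normrZ !ger0_norm//.
  apply: (@le_lt_trans _ _ (h * (`|u| + `|v|))).
    by rewrite mulrDr lerD// ler_wpM2r.
  by rewrite /h mulrAC ltr_pdivrMr// ltr_pM2l// ltrDl.
have hU (s t : R) : 0 <= s <= h -> 0 <= t <= h -> U (p + s *: u + t *: v).
  by move=> sh th; have [] := rP _ (hr s t sh th).
have [s [t [sh th aE]]] := second_difference fs h0 hU.
have hU' (x y : R) : 0 <= x <= h -> 0 <= y <= h -> U (p + x *: v + y *: u).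
  by move=> xh yh; rewrite addrAC; exact: hU.
have [s' [t' [sh' th' bE]]] := second_difference fs h0 hU'.
have [_ apx _] := rP _ (hr s t sh th).
have [_ _ bpx] := rP _ (hr t' s' th' sh').
have h20 : h ^+ 2 != 0 by rewrite expf_neq0// gt_eqF.
rewrite [p + h *: v + h *: u]addrAC [p + s' *: v + t' *: u]addrAC in bE.
move: aE bE apx bpx; rewrite -[X in _ = _ * X]/(a (p + s *: u + t *: v)).
rewrite -[X in _ -> _ = _ * X -> _]/(b (p + t' *: u + s' *: v)).
move: (a (p + _ + _)) (b (p + _ + _)) (a p) (b p).
move: (f (p + _ + _)) (f (p + h *: u)) (f (p + h *: v)) (f p) => x1 x2 x3 x4.
move=> A B ap bp aE bE.
have -> : A = B.
  by apply: (mulfI h20); rewrite -aE -bE; ring.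
rewrite distrC => apx bpx; have := ltrD apx bpx; rewrite -splitr ltNge.
move/negP; apply; rewrite (distrC ap bp).
have -> : bp - ap = (B - ap) + (bp - B) by ring.
exact: ler_normD.
Qed.

Lemma derive_swap E G (U : set E) (f : E -> G) (p u v : E) :
  has_coordinates G -> open U -> U p ->
  smooth_on U f -> 'D_v ('D_u f) p = 'D_u ('D_v f) p.
Proof.
move=> [m [e [c [cc ce]]]] Uo Up fs.
suff H k : c k ('D_v ('D_u f) p) = c k ('D_u ('D_v f) p).
  rewrite (ce ('D_v ('D_u f) p)) (ce ('D_u ('D_v f) p)).
  by apply: eq_bigr => k _; rewrite H.
have cD (w w' : E) : c k ('D_w' ('D_w f) p) = 'D_w' ('D_w (c k \o f)) p.
  have -> : 'D_w' ('D_w (c k \o f)) p = 'D_w' (c k \o 'D_w f) p.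
    apply: (open_eq_derive _ Uo Up) => x Ux.
    by rewrite derive_lincomp//; exact: (smooth_on_differentiable fs).
  rewrite derive_lincomp//; apply: (@smooth_on_differentiable _ _ U) => //.
  exact: smooth_on_derive.
rewrite !cD; apply: (derive_swap_real _ _ Uo Up).
exact: (@smooth_on_lincomp _ _ _ U (c k) f).
Qed.

End Smooth.

(** * Charts of the tangent bundle *)

Section Charts.
Variables (R : realType) (n : nat) (M : manifold R n).
Local Notation V := 'rV[R]_n.
Local Notation TM := (tangent_bundle M).
Implicit Types (i j k : midx M) (x : M) (z : TM) (p : V * V).

Lemma mimg_mphi i x : mdom i x -> (mphi i @` mdom i) (mphi i x).
Proof. by move=> ix; exists x. Qed.

Lemma mpsi_dom i (q : V) : (mphi i @` mdom i) q -> mdom i (mpsi i q).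
Proof. by case=> x ix <-; rewrite mphiK. Qed.

Lemma mpsiK i (q : V) : (mphi i @` mdom i) q -> mphi i (mpsi i q) = q.
Proof. by case=> x ix <-; rewrite mphiK. Qed.

Lemma open_mpsi i (A : set M) : open A ->
  open [set q | (mphi i @` mdom i) q /\ A (mpsi i q)].
Proof.
move=> Ao; rewrite openE => q [iq Aq]; rewrite /interior.
have iqn : nbhs q (mphi i @` mdom i).
  by apply: open_nbhs_nbhs; split=> //; exact: mimg_open.
have [x ix qE] := iq; have cx := mpsi_continuous ix; rewrite qE in cx.
have An : nbhs (mpsi i q) A by apply: open_nbhs_nbhs.
by apply: filterS2 iqn (cx _ An) => q' iq' Aq'; split.
Qed.

(** The domain of smoothness in [mtrans_smooth], rewritten as a preimage under [mpsi i]; in this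
    form its openness follows from continuity of [mpsi i]. *)
Definition overlap i j : set V :=
  [set q | (mphi i @` mdom i) q /\ mdom j (mpsi i q)].

Lemma overlap_open i j : open (overlap i j).
Proof. exact/open_mpsi/mdom_open. Qed.

Lemma overlap_mphi i j x : mdom i x -> mdom j x -> overlap i j (mphi i x).
Proof. by move=> ix jx; split; [exact: mimg_mphi|rewrite mphiK]. Qed.

Definition tau i j : V -> V := @mphi _ _ M j \o @mpsi _ _ M i.

Lemma tau_smooth i j : smooth_on (overlap i j) (tau i j).
Proof.
apply: smooth_on_sub (@mtrans_smooth _ _ M i j) => q [[x ix <-]].
by rewrite mphiK// => jx; exists x.
Qed.

Lemma tcoord_linear i j x : linear (@tcoord R n M i j x).
Proof. by move=> a u v; rewrite /tcoord linearP. Qed.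

Lemma tcoordD i j x u v : tcoord i j x (u + v) = tcoord i j x u + tcoord i j x v.
Proof. by rewrite /tcoord linearD. Qed.

Lemma tcoordZ i j x a u : tcoord i j x (a *: u) = a *: tcoord i j x u.
Proof. by rewrite /tcoord linearZ. Qed.

Lemma tcoord0 i j x : tcoord i j x 0 = 0.
Proof. by rewrite /tcoord linear0. Qed.

Lemma tcoordE i j (q v : V) : overlap i j q ->
  tcoord i j (mpsi i q) v = 'D_v (tau i j) q.
Proof.
move=> oq; rewrite deriveE; last exact: (smooth_on_differentiable (@tau_smooth i j)).
by rewrite /tcoord mpsiK//; case: oq.
Qed.

Lemma tau_differentiable i j x : mdom i x -> mdom j x ->
  differentiable (tau i j) (mphi i x).
Proof.
by move=> ix jx; apply: (smooth_on_differentiable (@tau_smooth i j)); exact: overlap_mphi.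
Qed.

Lemma tcoord_derive i j x v : mdom i x -> mdom j x ->
  tcoord i j x v = 'D_v (tau i j) (mphi i x).
Proof.
by move=> ix jx; rewrite deriveE//; exact: tau_differentiable.
Qed.

(** The cocycle identity, by the chain rule for transition maps. It makes the reference charts
    [mat x], which only serve to name vectors, drop out of chart formulas. *)
Lemma tcoord_comp i j k x v : mdom i x -> mdom j x -> mdom k x ->
  tcoord j k x (tcoord i j x v) = tcoord i k x v.
Proof.
move=> ix jx kx.
have tE : tau i j (mphi i x) = mphi j x by rewrite /tau /= mphiK.
have di := tau_differentiable ix jx.
have dj : differentiable (tau j k) (tau i j (mphi i x)).
  by rewrite tE; exact: tau_differentiable.
rewrite (tcoord_derive v ix kx) (tcoord_derive (tcoord i j x v) jx kx).
rewrite (tcoord_derive v ix jx) -tE.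
apply: (etrans (esym (derive_comp v di dj))).
apply: (@open_eq_derive _ _ _ (overlap i j)).
- exact: overlap_open.
- exact: overlap_mphi.
- by move=> q [iq jq]; rewrite /tau /= mphiK.
Qed.

Lemma tcoord_id i x v : mdom i x -> tcoord i i x v = v.
Proof.
move=> ix; rewrite tcoord_derive//.
rewrite (@open_eq_derive _ _ _ (overlap i i) _ id) ?derive_id//.
- exact: overlap_open.
- exact: overlap_mphi.
- by move=> q [iq _]; rewrite /tau /= mpsiK.
Qed.

Lemma tcoordK i j x v : mdom i x -> mdom j x ->
  tcoord j i x (tcoord i j x v) = v.
Proof. by move=> ix jx; rewrite tcoord_comp// tcoord_id. Qed.

Lemma tphiK i z : mdom i z.1 -> tpsi i (tphi i z) = z.
Proof.
case: z => x v /= ix; rewrite /tpsi /tphi /= mphiK// tcoordK//.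
exact: mat_dom.
Qed.

Lemma tpsiK i p : (mphi i @` mdom i) p.1 -> tphi i (tpsi i p) = p.
Proof.
case: p => q y /= iq; rewrite /tpsi /tphi /= mpsiK// tcoordK//.
  exact: mpsi_dom.
exact: mat_dom.
Qed.

Lemma tpsi_neq0 i p : (mphi i @` mdom i) p.1 ->
  (tpsi i p).2 != 0 <-> p.2 != 0.
Proof.
move=> iq; split; apply: contra => /eqP p0; apply/eqP; rewrite /tpsi /=.
  by rewrite p0 tcoord0.
have := tcoordK p.2 (mpsi_dom iq) (mat_dom (mpsi i p.1)).
by rewrite [tcoord i _ _ _]p0 tcoord0.
Qed.

(** * Natural coordinates of TM and their transition maps *)

Definition trans i j : V * V -> V * V := @tphi R n M j \o @tpsi R n M i.

Definition toverlap i j : set (V * V) := [set p | overlap i j p.1].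

Lemma toverlap_open i j : open (toverlap i j).
Proof.
apply: (@open_comp _ _ fst (overlap i j)) => [p _|].
  exact: fst_continuous.
exact: overlap_open.
Qed.

Lemma toverlap_tphi i j z : mdom i z.1 -> mdom j z.1 -> toverlap i j (tphi i z).
Proof. exact: overlap_mphi. Qed.

(** On each fibre the change of natural coordinates is the linear map D tau. Linearity in y is what
    makes the fibre derivatives of F^2 transform as tensors. *)
Lemma transE i j p : toverlap i j p ->
  trans i j p = (tau i j p.1, 'D_(p.2) (tau i j) p.1).
Proof.
case: p => q y oq; rewrite -tcoordE//= /trans /tphi /tpsi /=.
congr pair; case: oq => /= iq jq; rewrite tcoord_comp//; first exact: mpsi_dom.
exact: mat_dom.
Qed.

Lemma smooth_on_fst (E G H : normedModType R) (A : set E) (f : E -> H) :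
  has_coordinates E -> open A -> smooth_on A f ->
  smooth_on [set q : E * G | A q.1] (fun q => f q.1).
Proof.
move=> Ec Ao fs.
have o1 : open [set q : E * G | A q.1].
  by apply: (@open_comp _ _ fst A) => // q _; exact: fst_continuous.
apply: (@smooth_on_comp _ _ _ _ _ A fst f) => //.
by apply: smooth_on_linear => //; exact: fst_continuous.
Qed.

Lemma trans_smooth i j : smooth_on (toverlap i j) (trans i j).
Proof.
have oo := @toverlap_open i j; have to := @overlap_open i j.
have rVc := @has_coordinates_rV R n.
apply: (@smooth_on_ext _ _ _ _ (fun p => (tau i j p.1, 'D_(p.2) (tau i j) p.1))) => //.
  by move=> p op; rewrite transE.
apply: smooth_on_pair => //.
  apply: (@smooth_on_fst V V V (overlap i j) (tau i j)) => //; exact: tau_smooth.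
apply: (@smooth_on_app _ _ _ _ _ (fun p v => 'D_v (tau i j) p.1) snd) => //.
- move=> p op a u v; rewrite derive_linear//.
  exact: (smooth_on_differentiable (@tau_smooth i j)).
- move=> w; apply: (@smooth_on_fst V V V (overlap i j) ('D_w (tau i j))) => //.
  exact/smooth_on_derive/tau_smooth.
- by apply: smooth_on_linear => //; exact: snd_continuous.
Qed.

Lemma trans_differentiable i j p : toverlap i j p -> differentiable (trans i j) p.
Proof. exact/smooth_on_differentiable/trans_smooth. Qed.

Lemma trans_tphi i j z : mdom i z.1 -> trans i j (tphi i z) = tphi j z.
Proof. by move=> iz; rewrite /trans /= tphiK. Qed.

Definition dtrans i j z (xi : V * V) : V * V := 'd (trans i j) (tphi i z) xi.

Lemma dtrans_linear i j z : linear (dtrans i j z).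
Proof. by move=> a u v; rewrite /dtrans linearP. Qed.

Lemma dtrans_derive i j z xi : mdom i z.1 -> mdom j z.1 ->
  dtrans i j z xi = 'D_xi (trans i j) (tphi i z).
Proof.
move=> iz jz; rewrite deriveE//; apply: trans_differentiable.
exact: toverlap_tphi.
Qed.

Lemma dtrans_comp i j k z xi : mdom i z.1 -> mdom j z.1 -> mdom k z.1 ->
  dtrans j k z (dtrans i j z xi) = dtrans i k z xi.
Proof.
move=> iz jz kz.
have tE : trans i j (tphi i z) = tphi j z by exact: trans_tphi.
have di : differentiable (trans i j) (tphi i z).
  by apply: trans_differentiable; exact: toverlap_tphi.
have dj : differentiable (trans j k) (trans i j (tphi i z)).
  by rewrite tE; apply: trans_differentiable; exact: toverlap_tphi.
rewrite (dtrans_derive (dtrans i j z xi) jz kz) (dtrans_derive xi iz jz).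
rewrite (dtrans_derive xi iz kz).
transitivity ('D_('D_xi (trans i j) (tphi i z)) (trans j k) (trans i j (tphi i z))).
  by rewrite tE.
apply: (etrans (esym (derive_comp xi di dj))).
apply: (@open_eq_derive _ _ _ (toverlap i j)).
- exact: toverlap_open.
- exact: toverlap_tphi.
- by move=> q [iq jq]; rewrite /trans /= tphiK.
Qed.

Lemma dtrans_id i z xi : mdom i z.1 -> dtrans i i z xi = xi.
Proof.
move=> iz; rewrite dtrans_derive//.
rewrite (@open_eq_derive _ _ _ (toverlap i i) _ id) ?derive_id//.
- exact: toverlap_open.
- exact: toverlap_tphi.
- by move=> q [iq _]; rewrite /trans /= tpsiK.
Qed.

Lemma dtransK i j z xi : mdom i z.1 -> mdom j z.1 ->
  dtrans j i z (dtrans i j z xi) = xi.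
Proof. by move=> iz jz; rewrite dtrans_comp// dtrans_id. Qed.

Lemma dtrans_fst i j z xi : mdom i z.1 -> mdom j z.1 ->
  (dtrans i j z xi).1 = tcoord i j z.1 xi.1.
Proof.
move=> iz jz; have op := toverlap_tphi iz jz.
have dt := trans_differentiable op; have ot := tau_differentiable iz jz.
rewrite dtrans_derive// tcoord_derive//.
rewrite -(derive_lincomp xi (@fst_continuous _ _ _) dt).
transitivity ('D_xi (tau i j \o fst) (tphi i z)).
  apply: (open_eq_derive _ (@toverlap_open i j) op) => p op'.
  by rewrite -[LHS]/((trans i j p).1) transE.
have df : differentiable (fst : V * V -> V) (tphi i z).
  exact/linear_differentiable/fst_continuous.
apply: (etrans (derive_comp xi df ot)).
by rewrite derive_linear_fun//; exact: fst_continuous.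
Qed.

(* The components in the chart [i] of a tangent vector at [z]. *)
Definition tpush i z : V * V -> V * V := dtrans (mat z.1) i z.

Definition tpull i z : V * V -> V * V := dtrans i (mat z.1) z.

Lemma tpushK i z xi : mdom i z.1 -> tpull i z (tpush i z xi) = xi.
Proof. by move=> iz; apply: dtransK => //; exact: mat_dom. Qed.

Lemma tpullK i z xi : mdom i z.1 -> tpush i z (tpull i z xi) = xi.
Proof. by move=> iz; apply: dtransK => //; exact: mat_dom. Qed.

Lemma tpush_linear i z : linear (tpush i z).
Proof. exact: dtrans_linear. Qed.

Lemma tpull_linear i z : linear (tpull i z).
Proof. exact: dtrans_linear. Qed.

Lemma tpush_mat z xi : tpush (mat z.1) z xi = xi.
Proof. by apply: dtrans_id; exact: mat_dom. Qed.

Lemma tpush_fst i z xi : mdom i z.1 -> (tpush i z xi).1 = tcoord (mat z.1) i z.1 xi.1.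
Proof. by move=> iz; apply: dtrans_fst => //; exact: mat_dom. Qed.

Lemma vrepE i (X : vfield M) p : vrep i X p = tpush i (tpsi i p) (X (tpsi i p)).
Proof. by []. Qed.

(** [vderiv] is defined through the reference chart at [z], and [mat] may jump from point to point.
    By the chain rule any chart around the base point computes it, so one fixed chart can serve on a
    whole open set. *)
Lemma vderiv_chart i z xi (f : TM -> R) : mdom i z.1 ->
  differentiable (f \o tpsi i) (tphi i z) ->
  vderiv z xi f = 'D_(tpush i z xi) (f \o tpsi i) (tphi i z).
Proof.
move=> iz fd; have mz := mat_dom z.1.
have tE : trans (mat z.1) i (tphi (mat z.1) z) = tphi i z by exact: trans_tphi.
have op : toverlap (mat z.1) i (tphi (mat z.1) z) by exact: toverlap_tphi.
have dt := trans_differentiable op.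
rewrite /vderiv /tpush (dtrans_derive xi mz iz).
transitivity ('D_('D_xi (trans (mat z.1) i) (tphi (mat z.1) z)) (f \o tpsi i)
  (trans (mat z.1) i (tphi (mat z.1) z))); last by rewrite tE.
have fd' : differentiable (f \o tpsi i) (trans (mat z.1) i (tphi (mat z.1) z)).
  by rewrite tE.
apply: (etrans _ (derive_comp xi dt fd')).
apply: (open_eq_derive _ (@toverlap_open (mat z.1) i) op) => p [iq jq].
by rewrite /trans /= tphiK.
Qed.

Lemma neq0_open : open [set y : V | y != 0].
Proof.
have -> : [set y : V | y != 0] = ~` [set 0].
  by apply/seteqP; split=> y /= /eqP.
exact/closed_openC/accessible_closed_set1/hausdorff_accessible/norm_hausdorff.
Qed.

Lemma tlocP i (W : set TM) z : mdom i z.1 -> W z -> tloc i W (tphi i z).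
Proof. by move=> iz Wz; split; [exact: mimg_mphi|rewrite tphiK]. Qed.

Lemma tlocI i (W W' : set TM) : tloc i (W `&` W') = tloc i W `&` tloc i W'.
Proof.
by apply/seteqP; split=> [p [? []]|p [[? ?] []]].
Qed.

Lemma tloc_sub i (W W' : set TM) : W `<=` W' -> tloc i W `<=` tloc i W'.
Proof. by move=> WW' p [? ?]; split=> //; exact: WW'. Qed.

Lemma tloc_dom i (W : set TM) p : tloc i W p -> mdom i (tpsi i p).1.
Proof. by case=> /mpsi_dom. Qed.

Lemma tlocK i (W : set TM) p : tloc i W p -> tphi i (tpsi i p) = p.
Proof. by case=> iq _; exact: tpsiK. Qed.

(** The open set over which the frames and constant fields of the chart [i] are smooth. It is the
    [W] with which the conditions on a connection are applied in chart computations. *)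
Definition chart_dom i : set TM := [set z | mdom i z.1 /\ z.2 != 0].

Lemma tloc_chart_dom i j p : tloc j (chart_dom i) p <-> toverlap j i p /\ p.2 != 0.
Proof.
split=> [[jp [/= ip p0]]|[[jp ip] p0]].
  by split; [split|apply/(tpsi_neq0 jp)].
by split=> //; split=> //; apply/(tpsi_neq0 jp).
Qed.

Lemma tloc_chart_toverlap i j p : tloc j (chart_dom i) p -> toverlap j i p.
Proof. by case/tloc_chart_dom. Qed.

Lemma open_chart_dom i : open_TM0 (chart_dom i).
Proof.
split=> [z []//|j].
have -> : tloc j (chart_dom i) = toverlap j i `&` (snd @^-1` [set y | y != 0]).
  by apply/seteqP; split=> p /tloc_chart_dom.
apply: openI; first exact: toverlap_open.
apply: open_comp => [p _|]; first exact: snd_continuous.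
exact: neq0_open.
Qed.

Lemma open_TM0I (W W' : set TM) : open_TM0 W -> open_TM0 W' -> open_TM0 (W `&` W').
Proof.
move=> [W0 Wo] [W0' Wo']; split=> [z [/W0]//|i].
by rewrite tlocI; apply: openI.
Qed.

Lemma tloc_chart_domE i : tloc i (chart_dom i) = tloc i (@TM0 R n M).
Proof.
apply/seteqP; split=> p [ip]; first by case.
by move=> p0; split=> //; split=> //; exact: mpsi_dom.
Qed.

Lemma open_TM0T : open_TM0 (@TM0 R n M).
Proof.
split=> // i; rewrite -tloc_chart_domE; exact: (open_chart_dom i).2.
Qed.

Lemma ssmooth_sub (W W' : set TM) (Y : section M) :
  W' `<=` W -> ssmooth W Y -> ssmooth W' Y.
Proof. by move=> WW Ys i; apply: smooth_on_sub (Ys i); exact: tloc_sub. Qed.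

Lemma vsmooth_sub (W W' : set TM) (Y : vfield M) :
  W' `<=` W -> vsmooth W Y -> vsmooth W' Y.
Proof. by move=> WW Ys i; apply: smooth_on_sub (Ys i); exact: tloc_sub. Qed.

Definition cfield i (xi : V * V) : vfield M := fun z => tpull i z xi.

Lemma vrep_cfield i j xi p : toverlap j i p ->
  vrep j (cfield i xi) p = dtrans i j (tpsi j p) xi.
Proof.
move=> [jp ip]; rewrite vrepE /cfield /tpush /tpull dtrans_comp//.
- exact: mat_dom.
- exact: mpsi_dom.
Qed.

Lemma cfield_smooth i xi : vsmooth (chart_dom i) (cfield i xi).
Proof.
move=> j; have oj := (open_chart_dom i).2 j.
have rVc := @has_coordinates_rV R n.
have tj p : tloc j (chart_dom i) p -> toverlap i j (trans j i p).
  move=> /tloc_chart_toverlap [jp ip].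
  by apply: toverlap_tphi => //; exact: mpsi_dom.
(* In another chart [j] the constant field has as components the derivative of [trans i j] along
   [xi], taken at the point with coordinates [trans j i p]. *)
apply: (@smooth_on_ext _ _ _ _ ('D_xi (trans i j) \o trans j i)) => //.
  move=> p pj; rewrite vrep_cfield; last exact: tloc_chart_toverlap.
  have [jp ip] := tloc_chart_toverlap pj.
  by rewrite /= dtrans_derive//; exact: mpsi_dom.
apply: (@smooth_on_comp _ _ _ _ _ (toverlap i j)) => //.
- exact: has_coordinates_prod.
- apply: smooth_on_sub (@trans_smooth j i) => p; exact: tloc_chart_toverlap.
- exact/smooth_on_derive/trans_smooth.
Qed.

Lemma vrep_cfield_id i xi p : (mphi i @` mdom i) p.1 -> vrep i (cfield i xi) p = xi.
Proof.
by move=> ip; rewrite vrepE /cfield tpullK//; exact: mpsi_dom.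
Qed.

Lemma cfield_vrep i (X : vfield M) p : (mphi i @` mdom i) p.1 ->
  cfield i (vrep i X p) (tpsi i p) = X (tpsi i p).
Proof. by move=> ip; rewrite /cfield vrepE tpushK//; exact: mpsi_dom. Qed.

Lemma srep_frame i j v p : toverlap j i p ->
  srep j (frame i v) p = tcoord i j (mpsi j p.1) v.
Proof.
move=> [jp ip]; rewrite /srep /frame /= tcoord_comp//; first exact: mat_dom.
exact: mpsi_dom.
Qed.

Lemma frame_smooth i v : ssmooth (chart_dom i) (@frame R n M i v).
Proof.
move=> j; have oj := (open_chart_dom i).2 j.
have rVc := @has_coordinates_rV R n.
have tj p : tloc j (chart_dom i) p -> overlap i j (tau j i p.1).
  move=> /tloc_chart_toverlap [jp ip].
  by apply: overlap_mphi => //; exact: mpsi_dom.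
apply: (@smooth_on_ext _ _ _ _ ('D_v (tau i j) \o (fun p => tau j i p.1))) => //.
  move=> p pj; rewrite srep_frame; last exact: tloc_chart_toverlap.
  rewrite /= -tcoordE; last exact: tj.
  by rewrite /tau /= mphiK//; have [] := tloc_chart_toverlap pj.
apply: (@smooth_on_comp _ _ _ _ _ (overlap i j)) => //.
- apply: (@smooth_on_sub _ _ _ (toverlap j i)).
    by move=> p; exact: tloc_chart_toverlap.
  apply: (@smooth_on_fst V V V (overlap j i) (tau j i)) => //.
    exact: overlap_open.
  exact: tau_smooth.
- exact/smooth_on_derive/tau_smooth.
Qed.

Lemma srep_frame_id i v p : (mphi i @` mdom i) p.1 -> srep i (@frame R n M i v) p = v.
Proof.
move=> ip; rewrite srep_frame ?tcoord_id//; first exact: mpsi_dom.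
by split=> //; exact: mpsi_dom.
Qed.

Lemma frame_srep i (Y : section M) p : (mphi i @` mdom i) p.1 ->
  frame i (srep i Y p) (tpsi i p) = Y (tpsi i p).
Proof.
by move=> ip; rewrite /frame /srep tcoordK//; [exact: mat_dom|exact: mpsi_dom].
Qed.

Lemma srep_rho i (X : vfield M) p : (mphi i @` mdom i) p.1 ->
  srep i (rho X) p = (vrep i X p).1.
Proof. by move=> ip; rewrite vrepE tpush_fst//; exact: mpsi_dom. Qed.

Lemma srep_taut i p : (mphi i @` mdom i) p.1 -> srep i (@taut R n M) p = p.2.
Proof.
by move=> ip; rewrite /srep /taut /= tcoordK//; [exact: mpsi_dom|exact: mat_dom].
Qed.

Lemma taut_smooth : ssmooth (@TM0 R n M) (@taut R n M).
Proof.
move=> i; have oi := open_TM0T.2 i.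
apply: (@smooth_on_ext _ _ _ _ snd) => //.
  by move=> p [ip _]; rewrite srep_taut.
by apply: smooth_on_linear => //; exact: snd_continuous.
Qed.

Lemma srepD i (Y Z : section M) p :
  srep i (fun z => Y z + Z z) p = srep i Y p + srep i Z p.
Proof. by rewrite /srep /= tcoordD. Qed.

Lemma srepZ i (f : TM -> R) (Y : section M) p :
  srep i (fun z => f z *: Y z) p = f (tpsi i p) *: srep i Y p.
Proof. by rewrite /srep /= tcoordZ. Qed.

Lemma ssmoothD (W : set TM) (Y Z : section M) : open_TM0 W ->
  ssmooth W Y -> ssmooth W Z -> ssmooth W (fun z => Y z + Z z).
Proof.
move=> [_ Wo] Ys Zs i.
rewrite (_ : srep i _ = fun p => srep i Y p + srep i Z p); last first.
  by apply/funext => p; rewrite srepD.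
exact: smooth_on_add.
Qed.

Lemma ssmoothZ (W : set TM) (f : TM -> R) (Y : section M) : open_TM0 W ->
  fsmooth W f -> ssmooth W Y -> ssmooth W (fun z => f z *: Y z).
Proof.
move=> [_ Wo] fs Ys i.
rewrite (_ : srep i _ = fun p => (f \o tpsi i) p *: srep i Y p); last first.
  by apply/funext => p; rewrite srepZ.
exact: smooth_on_scale.
Qed.

Lemma ssmooth_cst0 (W : set TM) : open_TM0 W -> ssmooth W (fun=> 0 : V).
Proof.
move=> [_ Wo] i.
rewrite (_ : srep i _ = fun=> 0); first exact: smooth_on_cst.
by apply/funext => p; rewrite /srep tcoord0.
Qed.

Lemma ssmooth_ext (W : set TM) (Y Z : section M) : open_TM0 W ->
  (forall z, W z -> Y z = Z z) -> ssmooth W Y -> ssmooth W Z.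
Proof.
move=> [_ Wo] YZ Ys i; apply: smooth_on_ext (Ys i) => // p [_ Wp].
by rewrite /srep YZ.
Qed.

Lemma vsmooth_ext (W : set TM) (Y Z : vfield M) : open_TM0 W ->
  (forall z, W z -> Y z = Z z) -> vsmooth W Y -> vsmooth W Z.
Proof.
move=> [_ Wo] YZ Ys i; apply: smooth_on_ext (Ys i) => // p [_ Wp].
by rewrite !vrepE YZ.
Qed.

Lemma fsmooth_cst (W : set TM) (a : R) : open_TM0 W -> fsmooth W (fun=> a).
Proof. by move=> [_ Wo] i; exact: smooth_on_cst. Qed.

Lemma rho_smooth (W : set TM) (X : vfield M) : open_TM0 W ->
  vsmooth W X -> ssmooth W (rho X).
Proof.
move=> [_ Wo] Xs i; apply: (@smooth_on_ext _ _ _ _ (fst \o vrep i X)) => //.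
  by move=> p [ip _]; rewrite srep_rho.
exact: (@smooth_on_lincomp _ _ _ _ _ fst (vrep i X) (Wo i) (@fst_continuous _ _ _) (Xs i)).
Qed.

End Charts.

(** * Connections in a chart *)

Lemma derive_fst (R : realType) (E F G : normedModType R) (U : set (E * F))
    (g : E * F -> G) (f : E -> G) (p xi : E * F) : open U -> U p ->
  (forall q, U q -> g q = f q.1) -> 'D_xi g p = 'D_(xi.1) f p.1.
Proof. by move=> Uo Up gf; rewrite (open_eq_derive _ Uo Up gf). Qed.

Section Connections.
Variables (R : realType) (n : nat) (M : manifold R n) (D : connection_data M).
Local Notation V := 'rV[R]_n.
Local Notation TM := (tangent_bundle M).
Implicit Types (i j : midx M) (x : M) (z : TM) (p : V * V).
Hypothesis Dconn : is_connection D.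

Lemma cov_smooth (W : set TM) (X : vfield M) (Y : section M) : open_TM0 W ->
  vsmooth W X -> ssmooth W Y -> ssmooth W (cov D X Y).
Proof. by move=> Wo; case: (Dconn Wo) => + _ _ _; apply. Qed.

Lemma connection_local (W : set TM) (Y Z : section M) z xi : open_TM0 W -> W z ->
  ssmooth W Y -> (forall w, W w -> Y w = Z w) -> D z xi Y = D z xi Z.
Proof.
move=> Wo Wz Ys YZ; have Zs := ssmooth_ext Wo YZ Ys.
(* The indicator of [W] is smooth on [W] with zero derivative, and f Y = f Z as global functions;
   the Leibniz rule then turns both sides into the values to be compared. *)
pose f (w : TM) : R := if `[< W w >] then 1 else 0.
have f1 w : W w -> f w = 1 by move=> Ww; rewrite /f asboolT.
have fs : fsmooth W f.
  move=> i; apply: (@smooth_on_ext _ _ _ _ (fun=> (1 : R))).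
  - exact: Wo.2.
  - by move=> p [_ Wp]; rewrite /= f1.
  - by apply: smooth_on_cst; exact: Wo.2.
have f0 : vderiv z xi f = 0.
  rewrite /vderiv (@open_eq_derive _ _ _ (tloc (mat z.1) W) _ (fun=> (1 : R))).
  - by rewrite derive_cst.
  - exact: Wo.2.
  - by apply: tlocP => //; exact: mat_dom.
  - by move=> p [_ Wp]; rewrite /= f1.
have fYZ : (fun w => f w *: Y w) = (fun w => f w *: Z w).
  apply/funext => w; rewrite /f; case: asboolP => [Ww|_]; first by rewrite YZ.
  by rewrite !scale0r.
have [_ _ _ DL] := Dconn Wo.
have := DL f Y z xi fs Ys Wz; rewrite fYZ (DL f Z z xi fs Zs Wz).
by rewrite f0 f1// !scale0r !add0r !scale1r.
Qed.

Lemma connection_const_scale (W : set TM) (Y : section M) z xi (a : R) :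
  open_TM0 W -> W z -> ssmooth W Y ->
  D z xi (fun w => a *: Y w) = a *: D z xi Y.
Proof.
move=> Wo Wz Ys; have [_ _ _ DL] := Dconn Wo.
rewrite (DL (fun=> a))//; last exact: fsmooth_cst.
have -> : vderiv z xi (fun=> a) = 0.
  by apply: (etrans _ (derive_cst a (tphi (mat z.1) z) xi)).
by rewrite scale0r add0r.
Qed.

Lemma connection0 z xi : TM0 z -> D z xi (fun=> 0) = 0.
Proof.
move=> z0; have := connection_const_scale xi 0 (@open_TM0T _ _ M) z0
  (ssmooth_cst0 (@open_TM0T _ _ M)).
have -> : (fun _ : TM => 0 *: (0 : V)) = fun=> 0.
  by apply/funext => w; rewrite scaler0.
by move=> e; rewrite e; exact: scale0r.
Qed.

Lemma connection_sum (W : set TM) m (f : 'I_m -> TM -> R) (Y : 'I_m -> section M)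
    z xi : open_TM0 W -> W z ->
  (forall k, fsmooth W (f k)) -> (forall k, ssmooth W (Y k)) ->
  D z xi (fun w => \sum_k f k w *: Y k w)
  = \sum_k (vderiv z xi (f k) *: Y k z + f k z *: D z xi (Y k)).
Proof.
move=> Wo Wz; have [_ _ DA DL] := Dconn Wo.
suff H : (forall k, fsmooth W (f k)) -> (forall k, ssmooth W (Y k)) ->
    ssmooth W (fun w => \sum_k f k w *: Y k w) /\
    D z xi (fun w => \sum_k f k w *: Y k w)
    = \sum_k (vderiv z xi (f k) *: Y k z + f k z *: D z xi (Y k)).
  by move=> fs Ys; have [] := H fs Ys.
elim: m f Y => [|m IH] f Y fs Ys.
  rewrite big_ord0 (_ : (fun _ => _) = fun=> 0); last first.
    by apply/funext => w; rewrite big_ord0.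
  split; first exact: ssmooth_cst0.
  by apply: connection0; exact: Wo.1.
have [IHs IHE] := IH (fun k => f (lift ord0 k)) (fun k => Y (lift ord0 k))
  (fun k => fs _) (fun k => Ys _).
have s0 : ssmooth W (fun w => f ord0 w *: Y ord0 w) by apply: ssmoothZ.
rewrite (_ : (fun w => _) = fun w => f ord0 w *: Y ord0 w
    + \sum_k f (lift ord0 k) w *: Y (lift ord0 k) w); last first.
  by apply/funext => w; rewrite big_ord_recl.
split; first exact: ssmoothD.
by rewrite big_ord_recl (DA _ _ z xi s0 IHs Wz) IHE (DL _ _ z xi (fs _) (Ys _) Wz).
Qed.

Definition scoord i (Y : section M) (k : 'I_n) : TM -> R :=
  fun z => (srep i Y (tphi i z)) 0 k.

Lemma srep_trans i j (Y : section M) p : toverlap j i p ->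
  srep i Y (trans j i p) = 'D_(srep j Y p) (tau j i) p.1.
Proof.
move=> jip; have [jp ip] := jip.
have zE : tpsi i (trans j i p) = tpsi j p by exact: tphiK.
rewrite -(tcoordE _ jip) /srep zE; apply: esym; apply: tcoord_comp => //.
  exact: mat_dom.
exact: mpsi_dom.
Qed.

Lemma scoord_smooth (W : set TM) i (Y : section M) (k : 'I_n) : open_TM0 W ->
  W `<=` chart_dom i -> ssmooth W Y -> fsmooth W (scoord i Y k).
Proof.
move=> [_ Wo] Wi Ys j.
have Wji p : tloc j W p -> toverlap j i p.
  by move=> /(tloc_sub Wi)/tloc_chart_toverlap.
have rVc := @has_coordinates_rV R n.
pose g (v : V) : R := v 0 k.
have gl : linear g by move=> a u v; rewrite /g !mxE.
pose gL : {linear V -> R} := HB.pack_for {linear V -> R} g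
  (GRing.isLinear.Build _ _ _ _ _ gl).
apply: (@smooth_on_ext _ _ _ _ (gL \o (fun p => 'D_(srep j Y p) (tau j i) p.1))).
- exact: Wo.
- by move=> p Wp; rewrite /scoord /= /g -srep_trans//; exact: Wji.
- apply: smooth_on_lincomp; [exact: Wo|exact: coord_continuous|].
  apply: (@smooth_on_app _ _ _ _ _ (fun p v => 'D_v (tau j i) p.1)) => //.
  + move=> p /Wji op a u v; rewrite derive_linear//.
    exact: (smooth_on_differentiable (@tau_smooth _ _ _ j i)).
  + move=> w; apply: (@smooth_on_sub _ _ _ (toverlap j i)); first exact: Wji.
    apply: (@smooth_on_fst R V V V (overlap j i) ('D_w (tau j i))) => //.
      exact: overlap_open.
    exact/smooth_on_derive/tau_smooth.
Qed.

Lemma scoord_frame i (Y : section M) z : mdom i z.1 ->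
  Y z = \sum_k scoord i Y k z *: frame i (delta_mx 0 k) z.
Proof.
move=> iz; rewrite -[in LHS](tphiK iz) -frame_srep; last exact: mimg_mphi.
rewrite tphiK// {1}/frame [srep i Y _]row_sum_delta.
rewrite (linear_combination _ _ (@tcoord_linear _ _ _ _ _ _)).
by apply: eq_bigr => k _.
Qed.

(** The connection 1-forms over TM_0 in the frame of the chart. Vertical directions are kept here,
    until vanishing torsion shows that they contribute nothing. *)
Definition connection_form i p (xi : V * V) (b : V) : V :=
  srep i (cov D (cfield i xi) (frame i b)) p.

Lemma tloc_chart i p : tloc i (@TM0 R n M) p -> chart_dom i (tpsi i p).
Proof. by rewrite -tloc_chart_domE => -[]. Qed.

Lemma connection_form_linearr i p xi :
  tloc i (@TM0 R n M) p -> linear (connection_form i p xi).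
Proof.
move=> ip a u v; rewrite /connection_form /srep /cov.
have oi := open_chart_dom i; have fi := @frame_smooth _ _ M i.
have zi := tloc_chart ip.
have -> : frame i (a *: u + v) = (fun w : TM => a *: frame i u w + frame i v w).
  by apply/funext => w; rewrite /frame tcoordD tcoordZ.
have [_ _ DA _] := Dconn oi.
have au : ssmooth (chart_dom i) (fun w : TM => a *: frame i u w).
  by apply: ssmoothZ => //; exact: fsmooth_cst.
rewrite (DA _ _ _ _ au (fi v) zi) (connection_const_scale _ _ oi zi (fi u)).
by rewrite tcoordD tcoordZ.
Qed.

Lemma connection_form_linearl i p b : tloc i (@TM0 R n M) p ->
  linear (fun xi => connection_form i p xi b).
Proof.
move=> ip a u v; rewrite /connection_form /srep /cov /cfield.
have [_ DX _ _] := Dconn (open_chart_dom i).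
rewrite tpull_linear (DX _ _ _ _ _ (@frame_smooth _ _ M i b) (tloc_chart ip)).
by rewrite tcoordD tcoordZ.
Qed.

Lemma connection_form_smooth i xi b :
  smooth_on (tloc i (@TM0 R n M)) (fun p => connection_form i p xi b).
Proof.
have H := cov_smooth (open_chart_dom i) (@cfield_smooth _ _ M i xi)
  (@frame_smooth _ _ M i b).
by have := H i; rewrite tloc_chart_domE.
Qed.

(** Over the part of [W] inside the chart, the section is a combination of frames with smooth
    coefficients, and the Leibniz rule applies to each term. [X] matters only through its value at
    the point, so it can be traded for the constant field with the same components. *)
Lemma cov_connection_form (W : set TM) i (X : vfield M) (Y : section M) p : open_TM0 W ->
  ssmooth W Y -> tloc i W p ->
  srep i (cov D X Y) p
  = 'D_(vrep i X p) (srep i Y) p + connection_form i p (vrep i X p) (srep i Y p).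
Proof.
move=> Wo Ys iWp; have [ip Wp] := iWp; set z := tpsi i p.
have iz : mdom i z.1 by exact: mpsi_dom.
pose W' := W `&` chart_dom i.
have zi : chart_dom i z by split=> //; exact: Wo.1.
have Wo' : open_TM0 W' by apply: open_TM0I => //; exact: open_chart_dom.
have Ys' : ssmooth W' Y by apply: ssmooth_sub Ys; exact: subIsetl.
have W'i : W' `<=` chart_dom i by exact: subIsetr.
have pE : tphi i z = p by exact: tpsiK.
have ip0 : tloc i (@TM0 R n M) p by split=> //; exact: Wo.1.
have fs k : fsmooth W' (scoord i Y k) by exact: scoord_smooth.
have Fs k : ssmooth W' (@frame _ _ M i (delta_mx 0 k)).
  by apply: ssmooth_sub (@frame_smooth _ _ M i _); exact: subIsetr.
set xi := vrep i X p.
have XE : X z = cfield i xi z by rewrite cfield_vrep.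
rewrite {1}/srep /cov -/z XE.
rewrite (@connection_local W' Y (fun w => \sum_k scoord i Y k w *:
  frame i (delta_mx 0 k) w) z _ Wo')//; last first.
  by move=> w [_ [iw _]]; exact: scoord_frame.
rewrite (connection_sum _ Wo')//.
have tl := @tcoord_linear _ _ M (mat z.1) i z.1.
rewrite big_split /= tcoordD; congr (_ + _); last first.
  rewrite (linear_combination _ _ tl) [srep i Y p]row_sum_delta.
  rewrite (linear_combination _ _ (connection_form_linearr xi ip0)).
  by apply: eq_bigr => k _; rewrite /scoord pE.
rewrite (linear_combination _ _ tl) [RHS]row_sum_delta.
apply: eq_bigr => k _.
have iWo' : open (tloc i W') by exact: Wo'.2.
have iWp' : tloc i W' p by split.
have -> : tcoord (mat z.1) i z.1 (frame i (delta_mx 0 k) z) = delta_mx 0 k.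
  by rewrite /frame tcoordK//; exact: mat_dom.
congr (_ *: _).
have fd : differentiable (scoord i Y k \o tpsi i) (tphi i z).
  by rewrite pE; exact: (smooth_on_differentiable (fs k i)).
rewrite (vderiv_chart _ iz fd) pE /cfield tpullK//.
have Yd := smooth_on_differentiable (Ys' i) iWp'.
have Ydv : derivable (srep i Y) p xi by exact: diff_derivable.
rewrite (derive_mx Ydv) mxE; apply: (open_eq_derive _ iWo' iWp') => q [iq _].
by rewrite /scoord /= tpsiK.
Qed.

(** * Torsion-free connections: Christoffel symbols and horizontal lifts *)

Section TorsionFree.
Hypothesis Dtors : forall (W : set TM) (X Y : vfield M), open_TM0 W ->
  vsmooth W X -> vsmooth W Y -> forall z, W z ->
  cov D X (rho Y) z - cov D Y (rho X) z = rho (bracket X Y) z.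

(** [X] is projectable: its base components do not depend on y, so differentiating them along the
    vertical [Y] gives 0. The base components of [Y] vanish on [W], and so do their derivatives
    along [X]. *)
Lemma rho_bracket_vertical (W : set TM) i (X Y : vfield M) (a : V) z :
  open_TM0 W -> W `<=` chart_dom i -> vsmooth W X -> vsmooth W Y ->
  (forall w, W w -> rho X w = frame i a w) -> (forall w, W w -> rho Y w = 0) ->
  W z -> rho (bracket X Y) z = 0.
Proof.
move=> Wo Wi Xs Ys Xa Y0 Wz; set m := mat z.1; set p := tphi m z.
have mz : mdom m z.1 by exact: mat_dom.
have pW : tloc m W p by exact: tlocP.
have mWo : open (tloc m W) by exact: Wo.2.
have Xd := smooth_on_differentiable (Xs m) pW.
have Yd := smooth_on_differentiable (Ys m) pW.
have fE (u : V * V) (Z : vfield M) : differentiable (vrep m Z) p ->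
    ('D_u (vrep m Z) p).1 = 'D_u (fst \o vrep m Z) p.
  by move=> Zd; rewrite (derive_lincomp u (@fst_continuous _ _ _) Zd).
have Y1 q : tloc m W q -> (vrep m Y q).1 = 0.
  by move=> [mq Wq]; rewrite -srep_rho// /srep Y0// tcoord0.
have X1 q : tloc m W q -> (vrep m X q).1 = tcoord i m (mpsi m q.1) a.
  move=> [mq Wq]; rewrite -srep_rho// /srep Xa// -srep_frame//; split=> //.
  by have [] := Wi _ Wq.
have e1 : ('D_(vrep m X p) (vrep m Y) p).1 = 0.
  apply: (etrans (fE _ _ Yd)); apply: (etrans (open_eq_derive _ mWo pW Y1)).
  exact: derive_cst.
have e2 : ('D_(vrep m Y p) (vrep m X) p).1 = 0.
  apply: (etrans (fE _ _ Xd)); rewrite [vrep m Y p]surjective_pairing Y1//.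
  apply: (etrans (@derive_fst _ _ _ _ _ _ (fun q => tcoord i m (mpsi m q) a)
    _ _ mWo pW X1)).
  exact: derive0.
by rewrite -[LHS]/(_ - _) [X in X - _]e1 [X in _ - X]e2 subr0.
Qed.

Lemma rho_cfield i xi z : mdom i z.1 -> rho (cfield i xi) z = frame i xi.1 z.
Proof. by move=> iz; rewrite /rho /cfield /tpull dtrans_fst//; exact: mat_dom. Qed.

(** Vanishing torsion is tested on X = (a, 0) and Y = (0, b). Both D_X rho(Y) and rho[X, Y] vanish,
    which leaves D_Y of the frame section rho(X) equal to 0. *)
Lemma connection_form_vertical i p a b :
  tloc i (@TM0 R n M) p -> connection_form i p (0, b) a = 0.
Proof.
move=> ip; have zi := tloc_chart ip; have oi := open_chart_dom i.
have Xs := @cfield_smooth _ _ M i (a, 0).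
have Ys := @cfield_smooth _ _ M i (0, b).
have Xa z : chart_dom i z -> rho (cfield i (a, 0)) z = frame i a z.
  by move=> [iz _]; rewrite rho_cfield.
have Y0 z : chart_dom i z -> rho (cfield i (0, b)) z = 0.
  by move=> [iz _]; rewrite rho_cfield// /frame tcoord0.
have := Dtors oi Xs Ys zi.
rewrite (rho_bracket_vertical oi _ Xs Ys Xa Y0 zi)// /connection_form /srep.
rewrite {1}/cov (connection_local _ oi zi _ Y0); last exact: rho_smooth.
rewrite connection0; last by case: zi.
rewrite sub0r => /eqP; rewrite oppr_eq0 /cov.
rewrite (connection_local _ oi zi _ Xa); last exact: rho_smooth.
by move/eqP => ->; rewrite tcoord0.
Qed.

Definition Gamma i p (a b : V) : V := connection_form i p (a, 0) b.

Lemma connection_formE i p xi b : tloc i (@TM0 R n M) p ->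
  connection_form i p xi b = Gamma i p xi.1 b.
Proof.
move=> ip; have {1}-> : xi = 1 *: (xi.1, 0) + (0, xi.2).
  by rewrite scale1r; case: xi => u v; congr pair; rewrite /= ?addr0 ?add0r.
by rewrite (connection_form_linearl b ip) connection_form_vertical// scale1r addr0.
Qed.

Lemma Gamma_linearr i p a : tloc i (@TM0 R n M) p -> linear (Gamma i p a).
Proof. exact: connection_form_linearr. Qed.

Lemma Gamma_linearl i p b : tloc i (@TM0 R n M) p -> linear (fun a => Gamma i p a b).
Proof.
move=> ip c u v; rewrite /Gamma -(connection_form_linearl b ip); congr connection_form.
by congr pair; rewrite /= scaler0 addr0.
Qed.

Lemma Gamma_smooth i a b : smooth_on (tloc i (@TM0 R n M)) (fun p => Gamma i p a b).
Proof. exact: connection_form_smooth. Qed.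

(** Constant fields of a chart commute, so vanishing torsion is symmetry of Gamma. [bracket] is
    computed in the reference chart at [z], which is the chart in which the symmetry is stated and
    later used. *)
Lemma Gamma_sym z a b : TM0 z ->
  Gamma (mat z.1) (tphi (mat z.1) z) a b = Gamma (mat z.1) (tphi (mat z.1) z) b a.
Proof.
move=> z0; set i := mat z.1; set p := tphi i z.
have iz : mdom i z.1 by exact: mat_dom.
have zi : chart_dom i z by split.
have oi := open_chart_dom i.
have zE : tpsi i p = z by exact: tphiK.
have Xa c w : chart_dom i w -> rho (cfield i (c, 0)) w = frame i c w.
  by move=> [iw _]; rewrite rho_cfield.
have br0 : rho (bracket (cfield i (a, 0)) (cfield i (b, 0))) z = 0.
  have io : open (tloc i (chart_dom i)) by exact: oi.2.
  have ip : tloc i (chart_dom i) p by exact: tlocP.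
  have c0 u c : 'D_u (vrep i (cfield i (c, 0))) p = 0.
    rewrite (@open_eq_derive _ _ _ _ _ (fun=> (c, 0)) p _ io ip) ?derive_cst//.
    by move=> q [iq _]; exact: vrep_cfield_id.
  by rewrite /rho /bracket -/i -/p !c0 subr0.
have := Dtors oi (@cfield_smooth _ _ M i (a, 0)) (@cfield_smooth _ _ M i (b, 0)) zi.
rewrite br0 => /eqP; rewrite subr_eq0 => /eqP; rewrite /cov.
rewrite (connection_local _ oi zi _ (Xa b)); last exact/rho_smooth/cfield_smooth.
rewrite (connection_local _ oi zi _ (Xa a)); last exact/rho_smooth/cfield_smooth.
by move=> e; rewrite /Gamma /connection_form /srep /cov zE e.
Qed.

Lemma cov_chart (W : set TM) i (X : vfield M) (Y : section M) p : open_TM0 W ->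
  ssmooth W Y -> tloc i W p ->
  srep i (cov D X Y) p
  = 'D_(vrep i X p) (srep i Y) p + Gamma i p (srep i (rho X) p) (srep i Y p).
Proof.
move=> Wo Ys iWp; rewrite (cov_connection_form _ Wo Ys iWp) connection_formE.
  by rewrite srep_rho//; case: iWp.
by apply: tloc_sub iWp; exact: Wo.1.
Qed.

Lemma mu_chart i (X : vfield M) p : tloc i (@TM0 R n M) p ->
  srep i (mu D X) p = (vrep i X p).2 + Gamma i p (vrep i X p).1 p.2.
Proof.
move=> ip; have io : open (tloc i (@TM0 R n M)) by exact: (@open_TM0T _ _ M).2.
rewrite (cov_chart _ (@open_TM0T _ _ M) (@taut_smooth _ _ M) ip).
rewrite srep_rho ?srep_taut//; try by case: ip.
congr (_ + _).
rewrite (@open_eq_derive _ _ _ _ _ snd p _ io ip) ?derive_linear_fun//.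
  exact: snd_continuous.
by move=> q [iq _]; exact: srep_taut.
Qed.

(** By [mu_chart], mu(a, b) = b + Gamma(a) y, so exactly one horizontal vector lies over [w]. Since
    [hlift] is chosen by [xget], a witness has to be exhibited first, to exclude the default value
    0. *)
Lemma hlift_chart i z (w : V) : chart_dom i z ->
  hlift D z w = tpull i z (tcoord (mat z.1) i z.1 w,
    - Gamma i (tphi i z) (tcoord (mat z.1) i z.1 w) (tphi i z).2).
Proof.
move=> [iz z0]; set w' := tcoord _ i _ w; set p := tphi i z.
have ip : tloc i (@TM0 R n M) p by exact: tlocP.
have zE : tpsi i p = z by exact: tphiK.
have muE xi : tcoord (mat z.1) i z.1 (mu_at D z xi)
    = (tpush i z xi).2 + Gamma i p (tpush i z xi).1 p.2.
  by have := mu_chart (fun=> xi) ip; rewrite vrepE {1}/srep /mu /cov zE.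
pose A := [set xi : V * V | xi.1 = w /\ mu_at D z xi = 0].
have mz := mat_dom z.1.
have [h1 h2] : A (hlift D z w).
  apply: (@xgetPex _ 0 A); exists (tpull i z (w', - Gamma i p w' p.2)); split.
    by rewrite /tpull dtrans_fst//= /w' tcoordK.
  by rewrite -[LHS](tcoordK _ mz iz) muE tpullK//= addNr tcoord0.
rewrite -[LHS](tpushK _ iz); congr (tpull _ _).
have e1 : (tpush i z (hlift D z w)).1 = w' by rewrite tpush_fst// h1.
have := muE (hlift D z w); rewrite h2 tcoord0 e1 => /esym/eqP.
rewrite addr_eq0 => /eqP e2.
by rewrite [LHS]surjective_pairing e1 e2.
Qed.

Lemma vrep_hlift i (w : section M) p : tloc i (@TM0 R n M) p ->
  vrep i (fun z => hlift D z (w z)) p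
  = (srep i w p, - Gamma i p (srep i w p) p.2).
Proof.
move=> ip; have zi := tloc_chart ip; have [iz _] := zi.
rewrite vrepE (hlift_chart _ zi) tpullK// tpsiK//; by case: ip.
Qed.

Lemma hlift_smooth (W : set TM) (w : section M) : open_TM0 W ->
  ssmooth W w -> vsmooth W (fun z => hlift D z (w z)).
Proof.
move=> Wo ws i; have iWo : open (tloc i W) by exact: Wo.2.
have W0 p : tloc i W p -> tloc i (@TM0 R n M) p by apply: tloc_sub; exact: Wo.1.
have rVc := @has_coordinates_rV R n.
apply: (@smooth_on_ext _ _ _ _ (fun p => (srep i w p, - Gamma i p (srep i w p) p.2))).
- exact: iWo.
- by move=> p /W0 ip; rewrite vrep_hlift.
- apply: smooth_on_pair => //.
  apply: smooth_on_opp => //.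
  apply: (@smooth_on_app _ _ _ _ _ (fun p => Gamma i p (srep i w p)) snd) => //.
  + by move=> p /W0 ip; exact: Gamma_linearr.
  + move=> b; apply: (@smooth_on_app _ _ _ _ _ (fun p a => Gamma i p a b)) => //.
    * by move=> p /W0 ip; exact: Gamma_linearl.
    * by move=> a; apply: smooth_on_sub (@Gamma_smooth i a b) => p /W0.
  + by apply: smooth_on_linear => //; exact: snd_continuous.
Qed.

Lemma mu_hlift z (w : V) : TM0 z -> mu_at D z (hlift D z w) = 0.
Proof.
move=> z0; set i := mat z.1; have iz : mdom i z.1 by exact: mat_dom.
have ip : tloc i (@TM0 R n M) (tphi i z) by exact: tlocP.
have := mu_chart (fun z => hlift D z w) ip.
rewrite vrep_hlift//= addNr /srep /mu /cov tphiK// -/i => e.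
by rewrite -(tcoord_id (mu_at D z (hlift D z w)) iz).
Qed.

Lemma hlift_fst z (w : V) : TM0 z -> (hlift D z w).1 = w.
Proof.
move=> z0; set i := mat z.1; have iz : mdom i z.1 by exact: mat_dom.
have zi : chart_dom i z by split.
by rewrite (hlift_chart w zi) /tpull dtrans_fst//= tcoordK.
Qed.

End TorsionFree.
End Connections.

(** * The core of the argument, in one chart *)

(* [G] stands for Gamma, [horizontal_metric p c a b] for Q_{cab}, and
   [horizontal_cartan p c a b l] for C_{abl|c}. *)
Section LocalArgument.
Variables (R : realType) (n : nat).
Local Notation V := 'rV[R]_n.
Variables (U : set (V * V)) (g : V * V -> V -> V -> R) (G : V * V -> V -> V -> V).
Implicit Types (p xi : V * V) (a b c l : V).
Hypothesis Uo : open U.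
Hypothesis gs : forall a b, smooth_on U (fun p => g p a b).
Hypothesis gl : forall p b, U p -> linear (fun a => g p a b).
Hypothesis gsym : forall p a b, U p -> g p a b = g p b a.
Hypothesis Gs : forall a b, smooth_on U (fun p => G p a b).
Hypothesis Gl : forall p b, U p -> linear (fun a => G p a b).
Hypothesis Gr : forall p a, U p -> linear (G p a).
Hypothesis Gvert : forall p a b l, U p -> 'D_(0, l) (fun p => G p a b) p = 0.

Variable C : V * V -> V -> V -> V -> R.
Hypothesis CE : forall p a b c, C p a b c = 'D_(0, c) (fun p => g p a b) p.
Hypothesis Csym : forall p a b c, U p -> C p a b c = C p a c b.
Hypothesis Cy : forall p a b, U p -> C p a b p.2 = 0.

Let hor p c : V * V := (c, - G p c p.2).

Definition horizontal_metric p c a b : R :=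
  'D_(hor p c) (fun p => g p a b) p - g p (G p c a) b - g p a (G p c b).
Local Notation Q := horizontal_metric.
Hypothesis Qy : forall p a b, U p -> Q p p.2 a b = 0.

Definition horizontal_cartan p c a b l : R :=
  'D_(hor p c) (fun p => C p a b l) p
  - C p (G p c a) b l - C p a (G p c b) l - C p a b (G p c l).
Local Notation N := horizontal_cartan.

Let rVc : has_coordinates V.
Proof. exact: has_coordinates_rV. Qed.

Let gd p a b : U p -> differentiable (fun p => g p a b) p.
Proof. exact: smooth_on_differentiable. Qed.

Let Gd p a b : U p -> differentiable (fun p => G p a b) p.
Proof. exact: smooth_on_differentiable. Qed.

Let gr p a : U p -> linear (g p a).
Proof. by move=> Up s u v; rewrite ![g p a _]gsym// gl. Qed.

Let Cs a b c : smooth_on U (fun p => C p a b c).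
Proof.
rewrite (_ : (fun p => _) = 'D_(0, c) (fun p => g p a b)).
  exact/smooth_on_derive/gs.
by apply/funext => p; rewrite CE.
Qed.

Let Cfun a b c : (fun p => C p a b c) = 'D_(0, c) (fun p => g p a b).
Proof. by apply/funext => p; rewrite CE. Qed.

Let is_derive_diff (f : V * V -> R) p xi (df : R) : differentiable f p ->
  'D_xi f p = df -> is_derive p xi f df.
Proof. by move=> fd fE; apply: DeriveDef => //; exact: diff_derivable. Qed.

Let Cd p a b c : U p -> differentiable (fun p => C p a b c) p.
Proof. exact/smooth_on_differentiable/Cs. Qed.

Let Csym12 p a b c : U p -> C p a b c = C p b a c.
Proof.
by move=> Up; rewrite !CE; apply: (open_eq_derive _ Uo Up) => q Uq; exact: gsym.
Qed.

Let Cl3 p a b : U p -> linear (C p a b).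
Proof.
move=> Up s u v; rewrite !CE -derive_linear; last exact: gd.
by congr ('D_ _ _ _); congr pair; rewrite /= scaler0 addr0.
Qed.

Let horE p c : hor p c = (c, 0) + -1 *: (0, G p c p.2).
Proof. by congr pair; rewrite /= ?scaler0 ?addr0 ?add0r ?scaleN1r. Qed.

Let D_hor (f : V * V -> R) p c : differentiable f p ->
  'D_(hor p c) f p = 'D_(c, 0) f p - 'D_(0, G p c p.2) f p.
Proof.
by move=> fd; rewrite horE derive_addv// derive_scalev// scaleN1r.
Qed.

Let D_snd p xi : 'D_xi (snd : V * V -> V) p = xi.2.
Proof. by rewrite derive_linear_fun//; exact: snd_continuous. Qed.

Let d_snd p : differentiable (snd : V * V -> V) p.
Proof. exact/linear_differentiable/snd_continuous. Qed.

Let spray_derive p c xi : U p ->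
  differentiable (fun p => G p c p.2) p /\
  'D_xi (fun p => G p c p.2) p = 'D_xi (fun q => G q c p.2) p + G p c xi.2.
Proof.
move=> Up; split.
  apply: (@differentiable_app _ _ _ _ U (fun p => G p c) snd) => //.
  - by move=> q Uq; exact: Gr.
  - by move=> w; exact: Gd.
rewrite (@derive_app _ _ _ _ U (fun p => G p c) snd)// ?D_snd//.
- by move=> q Uq; exact: Gr.
- by move=> w; exact: Gd.
Qed.

Let QE p c a b : U p -> Q p c a b =
  'D_(c, 0) (fun p => g p a b) p - C p a b (G p c p.2)
  - g p (G p c a) b - g p a (G p c b).
Proof. by move=> Up; rewrite /Q D_hor ?CE//; exact: gd. Qed.

Let Ql p a b : U p -> linear (fun c => Q p c a b).
Proof.
move=> Up s u v; rewrite !QE// !(Gl _ Up) (gl _ Up) (gr _ Up) (Cl3 _ _ Up).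
have -> : (s *: u + v, 0) = s *: (u, 0) + (v, 0) :> V * V.
  by congr pair; rewrite /= scaler0 addr0.
rewrite derive_linear; last exact: gd.
have sE (x y : R) : x *: y = x * y by [].
rewrite !sE; move: (C p a b _) (C p a b _) ('D_(u, 0) _ p) ('D_(v, 0) _ p).
move: (g p _ b) (g p _ b) (g p a _) (g p a _) => x1 x2 x3 x4 y1 y2 z1 z2.
by ring.
Qed.

Let gGd p a b c : U p -> differentiable (fun p => g p (G p c a) b) p.
Proof.
move=> Up; apply: (@differentiable_app _ _ _ _ U (fun p w => g p w b)) => //.
- by move=> q Uq; exact: gl.
- by move=> w; exact: gd.
- exact: Gd.
Qed.

Let gGD p a b c l : U p ->
  'D_(0, l) (fun p => g p (G p c a) b) p = C p (G p c a) b l.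
Proof.
move=> Up; rewrite (@derive_app _ _ _ _ U (fun p w => g p w b))//.
- by rewrite Gvert// (linear_fun0 (gl b Up)) addr0.
- by move=> q Uq; exact: gl.
- by move=> w; exact: gd.
- exact: Gd.
Qed.

Let CGd p a b c : U p -> differentiable (fun p => C p a b (G p c p.2)) p.
Proof.
move=> Up; have [sd _] := spray_derive c 0 Up.
apply: (@differentiable_app _ _ _ _ U (fun p => C p a b)) => //.
- by move=> q Uq; exact: Cl3.
- by move=> w; exact: Cd.
Qed.

(** Two contributions. Exchanging fibre derivatives turns the l-derivative of C(a, b, w) into the
    w-derivative of C(a, b, l), and it becomes the vertical part of the horizontal derivative of C.
    Differentiating y in Gamma(c) y gives Gamma(c) l, the connection term of the new slot. *)
Let CGD p a b c l : U p ->
  'D_(0, l) (fun p => C p a b (G p c p.2)) p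
  = 'D_(0, G p c p.2) (fun p => C p a b l) p + C p a b (G p c l).
Proof.
move=> Up; have [sd sD] := spray_derive c (0, l) Up.
have e : 'D_(0, l) (fun p => G p c p.2) p = G p c l.
  by rewrite sD Gvert//= add0r.
apply: (etrans (@derive_app R _ _ _ U (fun p => C p a b) (fun p => G p c p.2) p
  (0, l) rVc Uo Up (fun q Uq => Cl3 a b Uq) (fun w => Cd a b w Up) sd)).
apply: congr2; last by rewrite e.
rewrite (Cfun a b (G p c p.2)) (Cfun a b l).
exact: (derive_swap _ _ (@has_coordinates_regular R) Uo Up (gs a b)).
Qed.

(** Q as a difference of functions, with the arguments of the last metric term exchanged so that
    [gGD] serves for both metric terms. *)
Let Qsum c a b : V * V -> R := 'D_(c, 0) (fun p => g p a b)
  - (fun p => C p a b (G p c p.2))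
  - (fun p => g p (G p c a) b) - (fun p => g p (G p c b) a).

Let QsumE p c a b : U p -> Qsum c a b p = Q p c a b.
Proof. by move=> Up; rewrite QE// [g p a _]gsym. Qed.

Let dQ p c a b : U p -> differentiable (fun p => Q p c a b) p.
Proof.
move=> Up; apply: (open_eq_differentiable Uo Up (fun q Uq => QsumE c a b Uq)).
apply: differentiableB; last exact: gGd.
apply: differentiableB; last exact: gGd.
apply: differentiableB; last exact: CGd.
exact/(smooth_on_differentiable _ Up)/smooth_on_derive.
Qed.

(** As Gamma does not depend on y, fibre differentiation commutes with the covariant horizontal
    derivative, and it turns g into C. *)
Let DQ p c a b l : U p -> 'D_(0, l) (fun p => Q p c a b) p = N p c a b l.
Proof.
move=> Up; have d1 : differentiable ('D_(c, 0) (fun p => g p a b)) p.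
  exact/(smooth_on_differentiable _ Up)/smooth_on_derive.
have e1 : 'D_(0, l) ('D_(c, 0) (fun p => g p a b)) p = 'D_(c, 0) (fun p => C p a b l) p.
  rewrite (Cfun a b l).
  exact: (derive_swap _ _ (@has_coordinates_regular R) Uo Up (gs a b)).
have i1 := is_derive_diff d1 e1.
have i2 := is_derive_diff (CGd a b c Up) (CGD a b c l Up).
have i3 := is_derive_diff (gGd a b c Up) (gGD a b c l Up).
have i4 := is_derive_diff (gGd b a c Up) (gGD b a c l Up).
have i := is_deriveB (is_deriveB (is_deriveB i1 i2) i3) i4.
apply: (etrans (esym (open_eq_derive _ Uo Up (fun q Uq => QsumE c a b Uq)))).
case: i => _ iE; apply: (etrans iE); rewrite /N (D_hor c (Cd a b l Up)).
rewrite (Csym12 (G p c b) a l Up).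
move: ('D_(c, 0) _ p) ('D_(0, _) _ p) (C p (G p c a) b l) (C p a _ l).
move: (C p a b (G p c l)) => x1 x2 x3 x4 x5.
by ring.
Qed.

(** The fibre derivative of Q_{kab} y^k = 0 along l: differentiating Q gives C_{abl|k} y^k,
    differentiating y gives Q_{lab}. *)
Let N_y p a b l : U p -> N p p.2 a b l = - Q p l a b.
Proof.
move=> Up; have e := @derive_app R _ _ _ U (fun p c => Q p c a b) snd p (0, l)
  rVc Uo Up (fun q Uq => Ql a b Uq) (fun w => dQ w a b Up) (d_snd p).
have e0 : 'D_(0, l) (fun p => Q p p.2 a b) p = 0.
  apply: (etrans (open_eq_derive _ Uo Up (fun q Uq => Qy a b Uq))).
  exact: derive_cst.
rewrite -DQ//; apply/eqP; rewrite -addr_eq0; apply/eqP.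
apply/esym; apply: (etrans (esym e0)); apply: (etrans e).
by apply: congr2 => //; rewrite D_snd.
Qed.

Let N_sym34 p c a b l : U p -> N p c a b l = N p c a l b.
Proof.
move=> Up; rewrite /N.
rewrite (@open_eq_derive _ _ _ U (fun p => C p a b l) (fun p => C p a l b))//.
  rewrite (Csym (G p c a) b l Up) (Csym a (G p c b) l Up) (Csym a b (G p c l) Up).
  ring.
by move=> q Uq; exact: Csym.
Qed.

Let N_sym23 p c a b l : U p -> N p c a b l = N p c b a l.
Proof.
move=> Up; rewrite /N.
rewrite (@open_eq_derive _ _ _ U (fun p => C p a b l) (fun p => C p b a l))//.
  rewrite (Csym12 (G p c a) b l Up) (Csym12 a (G p c b) l Up) (Csym12 a b _ Up).
  ring.
by move=> q Uq; exact: Csym12.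
Qed.

(** Through [N_y] the first index of Q becomes the last index of C, where it can be permuted with
    the other two. *)
Let Q_sym12 p a b c : U p -> Q p a b c = Q p b a c.
Proof.
move=> Up; apply: oppr_inj; rewrite -!N_y//.
by rewrite N_sym34// N_sym23// N_sym34// N_sym23// N_sym34// N_sym23// N_sym34//.
Qed.

(** The symmetry of Q in its first two indices survives fibre differentiation. This is what allows
    the index of differentiation to change places with an index of C. *)
Let N_sym12 p a b c l : U p -> N p a b c l = N p b a c l.
Proof.
move=> Up; rewrite -!DQ//; apply: (open_eq_derive _ Uo Up) => q Uq.
exact: Q_sym12.
Qed.

(** The horizontal derivative of y is - Gamma(c) y, which accounts for the connection term of the
    last slot; what remains is the derivative of C(a, b, y) = 0. *)
Let N_last p c a b : U p -> N p c a b p.2 = 0.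
Proof.
move=> Up; rewrite /N !Cy//.
have e := @derive_app R _ _ _ U (fun p => C p a b) snd p (hor p c) rVc Uo Up
  (fun q Uq => Cl3 a b Uq) (fun w => Cd a b w Up) (d_snd p).
have e0 : 'D_(hor p c) (fun p => C p a b p.2) p = 0.
  apply: (etrans (open_eq_derive _ Uo Up (fun q Uq => Cy a b Uq))).
  exact: derive_cst.
rewrite !subr0; apply/esym; apply: (etrans (esym e0)); apply: (etrans e).
by apply: congr2 => //; rewrite D_snd (linear_funN _ (Cl3 a b Up)).
Qed.

Lemma horizontal_cartan_spray p a b c : U p -> N p p.2 a b c = 0.
Proof. by move=> Up; rewrite N_sym12// N_sym23// N_sym34// N_last. Qed.

Lemma horizontal_metric0 p a b c : U p -> Q p a b c = 0.
Proof.
by move=> Up; apply: oppr_inj; rewrite -N_y// horizontal_cartan_spray// oppr0.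
Qed.

End LocalArgument.

(** * The fundamental and Cartan tensors in a chart *)

Section Fibres.
Variables (R : realType) (n : nat).
Local Notation V := 'rV[R]_n.
Implicit Types (f g : V * V -> R) (q y b : V).

Lemma derive_fibre (G : normedModType R) (f : V * V -> G) q y b :
  'D_(0, b) f (q, y) = 'D_b (fun v => f (q, v)) y.
Proof.
rewrite /derive.
suff -> : (fun h : R => h^-1 *: ((f \o shift (q, y)) (h *: (0, b)) - f (q, y)))
    = (fun h : R => h^-1 *: (((fun v => f (q, v)) \o shift y) (h *: b) - f (q, y))).
  by [].
apply/funext => h; congr (_ *: (_ - _)); rewrite /=; congr f.
by congr pair; rewrite /= scaler0 add0r.
Qed.

Lemma derive_precomp_linear (f : V -> R) (L : V -> V) y b : linear L ->
  'D_b (f \o L) y = 'D_(L b) f (L y).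
Proof.
move=> Ll; rewrite /derive.
suff -> : (fun h : R => h^-1 *: (((f \o L) \o shift y) (h *: b) - (f \o L) y))
    = (fun h : R => h^-1 *: ((f \o shift (L y)) (h *: L b) - f (L y))).
  by [].
by apply/funext => h; rewrite /= Ll.
Qed.

(** True already for difference quotients, hence without any differentiability, so the lemma can be
    iterated to reach second and third fibre derivatives. *)
Lemma derive_fibre_linear f g q q' (L : V -> V) : linear L ->
  (forall y, f (q, y) = g (q', L y)) ->
  forall b y, 'D_(0, b) f (q, y) = 'D_(0, L b) g (q', L y).
Proof.
move=> Ll fg b y; rewrite !derive_fibre -(derive_precomp_linear _ _ _ Ll).
by congr ('D_b _ y); apply/funext => v; rewrite fg.
Qed.

(** Euler's relation: along the ray through y the function is (1 + s)^k f(q, y), and its derivative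
    at s = 0 is k f(q, y). *)
Lemma derive_fibre_homogeneous f q y (k : nat) : differentiable f (q, y) ->
  (forall t : R, 0 < t -> f (q, t *: y) = t ^+ k * f (q, y)) ->
  'D_(0, y) f (q, y) = k%:R * f (q, y).
Proof.
move=> fd fh.
have fd0 : differentiable f ((q, y) + (0 : R) *: (0, y)) by rewrite scale0r addr0.
have [_ e] := is_derive_line fd0; rewrite scale0r addr0 in e.
rewrite -e; have -> : 'D_1 (fun s : R => f ((q, y) + s *: (0, y))) 0
    = 'D_1 (fun s : R => f (q, y) *: (1 + s) ^+ k) 0.
  apply: near_eq_derive.
  (* Homogeneity is available for positive factors only, so 1 + s has to be positive. *)
  have : \forall s \near (0 : R), -1 < s by apply: lt_nbhsr; rewrite ltrN10.
  apply: filterS => s s1.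
  have -> : (q, y) + s *: (0, y) = (q, (1 + s) *: y).
    by congr pair; rewrite /= ?scaler0 ?addr0// scalerDl scale1r.
  by rewrite fh; [exact: mulrC|lra].
have i : is_derive (0 : R) (1 : R) (fun s : R => (1 + s) ^+ k) k%:R.
  elim: k {fh e} => [|k IH]; first exact: is_derive_cst.
  have i1 := is_deriveD (is_derive_cst (1 : R) (0 : R) (1 : R))
    (is_derive_id (0 : R) (1 : R)).
  rewrite add0r in i1; have := is_deriveM i1 IH.
  rewrite (_ : (cst (1 : R) + id) * (fun s : R => (1 + s) ^+ k)
    = fun s : R => (1 + s) ^+ k.+1); last first.
    by apply/funext => s; rewrite exprS.
  move=> H; apply: (is_derive_eq H).
  have scaleRE (r s : R) : r *: s = r * s by [].
  rewrite -[(cst 1 + id) 0]/(1 + 0 : R) addr0 expr1n !scaleRE mul1r mulr1.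
  by rewrite natr1.
have [_ ->] := is_deriveZ (f (q, y)) i.
exact: mulrC.
Qed.

End Fibres.

(** * The tensors g and C: symmetry, change of chart, homogeneity, dependence on the fibre *)

Section Metric.
Variables (R : realType) (n : nat) (M : manifold R n).
Local Notation V := 'rV[R]_n.
Local Notation TM := (tangent_bundle M).
Variable F : TM -> R.
Hypothesis hF : is_finsler F.
Implicit Types (i j : midx M) (x : M) (z : TM) (p : V * V) (a b c y q : V).
Local Notation U i := (tloc i (@TM0 R n M)).

Lemma U_open i : open (U i).
Proof. exact: (@open_TM0T _ _ M).2. Qed.

Lemma F_smooth i : smooth_on (U i) (F \o tpsi i).
Proof. by case: hF => _ + _ _; apply. Qed.

Lemma Fsq_smooth i : smooth_on (U i) (Fsq F i).
Proof.
apply: (@smooth_on_ext _ _ _ _ (fun p => (F \o tpsi i) p *: (F \o tpsi i) p)).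
- exact: U_open.
- by move=> p _; rewrite /Fsq expr2.
- by apply: smooth_on_scale; [exact: U_open|exact: F_smooth|exact: F_smooth].
Qed.

(* [fund i p a b] is g(a, b) in the chart [i], and [dfund i p a b c] is
   2 A(a, b, c) / F. *)
Definition fund i p a b : R :=
  2^-1 * 'D_((0, b) : V * V) ('D_((0, a) : V * V) (Fsq F i)) p.

Definition dfund i p a b c : R := 'D_((0, c) : V * V) (fun p => fund i p a b) p.

Let addv (s : R) (u v : V) : (0, s *: u + v) = s *: (0, u) + (0, v) :> V * V.
Proof. by congr pair; rewrite /= scaler0 addr0. Qed.

Lemma fund_smooth i a b : smooth_on (U i) (fun p => fund i p a b).
Proof.
apply: (@smooth_on_scale _ _ R); first exact: U_open.
  by apply: smooth_on_cst; exact: U_open.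
exact/smooth_on_derive/smooth_on_derive/Fsq_smooth.
Qed.

Lemma dfund_smooth i a b c : smooth_on (U i) (fun p => dfund i p a b c).
Proof. exact/smooth_on_derive/fund_smooth. Qed.

Lemma fund_differentiable i a b p : U i p -> differentiable (fun p => fund i p a b) p.
Proof. exact/smooth_on_differentiable/fund_smooth. Qed.

Lemma dfund_differentiable i a b c p : U i p ->
  differentiable (fun p => dfund i p a b c) p.
Proof. exact/smooth_on_differentiable/dfund_smooth. Qed.

Let dE i a p : U i p -> differentiable ('D_((0, a) : V * V) (Fsq F i)) p.
Proof. exact/smooth_on_differentiable/smooth_on_derive/Fsq_smooth. Qed.

Lemma fund_sym i p a b : U i p -> fund i p a b = fund i p b a.
Proof.
move=> ip; exact: (congr1 (fun r : R => 2^-1 * r) (derive_swap (0, a) (0, b)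
  (@has_coordinates_regular R) (@U_open i) ip (@Fsq_smooth i))).
Qed.

Lemma fund_linearr i p a : U i p -> linear (fund i p a).
Proof.
move=> ip s u v; rewrite /fund addv derive_linear; last exact: dE.
have sE (x y : R) : x *: y = x * y by [].
by rewrite !sE mulrDr mulrCA.
Qed.

Lemma fund_linearl i p b : U i p -> linear (fun a => fund i p a b).
Proof. by move=> ip s u v; rewrite ![fund i p _ b]fund_sym// fund_linearr. Qed.

Lemma dfund_sym12 i p a b c : U i p -> dfund i p a b c = dfund i p b a c.
Proof.
by move=> ip; apply: (open_eq_derive _ (@U_open i) ip) => q iq; exact: fund_sym.
Qed.

Lemma dfundE i p a b c : U i p -> dfund i p a b c =
  2^-1 * 'D_((0, c) : V * V) ('D_((0, b) : V * V) ('D_((0, a) : V * V) (Fsq F i))) p.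
Proof.
move=> ip; have d : derivable ('D_((0, b) : V * V) ('D_((0, a) : V * V) (Fsq F i))) p (0, c).
  apply: diff_derivable; apply: (@smooth_on_differentiable _ _ _ (U i)) => //.
  exact/smooth_on_derive/smooth_on_derive/Fsq_smooth.
exact: (deriveZ (2^-1 : R) d).
Qed.

Lemma dfund_sym23 i p a b c : U i p -> dfund i p a b c = dfund i p a c b.
Proof.
move=> ip; apply: (etrans (dfundE a b c ip)).
apply: (etrans _ (esym (dfundE a c b ip))).
exact: (congr1 (fun r : R => 2^-1 * r) (derive_swap (0, b) (0, c)
  (@has_coordinates_regular R) (@U_open i) ip
  (smooth_on_derive (0, a) (@Fsq_smooth i)))).
Qed.

Lemma dfund_linear3 i p a b : U i p -> linear (dfund i p a b).
Proof.
move=> ip s u v; rewrite /dfund addv derive_linear//.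
exact: fund_differentiable.
Qed.

Lemma dfund_linear2 i p a c : U i p -> linear (fun b => dfund i p a b c).
Proof. by move=> ip s u v; rewrite ![dfund i p a _ c]dfund_sym23// dfund_linear3. Qed.

Lemma dfund_linear1 i p b c : U i p -> linear (fun a => dfund i p a b c).
Proof. by move=> ip s u v; rewrite ![dfund i p _ b c]dfund_sym12// dfund_linear2. Qed.

Lemma g_compE i p (k l : 'I_n) : g_comp F i p k l = fund i p (evec _ k) (evec _ l).
Proof. by rewrite mxE. Qed.

Lemma A_compE i p (k l h : 'I_n) : U i p ->
  A_comp F i p k l h
  = 2^-1 * F (tpsi i p) * dfund i p (evec _ k) (evec _ l) (evec _ h).
Proof. by move=> ip; rewrite dfundE// /A_comp /dy; field. Qed.

Lemma fund_coord i p a b : U i p ->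
  fund i p a b = (a *m g_comp F i p *m b^T) 0 0.
Proof.
move=> ip; rewrite {1}[a]row_sum_delta (linear_combination _ _ (fund_linearl b ip)).
rewrite {1}[b]row_sum_delta mxE.
under eq_bigr do rewrite (linear_combination _ _ (fund_linearr _ ip)) scaler_sumr.
rewrite exchange_big /=; apply: eq_bigr => l _.
rewrite !mxE mulr_suml; apply: eq_bigr => k _.
rewrite g_compE -[_ *: _]/(_ * _) -[X in _ * X]/(_ * _) /evec.
by rewrite mulrA mulrAC.
Qed.

Lemma dfund_coord i p a b c : U i p -> 2^-1 * F (tpsi i p) * dfund i p a b c =
  \sum_(k < n) \sum_(l < n) \sum_(h < n)
    A_comp F i p k l h * a 0 k * b 0 l * c 0 h.
Proof.
move=> ip; rewrite {1}[a]row_sum_delta (linear_combination _ _ (dfund_linear1 b c ip)).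
rewrite mulr_sumr; apply: eq_bigr => k _.
rewrite {1}[b]row_sum_delta (linear_combination _ _ (dfund_linear2 _ c ip)).
rewrite scaler_sumr mulr_sumr; apply: eq_bigr => l _.
rewrite {1}[c]row_sum_delta (linear_combination _ _ (dfund_linear3 _ _ ip)).
rewrite !scaler_sumr mulr_sumr; apply: eq_bigr => h _.
rewrite A_compE// /evec -![_ *: _]/(_ * _).
by move: (dfund i p _ _ _) (F _) => x1 x2; ring.
Qed.

Lemma Fsq_trans i j q y : overlap i j q ->
  Fsq F i (q, y) = Fsq F j (tau i j q, tcoord i j (mpsi i q) y).
Proof.
move=> oq; have op : toverlap i j (q, y) by [].
have e := transE op; rewrite /= -tcoordE// in e; rewrite -e /Fsq /trans /=.
by rewrite tphiK//; case: oq.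
Qed.

Lemma fund_trans i j q y a b : overlap i j q ->
  fund i (q, y) a b = fund j (tau i j q, tcoord i j (mpsi i q) y)
    (tcoord i j (mpsi i q) a) (tcoord i j (mpsi i q) b).
Proof.
move=> oq; apply: (congr1 (fun r : R => 2^-1 * r)).
have tl := @tcoord_linear _ _ _ i j (mpsi i q).
apply: (derive_fibre_linear tl) => y'.
by apply: (derive_fibre_linear tl) => y''; exact: Fsq_trans.
Qed.

Lemma dfund_trans i j q y a b c : overlap i j q ->
  dfund i (q, y) a b c = dfund j (tau i j q, tcoord i j (mpsi i q) y)
    (tcoord i j (mpsi i q) a) (tcoord i j (mpsi i q) b) (tcoord i j (mpsi i q) c).
Proof.
move=> oq; have tl := @tcoord_linear _ _ _ i j (mpsi i q).
by apply: (derive_fibre_linear tl) => y'; exact: fund_trans.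
Qed.

Lemma tphi_trans i p : (mphi i @` mdom i) p.1 ->
  let z := tpsi i p in
  overlap i (mat z.1) p.1 /\
  tphi (mat z.1) z = (tau i (mat z.1) p.1, tcoord i (mat z.1) (mpsi i p.1) p.2).
Proof.
move=> ip z; have mz : mdom (mat z.1) z.1 by exact: mat_dom.
have o : overlap i (mat z.1) p.1 by split.
split=> //; rewrite -(trans_tphi _ (mpsi_dom ip : mdom i z.1)) tpsiK// transE//.
by rewrite -tcoordE.
Qed.

Lemma U_mat z : TM0 z -> U (mat z.1) (tphi (mat z.1) z).
Proof. by move=> z0; apply: tlocP => //; exact: mat_dom. Qed.

Lemma metric_chart i (X Y : section M) p : U i p ->
  metric F X Y (tpsi i p) = fund i p (srep i X p) (srep i Y p).
Proof.
move=> ip; have [iq z0] := ip; set z := tpsi i p.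
have [ov pE] := tphi_trans iq.
rewrite /metric -fund_coord; last exact: U_mat.
rewrite [p in RHS]surjective_pairing (fund_trans _ _ _ ov) -/z pE.
by rewrite /srep !tcoordK//; try exact: mat_dom; exact: mpsi_dom.
Qed.

Lemma cartan_chart i (X Y Z : section M) p : U i p ->
  cartan F X Y Z (tpsi i p)
  = 2^-1 * F (tpsi i p) * dfund i p (srep i X p) (srep i Y p) (srep i Z p).
Proof.
move=> ip; have [iq z0] := ip; set z := tpsi i p.
have [ov pE] := tphi_trans iq.
rewrite /cartan -dfund_coord; last exact: U_mat.
rewrite tphiK; last exact: mat_dom.
rewrite [p in dfund i p]surjective_pairing (dfund_trans _ _ _ _ ov) -/z pE.
by rewrite /srep !tcoordK//; try exact: mat_dom; exact: mpsi_dom.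
Qed.

Lemma Fsq_homogeneous i q y (t : R) : 0 < t ->
  Fsq F i (q, t *: y) = t ^+ 2 * Fsq F i (q, y).
Proof.
by move=> t0; case: hF => _ _ Fh _; rewrite /Fsq /tpsi /= tcoordZ Fh// exprMn.
Qed.

Lemma U_scale i q y (t : R) : 0 < t -> U i (q, y) -> U i (q, t *: y).
Proof.
move=> t0 [iq y0]; have iq' : (mphi i @` mdom i) (q, t *: y).1 by [].
split=> //; apply/(tpsi_neq0 iq') => /=.
rewrite scaler_eq0 gt_eqF//=; exact/(tpsi_neq0 (iq : (mphi i @` mdom i) (q, y).1)).
Qed.

Let derive_homogeneous i f q y a (t s : R) : 0 < t -> U i (q, y) ->
  (forall p, U i p -> differentiable f p) ->
  (forall y, f (q, t *: y) = s * f (q, y)) ->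
  t * 'D_((0, a) : V * V) f (q, t *: y) = s * 'D_((0, a) : V * V) f (q, y).
Proof.
move=> t0 iqy fd fh; have iqty := U_scale t0 iqy.
have tl : linear (fun v : V => t *: v).
  by move=> r u v; rewrite scalerDr !scalerA mulrC.
transitivity ('D_((0, a) : V * V) (fun p => f (p.1, t *: p.2)) (q, y)).
  rewrite (@derive_fibre_linear _ _ (fun p => f (p.1, t *: p.2)) f q q _ tl)//.
  have -> : (0, t *: a) = t *: (0, a) :> V * V by congr pair; rewrite /= scaler0.
  by rewrite derive_scalev//; exact: fd.
have d : derivable f (q, y) (0, a) by exact/diff_derivable/fd.
apply: (etrans _ (deriveZ s d)); rewrite !derive_fibre.
by congr ('D_a _ y); apply/funext => v; rewrite /= fh.
Qed.

Let Fsq1_homogeneous i q y a (t : R) : 0 < t -> U i (q, y) ->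
  'D_((0, a) : V * V) (Fsq F i) (q, t *: y)
  = t * 'D_((0, a) : V * V) (Fsq F i) (q, y).
Proof.
move=> t0 iqy; have t00 : t != 0 by rewrite gt_eqF.
apply: (mulfI t00); rewrite mulrA -expr2.
apply: (@derive_homogeneous i) => //; last by move=> y'; exact: Fsq_homogeneous.
by move=> p ip; exact: (smooth_on_differentiable (@Fsq_smooth i)).
Qed.

Lemma U_fibre i q y y' : U i (q, y) -> y' != 0 -> U i (q, y').
Proof.
move=> [iq _] y0; have iq' : (mphi i @` mdom i) (q, y').1 by [].
by split=> //; apply/(tpsi_neq0 iq').
Qed.

Lemma U_neq0 i p : U i p -> p.2 != 0.
Proof. by move=> [iq p0]; apply/(tpsi_neq0 iq). Qed.

Lemma fund_homogeneous i q y a b (t : R) : 0 < t -> U i (q, y) ->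
  fund i (q, t *: y) a b = fund i (q, y) a b.
Proof.
move=> t0 iqy; apply: (congr1 (fun r : R => 2^-1 * r)); have t00 : t != 0 by rewrite gt_eqF.
have iqty := U_scale t0 iqy.
have y0 := U_neq0 iqy.
have d1 := dE a iqty; have d2 := dE a iqy.
(* F^2 is homogeneous on the whole fibre, but its first fibre derivative is known to be so only off
   the zero vector; the two sides of the next differentiation agree only near [y]. *)
have n0 : \forall v \near y, v != 0.
  by apply: (near_open (@neq0_open R n)).
apply: (mulfI t00).
have eL : t * 'D_((0, b) : V * V) ('D_((0, a) : V * V) (Fsq F i)) (q, t *: y)
    = 'D_((0, t *: b) : V * V) ('D_((0, a) : V * V) (Fsq F i)) (q, t *: y).
  have -> : (0, t *: b) = t *: (0, b) :> V * V by congr pair; rewrite /= scaler0.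
  by rewrite derive_scalev.
apply: (etrans eL) => {eL}.
have tl : linear (fun v : V => t *: v).
  by move=> r u v; rewrite scalerDr !scalerA mulrC.
apply: (etrans (esym (@derive_fibre_linear _ _
  (fun p => 'D_((0, a) : V * V) (Fsq F i) (p.1, t *: p.2)) _ q q _ tl
  (fun _ => erefl) b y))).
have d2' : derivable ('D_((0, a) : V * V) (Fsq F i)) (q, y) (0, b).
  exact: diff_derivable.
apply: (etrans _ (deriveZ t d2')); rewrite !derive_fibre.
apply: near_eq_derive; apply: filterS n0 => v v0 /=.
exact: Fsq1_homogeneous t0 (U_fibre iqy v0).
Qed.

(** Euler's relation in degree 0. *)
Lemma dfund_y i p a b : U i p -> dfund i p a b p.2 = 0.
Proof.
case: p => q y ip; rewrite /dfund (@derive_fibre_homogeneous _ _ _ q y 0).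
- by rewrite mul0r.
- exact: fund_differentiable.
- by move=> t t0; rewrite fund_homogeneous// mul1r.
Qed.

(** Euler's relation twice, in degrees 1 and 2; the resulting factor 2 cancels the 1/2 in g. *)
Lemma fund_yy i p : U i p -> fund i p p.2 p.2 = Fsq F i p.
Proof.
case: p => q y ip /=; rewrite /fund (@derive_fibre_homogeneous _ _ _ q y 1).
- rewrite mul1r (@derive_fibre_homogeneous _ _ _ q y 2); first by field.
    exact: (smooth_on_differentiable (@Fsq_smooth i)).
  by move=> t t0; exact: Fsq_homogeneous.
- exact: dE.
- by move=> t t0; rewrite expr1; exact: Fsq1_homogeneous.
Qed.

Lemma fund_pos i p a : U i p -> a != 0 -> 0 < fund i p a a.
Proof. by move=> ip a0; rewrite fund_coord//; case: hF => _ _ _; apply. Qed.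

(** F is only assumed nonnegative; that it has no zero on TM_0 comes from F^2 = g(y, y) and positive
    definiteness. *)
Lemma F_neq0 z : TM0 z -> F z != 0.
Proof.
move=> z0; have ip := U_mat z0; have := fund_pos ip (U_neq0 ip).
rewrite fund_yy// /Fsq tphiK; last exact: mat_dom.
by move=> h; apply: contraTN h => /eqP ->; rewrite expr0n ltxx.
Qed.

Lemma metric_taut z : TM0 z -> metric F (@taut R n M) (@taut R n M) z = F z ^+ 2.
Proof.
move=> z0; have ip := U_mat z0; have zE := tphiK (mat_dom z.1 : mdom (mat z.1) z.1).
rewrite -[in LHS]zE metric_chart// srep_taut; last by case: ip.
by rewrite fund_yy// /Fsq zE.
Qed.

Lemma finv_smooth : fsmooth (@TM0 R n M) (fun z => (F z)^-1).
Proof.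
move=> i; apply: (@smooth_on_inv _ _ _ (F \o tpsi i)).
- exact: U_open.
- by move=> p [_ p0]; exact: F_neq0.
- exact: F_smooth.
Qed.

Lemma ell_smooth : ssmooth (@TM0 R n M) (ell F).
Proof.
apply: ssmoothZ; [exact: open_TM0T|exact: finv_smooth|exact: taut_smooth].
Qed.

Lemma srep_ell i p : (mphi i @` mdom i) p.1 ->
  srep i (ell F) p = (F (tpsi i p))^-1 *: p.2.
Proof.
by move=> ip; rewrite -[p.2](srep_taut ip) -(srepZ i (fun z => (F z)^-1)).
Qed.

Lemma dfund0_cartan (X Y Z : section M) z :
  (forall i p a b c, U i p -> dfund i p a b c = 0) -> TM0 z ->
  cartan F X Y Z z = 0.
Proof.
move=> C0 z0; rewrite -(tphiK (mat_dom z.1 : mdom (mat z.1) z.1)).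
by rewrite cartan_chart; [rewrite C0 ?mulr0//; exact: U_mat|exact: U_mat].
Qed.

Lemma riemannian_dfund : is_riemannian F ->
  forall i p a b c, U i p -> dfund i p a b c = 0.
Proof.
move=> Friem i p a b c ip.
have H p' : U i p' -> fund i p' a b = fund i (p'.1, p.2) a b.
  case: p' => q y iqy; have iqp := U_fibre iqy (U_neq0 ip).
  rewrite (fund_coord a b iqy) (fund_coord a b iqp).
  by rewrite (Friem i q y p.2 _ (U_neq0 iqy) (U_neq0 ip))//; case: iqy.
apply: (etrans (@derive_fst _ _ _ _ _ (fun p => fund i p a b)
  (fun q => fund i (q, p.2) a b) p (0, c) (@U_open i) ip H)).
exact: derive0.
Qed.

(** The mean value theorem along a segment of the fibre; the segment has to avoid 0, where nothing
    is known about g. *)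
Lemma fund_segment i q y v a b :
  (forall i p a b c, U i p -> dfund i p a b c = 0) -> (mphi i @` mdom i) q ->
  (forall t : R, 0 <= t <= 1 -> y + t *: (v - y) != 0) ->
  fund i (q, v) a b = fund i (q, y) a b.
Proof.
move=> C0 iq seg.
have Up (t : R) : 0 <= t <= 1 -> U i ((q, y) + t *: (0, v - y)).
  move=> /seg t0; have -> : (q, y) + t *: (0, v - y) = (q, y + t *: (v - y)).
    by congr pair; rewrite /= scaler0 addr0.
  have iq' : (mphi i @` mdom i) (q, y + t *: (v - y)).1 by [].
  by split=> //; apply/(tpsi_neq0 iq').
have H (t : R) : 0 <= t <= 1 ->
    is_derive t 1 (fun s : R => fund i ((q, y) + s *: (0, v - y)) a b) 0.
  move=> t01; have d := fund_differentiable a b (Up _ t01).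
  have [dd e] := is_derive_line d; apply: DeriveDef; first exact: dd.
  exact: (etrans e (C0 i _ a b (v - y) (Up _ t01))).
have [s _] := mean_value (df := fun=> 0) ltr01 H.
have e0 : (q, y) + (0 : R) *: (0, v - y) = (q, y) by rewrite scale0r addr0.
have e1 : (q, y) + (1 : R) *: (0, v - y) = (q, v).
  by rewrite scale1r; congr pair; rewrite /= ?addr0// addrC subrK.
by rewrite mul0r e0 e1 => /eqP; rewrite subr_eq0 => /eqP.
Qed.

(** The segment from y to e_l misses 0: its k-th coordinate is (1 - t) y_k, which vanishes only at t
    = 1, and there the point is e_l itself. *)
Lemma fund_delta i q y a b (k l : 'I_n) :
  (forall i p a b c, U i p -> dfund i p a b c = 0) -> (mphi i @` mdom i) q ->
  y 0 k != 0 -> l != k -> fund i (q, delta_mx 0 l) a b = fund i (q, y) a b.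
Proof.
move=> C0 iq yk lk; apply: fund_segment => // t _; apply/eqP => /rowP e.
have := e k; rewrite !mxE eqxx [k == l]eq_sym (negbTE lk) /= sub0r mulrN.
have -> : y 0 k - t * y 0 k = (1 - t) * y 0 k by rewrite mulrBl mul1r.
move/eqP; rewrite mulf_eq0 (negbTE yk) orbF subr_eq0 => /eqP t1.
have := e l; rewrite !mxE !eqxx /= -t1 mul1r addrC subrK => /eqP.
by rewrite oner_eq0.
Qed.

(** Two nonzero vectors are joined by the broken line y, e_l, e_l', y', where e_l and e_l' are basis
    vectors that differ from a direction in which y, respectively y', has a nonzero coordinate. *)
Lemma dfund0_riemannian : n != 1%N ->
  (forall i p a b c, U i p -> dfund i p a b c = 0) -> is_riemannian F.
Proof.
move=> n1 C0 i q y y' iq y0 y0'.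
have coordP (v : V) : v != 0 -> exists k, v 0 k != 0.
  move=> v0; apply: contrapT => vk; move/eqP: v0; apply; apply/rowP => k.
  by rewrite mxE; apply: contrapT => /eqP vk0; apply: vk; exists k.
have other (k : 'I_n) : exists l : 'I_n, l != k.
  (* The index [k] itself excludes n = 0, so n <> 1 leaves a second index. *)
  have n0 : (0 < n)%N by exact: leq_ltn_trans (leq0n k) (ltn_ord k).
  have n2 : (1 < n)%N by rewrite ltn_neqAle eq_sym n1.
  pose l1 := Ordinal n2; pose l0 := Ordinal (ltnW n2).
  have [kl|kl] := eqVneq k l0; last by exists l0; rewrite eq_sym.
  by exists l1; rewrite kl.
have [k yk] := coordP _ y0; have [k' yk'] := coordP _ y0'.
have [l lk] := other k; have [l' lk'] := other k'.
apply/matrixP => r s; rewrite !g_compE.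
rewrite -(fund_delta _ _ C0 iq yk lk) -(fund_delta _ _ C0 iq yk' lk').
have [-> //|ll'] := eqVneq l l'.
apply/esym; apply: fund_delta C0 iq _ _; last by rewrite eq_sym; exact: ll'.
by rewrite mxE !eqxx oner_eq0.
Qed.

End Metric.

(** * Derivatives of the Cartan tensor along the spray *)

Section CartanDerivatives.
Variables (R : realType) (n : nat) (M : manifold R n).
Local Notation V := 'rV[R]_n.
Local Notation TM := (tangent_bundle M).
Variables (F : TM -> R) (D : connection_data M).
Hypothesis hF : is_finsler F.
Hypothesis Dconn : is_connection D.
Hypothesis Dtors : forall (W : set TM) (X Y : vfield M), open_TM0 W ->
  vsmooth W X -> vsmooth W Y -> forall z, W z ->
  cov D X (rho Y) z - cov D Y (rho X) z = rho (bracket X Y) z.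
Implicit Types (i j : midx M) (z : TM) (p : V * V) (a b c y : V).
Local Notation U i := (tloc i (@TM0 R n M)).
Local Notation Gam i p a b := (Gamma D i p a b).

Lemma vderiv_eq (W : set TM) (f g : TM -> R) z xi : open_TM0 W -> W z ->
  (forall w, W w -> f w = g w) -> vderiv z xi f = vderiv z xi g.
Proof.
move=> Wo Wz fg; apply: (open_eq_derive _ (Wo.2 (mat z.1))).
  by apply: tlocP => //; exact: mat_dom.
by move=> p [_ Wp]; exact: fg.
Qed.

Lemma vderiv0 (W : set TM) (f : TM -> R) z xi : open_TM0 W -> W z ->
  (forall w, W w -> f w = 0) -> vderiv z xi f = 0.
Proof.
move=> Wo Wz f0; apply: (etrans (vderiv_eq xi Wo Wz f0)).
exact: derive_cst.
Qed.

(* Such sections are stable under [cov D (ellbar F D)], and make every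
   derivative of the Cartan tensor vanish. *)
Definition null_or_taut (W : set TM) (X : section M) :=
  (forall z, W z -> X z = 0) \/ (forall z, W z -> X z = taut z).

(** The tautological section is sent to mu(ellbar) = 0 and the zero section to 0. Locality of the
    connection applies because [X] is known on an open set. *)
Lemma null_or_taut_cov (W : set TM) (X : section M) : open_TM0 W ->
  null_or_taut W X -> null_or_taut W (cov D (ellbar F D) X).
Proof.
move=> Wo [X0|Xt]; left => z Wz; have z0 : TM0 z by exact: Wo.1.
  rewrite /cov -(connection_local Dconn (Y := fun=> 0) _ Wo Wz (ssmooth_cst0 Wo)).
    exact: connection0.
  by move=> w /X0.
rewrite /cov -(connection_local Dconn (Y := @taut R n M) _ Wo Wz).
- exact: (mu_hlift Dconn Dtors).
- by apply: ssmooth_sub (@taut_smooth R n M); exact: Wo.1.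
- by move=> w /Xt.
Qed.

(** The base case is C(., ., y) = 0. In the inductive step the scalar term differentiates a function
    that vanishes on [W], and in each other term the special slot is either untouched or replaced by
    its covariant derivative, which is again special. *)
Lemma cartan_deriv_null (j : nat) (W : set TM) (X Y Z : section M) :
  open_TM0 W -> null_or_taut W X \/ null_or_taut W Y \/ null_or_taut W Z ->
  forall z, W z -> cartan_deriv F D j X Y Z z = 0.
Proof.
move=> Wo; elim: j X Y Z => [|j IH] X Y Z K z Wz /=.
  have z0 : TM0 z by exact: Wo.1.
  have ip := U_mat z0; have iz := mat_dom z.1.
  have zE : tpsi (mat z.1) (tphi (mat z.1) z) = z by exact: tphiK.
  rewrite -zE cartan_chart//; set i := mat z.1; set p := tphi i z.
  have srep_null (T : section M) : null_or_taut W T ->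
      srep i T p = 0 \/ srep i T p = p.2.
    move=> [T0|Tt]; [left|right]; first by rewrite /srep zE T0// tcoord0.
    by rewrite -(@srep_taut _ _ _ i p); [rewrite /srep zE Tt|case: ip].
  have C3 a b T : null_or_taut W T -> dfund F i p a b (srep i T p) = 0.
    move=> /srep_null [->|->]; last exact: dfund_y.
    exact: linear_fun0 (dfund_linear3 hF a b ip).
  have -> : dfund F i p (srep i X p) (srep i Y p) (srep i Z p) = 0.
    case: K => [KX|[KY|KZ]]; last exact: C3.
      by rewrite dfund_sym12// dfund_sym23//; exact: C3.
    by rewrite dfund_sym23//; exact: C3.
  by rewrite mulr0.
rewrite (vderiv0 _ Wo Wz (IH X Y Z K)).
have Kc := null_or_taut_cov Wo.
rewrite !IH ?subr0//; case: K => [KX|[KY|KZ]]; by [left|right; left|right; right|left; exact: Kc|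
  right; left; exact: Kc|right; right; exact: Kc].
Qed.

Lemma cartan_deriv0 (j : nat) :
  (forall i p a b c, U i p -> dfund F i p a b c = 0) ->
  forall (X Y Z : section M) z, TM0 z -> cartan_deriv F D j X Y Z z = 0.
Proof.
move=> C0; elim: j => [|j IH] X Y Z z z0 /=; first exact: dfund0_cartan.
by rewrite (vderiv0 _ (@open_TM0T _ _ M) z0 (IH X Y Z)) !IH// !subr0.
Qed.

Lemma ellbar_smooth : vsmooth (@TM0 R n M) (ellbar F D).
Proof.
exact: (hlift_smooth Dconn Dtors (@open_TM0T _ _ M) (ell_smooth hF)).
Qed.

Lemma vrep_ellbar i p : U i p -> vrep i (ellbar F D) p =
  (F (tpsi i p))^-1 *: (p.2, - Gam i p p.2 p.2).
Proof.
move=> ip; rewrite (vrep_hlift Dconn Dtors (ell F) ip) srep_ell; last by case: ip.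
rewrite (linear_funZ _ _ (Gamma_linearl Dconn p.2 ip)).
by congr pair; rewrite /= ?scalerN.
Qed.

(** The hypothesis ranges over all sections smooth on an open set because each step replaces an
    argument by its covariant derivative along [ellbar], a new section that is again smooth on
    [W]. *)
Lemma cartan_deriv_higher0 :
  (forall (W : set TM) (X Y Z : section M), open_TM0 W ->
    ssmooth W X -> ssmooth W Y -> ssmooth W Z ->
    forall z, W z -> cartan_deriv F D 1 X Y Z z = 0) ->
  forall (j : nat) (W : set TM) (X Y Z : section M), open_TM0 W ->
    ssmooth W X -> ssmooth W Y -> ssmooth W Z ->
    forall z, W z -> cartan_deriv F D j.+1 X Y Z z = 0.
Proof.
move=> A1; elim=> [|j IH] W X Y Z Wo Xs Ys Zs z Wz; first exact: (A1 W).
have ls : vsmooth W (ellbar F D).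
  by apply: vsmooth_sub ellbar_smooth; exact: Wo.1.
have cs T : ssmooth W T -> ssmooth W (cov D (ellbar F D) T).
  by move=> Ts; exact: (cov_smooth Dconn).
rewrite -[LHS]/(vderiv z (ellbar F D z) (cartan_deriv F D j.+1 X Y Z)
  - cartan_deriv F D j.+1 (cov D (ellbar F D) X) Y Z z
  - cartan_deriv F D j.+1 X (cov D (ellbar F D) Y) Z z
  - cartan_deriv F D j.+1 X Y (cov D (ellbar F D) Z) z).
rewrite (vderiv0 _ Wo Wz (IH W X Y Z Wo Xs Ys Zs)).
rewrite (IH W _ Y Z Wo (cs _ Xs) Ys Zs z Wz) (IH W X _ Z Wo Xs (cs _ Ys) Zs z Wz).
by rewrite (IH W X Y _ Wo Xs Ys (cs _ Zs) z Wz) !subr0.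
Qed.

Lemma derive_dfund i (W : set TM) (X Y Z : section M) p xi : open_TM0 W ->
  ssmooth W X -> ssmooth W Y -> ssmooth W Z -> tloc i W p ->
  let f q := dfund F i q (srep i X q) (srep i Y q) (srep i Z q) in
  differentiable f p /\
  'D_xi f p = 'D_xi (fun q => dfund F i q (srep i X p) (srep i Y p) (srep i Z p)) p
    + dfund F i p ('D_xi (srep i X) p) (srep i Y p) (srep i Z p)
    + dfund F i p (srep i X p) ('D_xi (srep i Y) p) (srep i Z p)
    + dfund F i p (srep i X p) (srep i Y p) ('D_xi (srep i Z) p).
Proof.
move=> Wo Xs Ys Zs ip.
have iWo : open (tloc i W) by exact: Wo.2.
have iU q : tloc i W q -> U i q by apply: tloc_sub; exact: Wo.1.
have Xd := smooth_on_differentiable (Xs i) ip.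
have Yd := smooth_on_differentiable (Ys i) ip.
have Zd := smooth_on_differentiable (Zs i) ip.
have rVc := @has_coordinates_rV R n.
have d0 a b c := dfund_differentiable hF a b c (iU p ip).
have l1 b c q (iq : tloc i W q) := dfund_linear1 hF b c (iU q iq).
have l2 a c q (iq : tloc i W q) := dfund_linear2 hF a c (iU q iq).
have l3 a b q (iq : tloc i W q) := dfund_linear3 hF a b (iU q iq).
pose f1 b c q := dfund F i q (srep i X q) b c.
have d1 b c : differentiable (f1 b c) p.
  exact: (@differentiable_app _ _ _ _ _ (fun q a => dfund F i q a b c) _ _ rVc
    iWo ip (l1 b c) (fun a => d0 a b c) Xd).
have e1 b c : 'D_xi (f1 b c) p = 'D_xi (fun q => dfund F i q (srep i X p) b c) p
    + dfund F i p ('D_xi (srep i X) p) b c.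
  exact: (@derive_app _ _ _ _ _ (fun q a => dfund F i q a b c) _ _ xi rVc
    iWo ip (l1 b c) (fun a => d0 a b c) Xd).
pose f2 c q := dfund F i q (srep i X q) (srep i Y q) c.
have d2 c : differentiable (f2 c) p.
  exact: (@differentiable_app _ _ _ _ _ (fun q b => f1 b c q) _ _ rVc
    iWo ip (fun q iq => l2 _ c q iq) (fun b => d1 b c) Yd).
have e2 c : 'D_xi (f2 c) p = 'D_xi (f1 (srep i Y p) c) p
    + dfund F i p (srep i X p) ('D_xi (srep i Y) p) c.
  exact: (@derive_app _ _ _ _ _ (fun q b => f1 b c q) _ _ xi rVc
    iWo ip (fun q iq => l2 _ c q iq) (fun b => d1 b c) Yd).
split.
  exact: (@differentiable_app _ _ _ _ _ (fun q c => f2 c q) _ _ rVc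
    iWo ip (fun q iq => l3 _ _ q iq) d2 Zd).
apply: (etrans (@derive_app _ _ _ _ _ (fun q c => f2 c q) _ _ xi rVc
  iWo ip (fun q iq => l3 _ _ q iq) d2 Zd)).
by apply: congr2 => //; apply: (etrans (e2 _)); apply: congr2 => //; exact: e1.
Qed.

(** In A = F C / 2 the factor F is constant along the spray by the last hypothesis, and it cancels
    the factor 1 / F in [ellbar]. So Adot is half of C_{abl|k} y^k. *)
Lemma cartan_deriv1_chart i (W : set TM) (X Y Z : section M) p : open_TM0 W ->
  ssmooth W X -> ssmooth W Y -> ssmooth W Z -> tloc i W p ->
  'D_(p.2, - Gam i p p.2 p.2) (F \o tpsi i) p = 0 ->
  cartan_deriv F D 1 X Y Z (tpsi i p)
  = 2^-1 * horizontal_cartan (Gamma D i) (dfund F i) p p.2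
      (srep i X p) (srep i Y p) (srep i Z p).
Proof.
move=> Wo Xs Ys Zs iWp F0.
have iWo : open (tloc i W) by exact: Wo.2.
have iU q : tloc i W q -> U i q by apply: tloc_sub; exact: Wo.1.
have ip := iU p iWp; have iz := tloc_dom iWp; have pE := tlocK iWp.
set xi := (p.2, - Gam i p p.2 p.2) in F0 *.
have [zq Wz] := iWp; set z := tpsi i p in iz Wz pE *.
have Fn0 : F z != 0 by apply: (F_neq0 hF); exact: Wo.1.
pose f q := dfund F i q (srep i X q) (srep i Y q) (srep i Z q).
have [fd fD] := derive_dfund xi Wo Xs Ys Zs iWp.
pose f0 q : R := (2^-1 * F (tpsi i q)) *: f q.
have Fd : differentiable (F \o tpsi i) p.
  exact: (smooth_on_differentiable (@F_smooth _ _ _ _ hF i)).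
have hFd : differentiable (fun q => 2^-1 * F (tpsi i q)) p.
  exact: (@differentiableZ _ _ _ (F \o tpsi i) (2^-1) p Fd).
have hF0 : 'D_xi (fun q => 2^-1 * F (tpsi i q)) p = 0.
  have dF : derivable (F \o tpsi i) p xi by exact: diff_derivable.
  by apply: (etrans (deriveZ (2^-1 : R) dF)); rewrite F0 scaler0.
have f0d : differentiable f0 p by exact: differentiable_scale.
have f0D : 'D_xi f0 p = (2^-1 * F z) * 'D_xi f p.
  by apply: (etrans (derive_scale xi hFd fd)); rewrite hF0 scale0r add0r.
have cE q : tloc i W q -> f0 q = (cartan F X Y Z \o tpsi i) q.
  by move=> /iU iq; exact: (esym (cartan_chart hF X Y Z iq)).
have cd : differentiable (cartan F X Y Z \o tpsi i) p.
  exact: (open_eq_differentiable iWo iWp cE f0d).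
have xiE : tpush i z (ellbar F D z) = (F z)^-1 *: xi by rewrite -vrepE vrep_ellbar.
have vE : vderiv z (ellbar F D z) (cartan F X Y Z) = 2^-1 * 'D_xi f p.
  have cd' : differentiable (cartan F X Y Z \o tpsi i) (tphi i z) by rewrite pE.
  rewrite (vderiv_chart _ iz cd') xiE pE derive_scalev//.
  rewrite -(open_eq_derive _ iWo iWp cE) f0D -[_ *: _]/(_ * _).
  by rewrite mulrA mulrCA mulVf// mulr1.
have cov1 (T : section M) : ssmooth W T -> srep i (cov D (ellbar F D) T) p
    = (F z)^-1 *: ('D_xi (srep i T) p + Gam i p p.2 (srep i T p)).
  move=> Ts; rewrite (cov_chart Dconn Dtors _ Wo Ts iWp) srep_rho//.
  rewrite vrep_ellbar// -/xi derive_scalev; last first.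
    exact: smooth_on_differentiable (Ts i) iWp.
  rewrite scalerDr; congr (_ + _).
  exact: (linear_funZ _ _ (Gamma_linearl Dconn (srep i T p) ip)).
rewrite -[LHS]/(vderiv z (ellbar F D z) (cartan F X Y Z)
  - cartan F (cov D (ellbar F D) X) Y Z z - cartan F X (cov D (ellbar F D) Y) Z z
  - cartan F X Y (cov D (ellbar F D) Z) z) vE.
rewrite (cartan_chart hF _ Y Z ip) (cartan_chart hF X _ Z ip).
rewrite (cartan_chart hF X Y _ ip) (cov1 X Xs) (cov1 Y Ys) (cov1 Z Zs) fD.
rewrite /horizontal_cartan -/xi -/z.
have Z1 (r : R) u b c : dfund F i p (r *: u) b c = r * dfund F i p u b c.
  exact: (@linear_funZ R V R (fun a => dfund F i p a b c) r u
    (dfund_linear1 hF b c ip)).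
have Z2 (r : R) u a c : dfund F i p a (r *: u) c = r * dfund F i p a u c.
  exact: (@linear_funZ R V R (fun b => dfund F i p a b c) r u
    (dfund_linear2 hF a c ip)).
have Z3 (r : R) u a b : dfund F i p a b (r *: u) = r * dfund F i p a b u.
  exact: (@linear_funZ R V R (dfund F i p a b) r u (dfund_linear3 hF a b ip)).
have D1 u v b c : dfund F i p (u + v) b c = dfund F i p u b c + dfund F i p v b c.
  exact: (@linear_funD R V R (fun a => dfund F i p a b c) u v
    (dfund_linear1 hF b c ip)).
have D2 u v a c : dfund F i p a (u + v) c = dfund F i p a u c + dfund F i p a v c.
  exact: (@linear_funD R V R (fun b => dfund F i p a b c) u v
    (dfund_linear2 hF a c ip)).
have D3 u v a b : dfund F i p a b (u + v) = dfund F i p a b u + dfund F i p a b v.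
  exact: (@linear_funD R V R (dfund F i p a b) u v (dfund_linear3 hF a b ip)).
rewrite Z1 Z2 Z3 D1 D2 D3; move: (F z) Fn0 => r r0.
move: ('D_xi _ p) (dfund F i p _ _ _) (dfund F i p _ _ _) (dfund F i p _ _ _).
move: (dfund F i p _ _ _) (dfund F i p _ _ _) (dfund F i p _ _ _).
by move=> x1 x2 x3 x4 x5 x6 x7; field.
Qed.

End CartanDerivatives.

(** * Shen-type connections *)

(** Koszul's argument: T(d, e, f) = g(A d e - B d e, f) is symmetric in its first two arguments and
    antisymmetric in its last two, hence zero. *)
Lemma levi_civita_unique (R : realType) (n : nat)
    (g : 'rV[R]_n -> 'rV[R]_n -> R) (A B : 'rV[R]_n -> 'rV[R]_n -> 'rV[R]_n) :
  (forall b, linear (fun a => g a b)) -> (forall a b, g a b = g b a) ->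
  (forall a, a != 0 -> 0 < g a a) ->
  (forall a b, A a b = A b a) -> (forall a b, B a b = B b a) ->
  (forall a b c, g (A c a) b + g a (A c b) = g (B c a) b + g a (B c b)) ->
  forall a b, A a b = B a b.
Proof.
move=> gl gsym gpos As Bs gAB a c.
pose T d e f := g (A d e - B d e) f.
have gB u v w : g (u - v) w = g u w - g v w.
  by rewrite (linear_funD _ _ (gl w)) (linear_funN _ (gl w)).
have Tsym d e f : T d e f = T e d f by rewrite /T As Bs.
have Tanti d e f : T d e f = - T d f e.
  have := gAB e f d; rewrite /T !gB (gsym e (A d f)) (gsym e (B d f)).
  move: (g _ f) (g _ f) (g _ e) (g _ e) => x1 x2 x3 x4 h.
  by lra.
(* Six swaps, alternately of the last and of the first two arguments, return to the start with sign
   (-1)^3. *)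
have T0 d e f : T d e f = 0.
  have h1 := Tanti d e f; have h2 := Tsym d f e; have h3 := Tanti f d e.
  have h4 := Tsym f e d; have h5 := Tanti e f d; have h6 := Tsym e d f.
  by move: h1 h2 h3 h4 h5 h6; lra.
apply/eqP; rewrite -subr_eq0; apply: contrapT => /negP d0.
by have := gpos _ d0; rewrite -/(T a c _) T0 ltxx.
Qed.

(** * The defining conditions of a Shen-type connection, read in a chart *)

Section Shen.
Variables (R : realType) (n : nat) (M : manifold R n).
Local Notation V := 'rV[R]_n.
Local Notation TM := (tangent_bundle M).
Variables (F : TM -> R) (m : nat) (kappa : 'I_m -> R) (D : connection_data M).
Hypothesis hF : is_finsler F.
Hypothesis hD : is_shen_connection F kappa D.
Implicit Types (i j : midx M) (z : TM) (p q : V * V) (a b c y : V).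
Local Notation U i := (tloc i (@TM0 R n M)).
Local Notation Gam i p a b := (Gamma D i p a b).
Local Notation S := (shen_tensor F kappa D).

Lemma sharp0 (X Y : section M) z : sharp F (fun _ _ _ _ => 0) X Y z = 0.
Proof.
rewrite /sharp (_ : \row_k _ = 0) ?mul0mx//.
by apply/rowP => k; rewrite !mxE.
Qed.

Lemma shen_connection : is_connection D.
Proof. exact: hD.1.1. Qed.
Let Dconn := shen_connection.

Lemma shen_torsion (W : set TM) (X Y : vfield M) : open_TM0 W ->
  vsmooth W X -> vsmooth W Y -> forall z, W z ->
  cov D X (rho Y) z - cov D Y (rho X) z = rho (bracket X Y) z.
Proof.
move=> Wo Xs Ys z Wz; have [H _] := hD.2 W Wo.
by have := H X Y Xs Ys z Wz; rewrite !sharp0 scaler0 subrr => /subr0_eq.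
Qed.
Let Dtors := shen_torsion.

Let hl (w : section M) : vfield M := fun z => hlift D z (w z).

(** On a horizontal lift mu vanishes, which removes the term A(mu, ., .) of the metric condition. *)
Lemma shen_metric (W : set TM) (w X Y : section M) : open_TM0 W ->
  ssmooth W w -> ssmooth W X -> ssmooth W Y -> forall z, W z ->
  cov_metric F D (hl w) X Y z
  = 2 * cartan F (rho (hl w)) X Y z - 2 * S (rho (hl w)) X Y z.
Proof.
move=> Wo ws Xs Ys z Wz; have [_ H] := hD.2 W Wo.
have z0 : TM0 z by exact: Wo.1.
rewrite (H (hl w) X Y (hlift_smooth Dconn Dtors Wo ws) Xs Ys z Wz).
have mu0 : mu D (hl w) z = 0 by exact: (mu_hlift Dconn Dtors).
have -> : cartan F (mu D (hl w)) X Y z = 0.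
  rewrite /cartan big1// => k _; rewrite big1// => l _; rewrite big1// => h _.
  by rewrite mu0 mxE mulr0 !mul0r.
by rewrite !mulr0 addr0 subr0.
Qed.

Lemma shen_null (W : set TM) (X Y Z : section M) : open_TM0 W ->
  null_or_taut W X -> forall z, W z -> S X Y Z z = 0.
Proof.
move=> Wo KX z Wz; rewrite /shen_tensor big1// => j _.
by rewrite (cartan_deriv_null hF Dconn Dtors _ Wo (or_introl KX) Wz) mulr0.
Qed.

Lemma rho_hl (w : section M) z : TM0 z -> rho (hl w) z = w z.
Proof. by move=> z0; exact: (hlift_fst Dconn Dtors). Qed.

(** [S] keeps whole sections as arguments, and [rho (hl w)] is not replaced by [w]: the two agree on
    TM_0 only, and [S] differentiates its arguments, so values at one point would not determine it.
    The first term on the right is 2 A. *)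
Lemma horizontal_metric_shen i (w : section M) p a b :
  ssmooth (chart_dom i) w -> U i p ->
  horizontal_metric (fund F i) (Gamma D i) p (srep i w p) a b
  = F (tpsi i p) * dfund F i p (srep i w p) a b
    - 2 * S (rho (hl w)) (frame i a) (frame i b) (tpsi i p).
Proof.
move=> ws ip; have oi := open_chart_dom i; have zi := tloc_chart ip.
have [iq z0] := ip; have iz : mdom i (tpsi i p).1 by case: zi.
have fs := @frame_smooth _ _ M i.
have ip' : tloc i (chart_dom i) p by rewrite tloc_chart_domE.
have pE : tphi i (tpsi i p) = p by exact: tpsiK.
have iUo := @U_open _ _ M i.
have mE q : U i q -> fund F i q a b = (metric F (frame i a) (frame i b) \o tpsi i) q.
  move=> iq'; have [iqq _] := iq'; apply: esym.
  by apply: (etrans (metric_chart hF _ _ iq')); rewrite !srep_frame_id.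
have md : differentiable (metric F (frame i a) (frame i b) \o tpsi i) p.
  exact: (open_eq_differentiable iUo ip mE (fund_differentiable hF a b ip)).
have md' : differentiable (metric F (frame i a) (frame i b) \o tpsi i) (tphi i (tpsi i p)).
  by rewrite pE.
have covE c : srep i (cov D (hl w) (frame i c)) p = Gam i p (srep i w p) c.
  rewrite (cov_chart Dconn Dtors _ oi (fs c) ip') srep_frame_id//.
  have cE q : tloc i (chart_dom i) q -> srep i (@frame R n M i c) q = c.
    by move=> [iqq _]; exact: srep_frame_id.
  rewrite (open_eq_derive _ (oi.2 i) ip' cE) derive_cst add0r.
  by rewrite {1}/srep rho_hl.
have := shen_metric oi ws (fs a) (fs b) zi.
rewrite /cov_metric (vderiv_chart _ iz md') pE -vrepE (vrep_hlift Dconn Dtors w ip).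
rewrite -(open_eq_derive _ iUo ip mE).
rewrite (metric_chart hF _ _ ip) (metric_chart hF (frame i a) _ ip).
rewrite (cartan_chart hF _ _ _ ip) !covE !srep_frame_id//.
have -> : srep i (rho (hl w)) p = srep i w p by rewrite {1}/srep rho_hl.
rewrite /horizontal_metric => ->; congr (_ - _).
by rewrite mulrA mulVKf ?pnatr_eq0// -mulrA mulVKf ?pnatr_eq0.
Qed.

(** The metric condition for the tautological section in all three slots: g(y, y) = F^2, the section
    is parallel, and the right-hand side vanishes. Hence the derivative 2 F dF of F^2 along the
    spray is 0, and F can be divided out. *)
Lemma spray_F i p : U i p -> 'D_(p.2, - Gam i p p.2 p.2) (F \o tpsi i) p = 0.
Proof.
move=> ip; have [iq z0] := ip; have To := @open_TM0T _ _ M.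
have ts := @taut_smooth R n M; set z := tpsi i p in z0.
have iz : mdom i z.1 by exact: mpsi_dom.
have pE : tphi i z = p by exact: tpsiK.
have iUo := @U_open _ _ M i.
have rE : forall w, TM0 w -> rho (hl (@taut R n M)) w = taut w.
  by move=> w; exact: rho_hl.
have K : null_or_taut (@TM0 R n M) (rho (hl (@taut R n M))) by right.
have c0 : cartan F (rho (hl (@taut R n M))) (@taut R n M) (@taut R n M) z = 0.
  exact: (cartan_deriv_null hF Dconn Dtors 0 To (or_introl K) z0).
have := shen_metric To ts ts ts z0; rewrite (shen_null _ _ To K z0) c0.
have mu0 : cov D (hl (@taut R n M)) (@taut R n M) z = 0.
  exact: (mu_hlift Dconn Dtors).
have mt0 (X Y : section M) : X z = 0 -> metric F X Y z = 0 /\ metric F Y X z = 0.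
  by move=> X0; rewrite /metric X0 !mul0mx trmx0 mulmx0 mxE.
rewrite /cov_metric; have [-> ->] := mt0 _ (@taut R n M) mu0.
rewrite !mulr0 !subr0.
have mF w : TM0 w -> metric F (@taut R n M) (@taut R n M) w = F w ^+ 2.
  by move=> w0; exact: metric_taut.
rewrite (vderiv_eq _ To z0 mF).
have Fd : differentiable (F \o tpsi i) p.
  exact: (smooth_on_differentiable (@F_smooth _ _ _ _ hF i)).
have F2d : differentiable (Fsq F i) p.
  exact: (smooth_on_differentiable (@Fsq_smooth _ _ _ _ hF i)).
have F2d' : differentiable ((fun z => F z ^+ 2) \o tpsi i) (tphi i z) by rewrite pE.
rewrite (vderiv_chart _ iz F2d') -/z pE -vrepE (vrep_hlift Dconn Dtors _ ip) srep_taut//.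
set xi := (p.2, _) => e.
have e2 : 'D_xi (fun q => (F \o tpsi i) q *: (F \o tpsi i) q) p = 0.
  by rewrite -e; congr ('D_xi _ p); apply/funext => q; rewrite /= expr2.
move: e2; rewrite (derive_scale xi Fd Fd) -/z => /eqP.
have -> : 'D_xi (F \o tpsi i) p *: F z + F z *: 'D_xi (F \o tpsi i) p
    = 2 * F z * 'D_xi (F \o tpsi i) p.
  by rewrite -![_ *: _]/(_ * _) -[X in X + _]/(_ * _); ring.
rewrite !mulf_eq0 pnatr_eq0 /= (negbTE (F_neq0 hF z0)) /=.
by move/eqP.
Qed.

(** * Vanishing hv-curvature implies C = 0 *)

Section CurvatureFree.
Hypothesis P0 : hv_curvature_vanishes D.

(** The curvature is evaluated on the horizontal lift h of a frame section, a constant vertical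
    field v and a frame section Z. D_v Z = 0, and D_{[h, v]} Z = 0 since [h, v] is vertical; - D_v
    D_h Z is minus the fibre derivative of Gamma. *)
Lemma Gamma_vertical_derive i p a c b : U i p ->
  'D_((0, b) : V * V) (fun q => Gam i q a c) p = 0.
Proof.
move=> ip; set W := chart_dom i; have Wo : open_TM0 W := open_chart_dom i.
have zi : W (tpsi i p) by exact: tloc_chart.
have [iz z0] := zi; have ip' : tloc i W p by rewrite tloc_chart_domE.
set X := cfield i (a, 0) : vfield M; set Y := cfield i (0, b) : vfield M.
set Z := frame i c : section M.
have Xs : vsmooth W X by exact: cfield_smooth.
have Ys : vsmooth W Y by exact: cfield_smooth.
have Zs : ssmooth W Z by exact: frame_smooth.
have rX w : W w -> rho X w = frame i a w by move=> [iw _]; rewrite rho_cfield.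
have rY w : W w -> rho Y w = 0.
  by move=> [iw _]; rewrite rho_cfield// /frame tcoord0.
set h := hpart D X; set v := vpart D Y.
have hs : vsmooth W h := hlift_smooth Dconn Dtors Wo (rho_smooth Wo Xs).
have rh w : W w -> rho h w = frame i a w.
  by move=> Ww; rewrite -rX//; apply: rho_hl; exact: Wo.1.
have vY w : W w -> v w = Y w.
  move=> Ww; rewrite /v /vpart /hpart -/(rho Y w) rY// (hlift_chart Dconn Dtors _ Ww).
  have iU : U i (tphi i w) by apply: tlocP; [case: Ww|exact: Wo.1].
  rewrite !tcoord0 (linear_fun0 (Gamma_linearl Dconn _ iU)) oppr0.
  by rewrite (linear_fun0 (tpull_linear _ _)) subr0.
have vs : vsmooth W v by apply: (vsmooth_ext Wo _ Ys) => w /vY.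
have rv w : W w -> rho v w = 0 by move=> Ww; rewrite /rho vY//; exact: rY.
have cZ q : tloc i W q -> srep i Z q = c by move=> [iq _]; exact: srep_frame_id.
have covZ T q : tloc i W q -> srep i (cov D T Z) q = Gam i q (srep i (rho T) q) c.
  move=> iq; rewrite (cov_chart Dconn Dtors _ Wo Zs iq) cZ//.
  by rewrite (open_eq_derive _ (Wo.2 i) iq cZ) derive_cst add0r.
have tc0 w (u : V) : W w -> tcoord (mat w.1) i w.1 u = 0 -> u = 0.
  move=> [iw _] u0; rewrite -(tcoordK u (mat_dom w.1) iw) u0.
  exact: tcoord0.
have vert0 T w : W w -> rho T w = 0 -> cov D T Z w = 0.
  move=> Ww T0; have [iw _] := Ww; apply: (tc0 w) => //.
  have iw' : tloc i W (tphi i w) by exact: tlocP.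
  have := covZ T _ iw'; rewrite /srep tphiK// T0 tcoord0 => ->.
  have iU : U i (tphi i w) by apply: tlocP => //; exact: Wo.1.
  exact: (linear_fun0 (Gamma_linearl Dconn _ iU)).
have := P0 Wo Xs Ys Zs zi; rewrite /hv_curvature /curvature -/h -/v.
(* D_v Z vanishes on all of [W], so its derivative vanishes by locality. *)
have -> : cov D h (cov D v Z) (tpsi i p) = 0.
  rewrite {1}/cov -(connection_local Dconn (Y := fun=> 0) _ Wo zi (ssmooth_cst0 Wo)).
    exact: connection0.
  by move=> w Ww; rewrite vert0//; exact: rv.
rewrite [X in _ - _ - X]vert0//; last first.
  exact: (rho_bracket_vertical Wo (fun w Ww => Ww) hs vs rh rv zi).
rewrite sub0r subr0 => /eqP; rewrite oppr_eq0 => /eqP e.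
have hZs : ssmooth W (cov D h Z) by exact: (cov_smooth Dconn).
have := cov_chart Dconn Dtors v Wo hZs ip'.
have -> : srep i (cov D v (cov D h Z)) p = 0 by rewrite /srep e tcoord0.
have -> : srep i (rho v) p = 0 by rewrite /srep rv// tcoord0.
rewrite (linear_fun0 (Gamma_linearl Dconn _ ip)) addr0.
have vpE : vrep i v p = (0, b) by rewrite vrepE vY// -vrepE vrep_cfield_id//; case: ip.
have hE q : tloc i W q -> srep i (cov D h Z) q = Gam i q a c.
  move=> iq; rewrite covZ// {1}/srep rh; last by case: iq.
  by rewrite -/(srep i (frame i a) q) srep_frame_id//; case: iq.
by rewrite vpE (open_eq_derive _ (Wo.2 i) ip' hE).
Qed.

(** Both A and [S] vanish when the tautological section is inserted, whatever the constants are. *)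
Lemma horizontal_metric_spray i p a b : U i p ->
  horizontal_metric (fund F i) (Gamma D i) p p.2 a b = 0.
Proof.
move=> ip; have [iq z0] := ip.
have ts : ssmooth (chart_dom i) (@taut R n M).
  by apply: ssmooth_sub (@taut_smooth R n M) => z [].
have := horizontal_metric_shen a b ts ip; rewrite srep_taut// => ->.
rewrite dfund_sym12// dfund_sym23// dfund_y// mulr0 sub0r.
have K : null_or_taut (@TM0 R n M) (rho (hl (@taut R n M))).
  by right => w; exact: rho_hl.
by rewrite (shen_null _ _ (@open_TM0T _ _ M) K z0) mulr0 oppr0.
Qed.

Lemma shen_horizontal i p a b c : U i p ->
  horizontal_metric (fund F i) (Gamma D i) p a b c = 0 /\
  horizontal_cartan (Gamma D i) (dfund F i) p p.2 a b c = 0.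
Proof.
move=> ip.
have H1 := @U_open _ _ M i.
have H2 d e : smooth_on (U i) (fun q => fund F i q d e) by exact: fund_smooth.
have H3 q d := @fund_linearl _ _ _ _ hF i q d.
have H4 q d e := @fund_sym _ _ _ _ hF i q d e.
have H5 d e : smooth_on (U i) (fun q => Gam i q d e) by exact: Gamma_smooth.
have H6 q d := @Gamma_linearl _ _ _ _ Dconn i q d.
have H7 q d := @Gamma_linearr _ _ _ _ Dconn i q d.
have H8 q d e l : U i q -> 'D_((0, l) : V * V) (fun r => Gam i r d e) q = 0.
  by move=> iq; exact: Gamma_vertical_derive.
have H9 q d e l : dfund F i q d e l = 'D_((0, l) : V * V) (fun r => fund F i r d e) q.
  by [].
have H10 q d e l := @dfund_sym23 _ _ _ _ hF i q d e l.
have H11 q d e := @dfund_y _ _ _ _ hF i q d e.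
have H12 q d e := @horizontal_metric_spray i q d e.
split.
  exact: (@horizontal_metric0 R n (U i) (fund F i) (Gamma D i) H1 H2 H3 H4 H5 H6
    H7 H8 (dfund F i) H9 H10 H11 H12).
exact: (@horizontal_cartan_spray R n (U i) (fund F i) (Gamma D i) H1 H2 H3 H4 H5
  H6 H7 H8 (dfund F i) H9 H10 H11 H12).
Qed.

Lemma shen_cartan_deriv1 (W : set TM) (X Y Z : section M) : open_TM0 W ->
  ssmooth W X -> ssmooth W Y -> ssmooth W Z ->
  forall z, W z -> cartan_deriv F D 1 X Y Z z = 0.
Proof.
move=> Wo Xs Ys Zs z Wz; set i := mat z.1.
have iz : mdom i z.1 by exact: mat_dom.
have iWp : tloc i W (tphi i z) by exact: tlocP.
have ip : U i (tphi i z) by apply: tlocP => //; exact: Wo.1.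
have zE : tpsi i (tphi i z) = z by exact: tphiK.
rewrite -zE (cartan_deriv1_chart hF Dconn Dtors Wo Xs Ys Zs iWp (spray_F ip)).
by rewrite (shen_horizontal _ _ _ ip).2 mulr0.
Qed.

(** Second use of the metric condition, now in an arbitrary direction: with Q = 0 and all
    derivatives of A zero, it reads F C = 0. *)
Lemma shen_dfund0 i p a b c : U i p -> dfund F i p a b c = 0.
Proof.
move=> ip; have [iq z0] := ip; have zi := tloc_chart ip.
have fs d : ssmooth (chart_dom i) (@frame R n M i d) by exact: frame_smooth.
have Wo := open_chart_dom i.
have := horizontal_metric_shen b c (fs a) ip; rewrite srep_frame_id//.
rewrite (shen_horizontal _ _ _ ip).1.
have -> : S (rho (hl (frame i a))) (frame i b) (frame i c) (tpsi i p) = 0.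
  rewrite /shen_tensor big1// => j _.
  have rs : ssmooth (chart_dom i) (rho (hl (frame i a))).
    by apply: (rho_smooth Wo); exact: (hlift_smooth Dconn Dtors).
  rewrite (cartan_deriv_higher0 hF Dconn Dtors shen_cartan_deriv1 j Wo rs
    (fs b) (fs c) zi).
  by rewrite mulr0.
rewrite mulr0 subr0 => /esym/eqP; rewrite mulf_eq0 (negbTE (F_neq0 hF z0)).
by move/eqP.
Qed.

End CurvatureFree.

(** * A Riemannian metric implies vanishing hv-curvature *)

Section Riemannian.
Hypothesis Friem : is_riemannian F.

Lemma fund_base i p q a b : U i p -> U i q -> p.1 = q.1 ->
  fund F i p a b = fund F i q a b.
Proof.
case: p q => [x y] [x' y'] ip iq /= xx'; subst x'.
rewrite (fund_coord hF a b ip) (fund_coord hF a b iq).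
by rewrite (Friem _ (U_neq0 ip) (U_neq0 iq))//; case: ip.
Qed.

(** With A = 0 and [S] = 0 the metric is parallel, and the vertical part of the horizontal
    derivative is lost on a g that depends on the base point only. This is the equation that
    determines the Levi-Civita connection. *)
Lemma Gamma_metric i p a b c : U i p ->
  fund F i p (Gam i p c a) b + fund F i p a (Gam i p c b)
  = 'D_c (fun x => fund F i (x, p.2) a b) p.1.
Proof.
move=> ip; have [iq z0] := ip.
have fs d : ssmooth (chart_dom i) (@frame R n M i d) by exact: frame_smooth.
have := horizontal_metric_shen a b (fs c) ip; rewrite srep_frame_id//.
have -> : S (rho (hl (frame i c))) (frame i a) (frame i b) (tpsi i p) = 0.
  rewrite /shen_tensor big1// => j _.
  by rewrite (cartan_deriv0 D hF _ (riemannian_dfund hF Friem))// mulr0.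
rewrite (riemannian_dfund hF Friem)// !mulr0 subr0 /horizontal_metric.
have H q : U i q -> fund F i q a b = fund F i (q.1, p.2) a b.
  case: q => x y iqq.
  exact: (fund_base a b iqq (U_fibre iqq (U_neq0 ip)) erefl).
have e := @derive_fst _ _ _ _ _ (fun q => fund F i q a b)
  (fun x => fund F i (x, p.2) a b) p (c, - Gam i p c p.2) (@U_open _ _ M i) ip H.
rewrite [X in X - _ - _]e /= -addrA -opprD => /eqP; rewrite subr_eq0 => /eqP.
by move=> ->.
Qed.

(** At two vectors over the same base point, Gamma solves the same symmetric metric system, and that
    system has only one solution. *)
Lemma Gamma_base z y a c : TM0 z -> y != 0 ->
  Gam (mat z.1) (mphi (mat z.1) z.1, y) a c
  = Gam (mat z.1) (tphi (mat z.1) z) a c.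
Proof.
move=> z0 y0; set i := mat z.1; have iz : mdom i z.1 by exact: mat_dom.
(* [Gamma_sym] is stated in the reference chart of the point; [z'] has the base point of [z], hence
   the same reference chart. *)
pose z' : TM := (z.1, y).
have pE : tphi i z' = (mphi i z.1, y) by rewrite /tphi /= tcoord_id.
rewrite -pE; set p := tphi i z; set p' := tphi i z'.
have ip : U i p by exact: tlocP.
have ip' : U i p' by apply: tlocP.
have s1 d e : Gam i p d e = Gam i p e d by exact: (Gamma_sym Dconn Dtors).
have s2 d e : Gam i p' d e = Gam i p' e d.
  exact: (Gamma_sym Dconn Dtors d e (y0 : TM0 z')).
have gE d e : fund F i p' d e = fund F i p d e by exact: (fund_base d e ip' ip erefl).
have p1 : p.1 = mphi i z.1 by [].
have p1' : p'.1 = mphi i z.1 by [].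
clear pE; clearbody p p'.
have gl b := @fund_linearl _ _ _ _ hF i p b ip.
have gs d b := fund_sym hF d b ip.
have gp d := fund_pos hF ip (a := d).
apply: (@levi_civita_unique _ _ (fund F i p) _ _ gl gs gp s2 s1 _ a c) => d e f.
apply: (etrans (congr2 +%R (esym (gE _ _)) (esym (gE _ _)))).
apply: (etrans (Gamma_metric d e f ip')).
apply: (etrans _ (esym (Gamma_metric d e f ip))); rewrite p1 p1'.
apply: (open_eq_derive f (@mimg_open _ _ M i) (mimg_mphi iz)) => x ix.
have ux y' : y' != 0 -> U i (x, y').
  by move=> y'0; split; [exact: ix|exact/(@tpsi_neq0 _ _ _ i (x, y') ix)].
exact: (fund_base d e (ux _ (U_neq0 ip')) (ux _ (U_neq0 ip)) erefl).
Qed.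

Lemma Gamma_vertical0 z a c b : TM0 z ->
  'D_((0, b) : V * V) (fun q => Gam (mat z.1) q a c) (tphi (mat z.1) z) = 0.
Proof.
move=> z0; set i := mat z.1; have iz : mdom i z.1 by exact: mat_dom.
rewrite [tphi i z]surjective_pairing derive_fibre.
have y0 : (tphi i z).2 != 0.
  by apply: (@U_neq0 _ _ _ i); exact: tlocP.
apply: (etrans (open_eq_derive (g := fun=> Gam i (tphi i z) a c) b (@neq0_open R n) y0 _)).
  by move=> y; exact: Gamma_base.
exact: derive_cst.
Qed.

Lemma srep_mat (T : section M) z : srep (mat z.1) T (tphi (mat z.1) z) = T z.
Proof.
have iz : mdom (mat z.1) z.1 by exact: mat_dom.
by rewrite /srep tphiK// tcoord_id.
Qed.

(** A direct computation in the reference chart at [z], with components H of h, K of v and zeta of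
    Z, where K has no base part. Vertical differentiation is then plain differentiation along K, and
    Gamma enters through H only. *)
Lemma riemannian_curvature : hv_curvature_vanishes D.
Proof.
move=> W X Y Z Wo Xs Ys Zs z Wz; rewrite /hv_curvature /curvature.
set h := hpart D X; set v := vpart D Y; set i := mat z.1; set p := tphi i z.
have iz : mdom i z.1 by exact: mat_dom.
have z0 : TM0 z by exact: Wo.1.
have iWp : tloc i W p by exact: tlocP.
have iWo : open (tloc i W) := Wo.2 i.
have iU q : tloc i W q -> U i q by apply: tloc_sub; exact: Wo.1.
have ip := iU p iWp.
have rVc := @has_coordinates_rV R n; have pc := has_coordinates_prod rVc rVc.
have hs : vsmooth W h := hlift_smooth Dconn Dtors Wo (rho_smooth Wo Xs).
have vs : vsmooth W v.
  move=> j; have jWo : open (tloc j W) := Wo.2 j.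
  have hYs : vsmooth W (hpart D Y) := hlift_smooth Dconn Dtors Wo (rho_smooth Wo Ys).
  apply: (@smooth_on_ext _ _ _ (tloc j W)
    (fun q => vrep j Y q + - vrep j (hpart D Y) q) (vrep j v) jWo).
    move=> q _; rewrite !vrepE /v /vpart.
    have tl := @tpush_linear _ _ M j (tpsi j q).
    by rewrite (linear_funD _ _ tl) (linear_funN _ tl).
  exact: (smooth_on_add jWo (Ys j) (smooth_on_opp jWo (hYs j))).
have rv w : W w -> rho v w = 0.
  move=> Ww; rewrite -[LHS]/((Y w).1 - (hlift D w (Y w).1).1).
  by rewrite (hlift_fst Dconn Dtors) ?subrr//; exact: Wo.1.
pose zeta := srep i Z; pose H := vrep i h; pose K := vrep i v.
have Ks : smooth_on (tloc i W) K := vs i.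
have Hs : smooth_on (tloc i W) H := hs i.
have zs : smooth_on (tloc i W) zeta := Zs i.
have K1 q : tloc i W q -> (K q).1 = 0.
  move=> [iq Wq]; rewrite /K -srep_rho// /srep rv//; exact: tcoord0.
have G0 q c : tloc i W q -> Gam i q 0 c = 0.
  by move=> /iU iq; exact: (linear_fun0 (Gamma_linearl Dconn c iq)).
have cvZ q : tloc i W q -> srep i (cov D v Z) q = 'D_(K q) zeta q.
  move=> iq; rewrite (cov_chart Dconn Dtors _ Wo Zs iq) srep_rho; last by case: iq.
  by rewrite -/K K1// G0// addr0.
have chZ q : tloc i W q -> srep i (cov D h Z) q
    = 'D_(H q) zeta q + Gam i q (H q).1 (zeta q).
  move=> iq; rewrite (cov_chart Dconn Dtors _ Wo Zs iq) srep_rho//; by case: iq.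
have vZs : ssmooth W (cov D v Z) by exact: (cov_smooth Dconn).
have hZs : ssmooth W (cov D h Z) by exact: (cov_smooth Dconn).
have Kd := smooth_on_differentiable Ks iWp.
have Hd := smooth_on_differentiable Hs iWp.
have zd := smooth_on_differentiable zs iWp.
have dzl q : tloc i W q -> linear (fun w => 'D_w zeta q).
  move=> iq s u w; rewrite derive_linear//.
  exact: (smooth_on_differentiable zs).
have dzd w : differentiable ('D_w zeta) p.
  exact: (smooth_on_differentiable (smooth_on_derive w zs) iWp).
have dT (T : V * V -> V * V) xi : differentiable T p ->
    differentiable (fun q => 'D_(T q) zeta q) p /\
    'D_xi (fun q => 'D_(T q) zeta q) p
    = 'D_xi ('D_(T p) zeta) p + 'D_('D_xi T p) zeta p.
  move=> Td; split.
    exact: (@differentiable_app _ _ _ _ _ (fun q w => 'D_w zeta q) T p pc iWo iWp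
      dzl dzd Td).
  exact: (@derive_app _ _ _ _ _ (fun q w => 'D_w zeta q) T p xi pc iWo iWp
    dzl dzd Td).
have t1 : cov D h (cov D v Z) z = 'D_(H p) ('D_(K p) zeta) p
    + 'D_('D_(H p) K p) zeta p + Gam i p (H p).1 ('D_(K p) zeta p).
  rewrite -srep_mat -/i -/p (cov_chart Dconn Dtors _ Wo vZs iWp) srep_rho; last by case: ip.
  apply: congr2; last exact: (congr1 (Gamma D i p (H p).1) (cvZ p iWp)).
  apply: (etrans (open_eq_derive _ iWo iWp cvZ)); exact: (dT K (H p) Kd).2.
have Gd a c : differentiable (fun q => Gam i q a c) p.
  exact: (smooth_on_differentiable (@Gamma_smooth _ _ _ _ Dconn i a c)).
have H1d : differentiable (fst \o H) p.
  have fd : differentiable (fst : V * V -> V) (H p).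
    exact/linear_differentiable/fst_continuous.
  exact: (differentiable_comp Hd fd).
have G1l c q : tloc i W q -> linear (fun a => Gam i q a c).
  by move=> /iU iq; exact: Gamma_linearl.
have G2l q : tloc i W q -> linear (fun c => Gam i q (H q).1 c).
  by move=> /iU iq; exact: Gamma_linearr.
have KpE : K p = (0, (K p).2) by rewrite -(K1 p iWp) -surjective_pairing.
have g1d c : differentiable (fun q => Gam i q (H q).1 c) p.
  exact: (@differentiable_app _ _ _ _ _ (fun q a => Gam i q a c) (fst \o H) p rVc
    iWo iWp (G1l c) (fun a => Gd a c) H1d).
(* The one place where a fibre derivative of Gamma appears, and where its vanishing is used. *)
have g1D c : 'D_(K p) (fun q => Gam i q (H q).1 c) p = Gam i p ('D_(K p) H p).1 c.
  apply: (etrans (@derive_app _ _ _ _ _ (fun q a => Gam i q a c) (fst \o H) p (K p)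
    rVc iWo iWp (G1l c) (fun a => Gd a c) H1d)).
  rewrite {1}KpE Gamma_vertical0// add0r.
  by rewrite (derive_lincomp (K p) (@fst_continuous _ _ _) Hd).
have g2d : differentiable (fun q => Gam i q (H q).1 (zeta q)) p.
  exact: (@differentiable_app _ _ _ _ _ (fun q c => Gam i q (H q).1 c) zeta p rVc
    iWo iWp G2l g1d zd).
have g2D : 'D_(K p) (fun q => Gam i q (H q).1 (zeta q)) p
    = Gam i p ('D_(K p) H p).1 (zeta p) + Gam i p (H p).1 ('D_(K p) zeta p).
  apply: (etrans (@derive_app _ _ _ _ _ (fun q c => Gam i q (H q).1 c) zeta p (K p)
    rVc iWo iWp G2l g1d zd)).
  by rewrite g1D.
have t2 : cov D v (cov D h Z) z = 'D_(K p) ('D_(H p) zeta) p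
    + 'D_('D_(K p) H p) zeta p
    + (Gam i p ('D_(K p) H p).1 (zeta p) + Gam i p (H p).1 ('D_(K p) zeta p)).
  rewrite -srep_mat -/i -/p (cov_chart Dconn Dtors _ Wo hZs iWp) srep_rho; last by case: ip.
  have GK0 : Gam i p (vrep i v p).1 (srep i (cov D h Z) p) = 0.
    exact: (etrans (congr1 (fun a => Gam i p a _) (K1 p iWp)) (G0 p _ iWp)).
  apply: (etrans (congr2 +%R erefl GK0)); rewrite addr0.
  apply: (etrans (open_eq_derive _ iWo iWp chZ)).
  have [d1 e1] := dT H (K p) Hd.
  have d1' : derivable (fun q => 'D_(H q) zeta q) p (K p) by exact: diff_derivable.
  have d2' : derivable (fun q => Gam i q (H q).1 (zeta q)) p (K p) by exact: diff_derivable.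
  exact: (etrans (deriveD d1' d2') (congr2 +%R e1 g2D)).
have t3 : cov D (bracket h v) Z z = 'D_('D_(H p) K p) zeta p
    - 'D_('D_(K p) H p) zeta p - Gam i p ('D_(K p) H p).1 (zeta p).
  rewrite -srep_mat -/i -/p (cov_chart Dconn Dtors _ Wo Zs iWp) srep_rho; last by case: ip.
  have bE : vrep i (bracket h v) p = 'D_(H p) K p - 'D_(K p) H p.
    by rewrite vrepE /p tphiK// /i tpush_mat.
  have B1 : ('D_(H p) K p).1 = 0.
    apply: (etrans (esym (derive_lincomp (H p) (@fst_continuous _ _ _) Kd))).
    apply: (etrans (open_eq_derive _ iWo iWp K1)).
    exact: derive_cst.
  have b1 : (vrep i (bracket h v) p).1 = - ('D_(K p) H p).1.
    by rewrite bE -[LHS]/(_ - _) [X in X - _]B1 sub0r.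
  apply: congr2.
    rewrite bE; apply: (etrans (derive_addv _ _ zd)).
    exact: (congr2 +%R erefl (derive_oppv _ zd)).
  by rewrite b1; exact: (linear_funN _ (G1l (zeta p) p iWp)).
(* [a] and [a'] are the two mixed second derivatives of [zeta]; [b], [d], [e] are cancelled by the
   bracket term, and [c] occurs in both iterated derivatives. *)
have cancel (a b c d e a' T1 T2 T3 : V) : T1 = a + b + c ->
    T2 = a' + d + (e + c) -> T3 = b - d - e -> a' = a -> T1 - T2 - T3 = 0.
  by move=> -> -> -> ->; apply/rowP => k; rewrite !mxE; ring.
exact: (cancel _ _ _ _ _ _ _ _ _ t1 t2 t3
  (derive_swap (H p) (K p) rVc iWo iWp zs)).
Qed.

End Riemannian.
End Shen.

Theorem theorem5p3 (R : realType) (n : nat) (hn : n != 1%N)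
    (M : manifold R n) (F : tangent_bundle M -> R) (hF : is_finsler F)
    (m : nat) (hm : (1 <= m)%N) (kappa : 'I_m -> R)
    (D : connection_data M) (hD : is_shen_connection F kappa D) :
  hv_curvature_vanishes D <-> is_riemannian F.
Proof.
split=> [P0|Friem]; last exact: (riemannian_curvature hF hD Friem).
apply: (dfund0_riemannian hF hn) => i p a b c ip.
exact: (shen_dfund0 hF hD P0).
Qed.
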